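(* Let $p\in(3,\infty)$ and let $\alpha=\alpha(p/(p-1))$, where $\alpha(\cdot)$ is the function on $(1,3/2)$ defined in the context. Then there exist a function $a\in\mathfrak{A}(1,\alpha)$ and a function $f\in L_p(Q)$ such that the equation $$u_t=(a\,u_x)_x+\Lambda f\quad\text{in } Q$$ does not have solutions in the class $\overset{0}{\mathcal{H}}{}^{1}_p(Q)$.
   Context: $Q=(0,1)\times\mathbb{R}$, with points written $(t,x)$. For $0<\beta\le\alpha<\infty$, $\mathfrak{A}(\beta,\alpha)$ is the set of Borel functions $a(t,x)$ on $Q$ with $\beta\le a(t,x)\le\alpha$ for all $(t,x)\in Q$. For $p\in(1,\infty)$, $W^{1,2}_p$ is the Sobolev space of functions $u(t,x)$ on $\mathbb{R}^2$ such that $u,u_x,u_{xx},u_t\in L_p(\mathbb{R}^2)$, and $\overset{0}{W}{}^{1,2}_p(Q)$ is the set of restrictions to $Q$ of functions in $W^{1,2}_p$ that are identically zero for $t\le0$. With $D=\partial/\partial x$, set $\Lambda=(1-D^2)^{1/2}$ (acting in the variable $x$), $H^n_p(\mathbb{R})=\Lambda^{-n}L_p(\mathbb{R})$, and $\overset{0}{\mathcal{H}}{}^{1}_p(Q)=\Lambda\,\overset{0}{W}{}^{1,2}_p(Q)$. For $u\in\overset{0}{\mathcal{H}}{}^{1}_p(Q)$ and $f\in L_p(Q)$, each of $u_t$, $(au_x)_x$, $\Lambda f$ is an $H^{-1}_p(\mathbb{R})$-valued function of $t$ ($u_t$ being the strong $t$-derivative of $u$ as an $H^{-1}_p(\mathbb{R})$-valued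 function), and the equation is understood as an equality of $H^{-1}_p(\mathbb{R})$-valued functions. Definition of $\alpha(\cdot)$. For $\gamma\in(0,1)$ put $\lambda=\gamma-1\in(-1,0)$, $\phi_\lambda(x)=\int_0^\infty e^{-2xr-r^2}r^{-1-\lambda}\,dr$, $u_\lambda(x)=\phi_\lambda(x)+\phi_\lambda(-x)$. There is a unique $c_{0\lambda}>0$ such that $(u_\lambda(x)e^{-x^2})''=0$ at $x=c_{0\lambda}$, and a unique $c_{1\lambda}>0$ such that $(\phi_\lambda(x)e^{-x^2})''=0$ at $x=c_{1\lambda}$. Set $a_{1\gamma}=c_{0\lambda}/c_{1\lambda}$ (one has $a_{1\gamma}>1$) and $\beta(\gamma)=a_{1\gamma}^2$. Fix any function $\gamma:(1,3/2)\to(0,1)$ with $\gamma(q)<\frac3q-2$ for all $q\in(1,3/2)$ and $\lim_{q\downarrow1}\gamma(q)=1$, and set $\alpha(q)=\beta(\gamma(q))$ for $q\in(1,3/2)$. *)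

(* Defs.v *)
From HB Require Import structures.
From mathcomp Require Import all_boot all_order all_algebra.
From mathcomp Require Import all_classical all_reals all_analysis.

Set Implicit Arguments.
Unset Strict Implicit.
Unset Printing Implicit Defensive.

Import Order.TTheory GRing.Theory Num.Theory.
Import numFieldNormedType.Exports.

Local Open Scope classical_set_scope.
Local Open Scope ring_scope.

Notation plane R := (measurableTypeR R * measurableTypeR R)%type.
Notation leb := lebesgue_measure.
Notation leb2 R := (@lebesgue_measure R \x @lebesgue_measure R)%E.

Section Plane.
Context {R : realType}.

(* Points of the plane are pairs (t, x). *)
Definition Q : set (plane R) := [set z | 0 < z.1 < 1].

(* Functions on Q are represented by functions on the plane, whose values
   outside Q are never used. *)
Definition frakA (b al : R) (a : plane R -> R) : Prop :=
  measurable_fun Q a /\ forall z, Q z -> b <= a z <= al.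

Definition LpR (p : R) (h : R -> R) : Prop :=
  (h : measurableTypeR R -> R) \in Lfun leb p%:E.

Definition LpR2 (p : R) (u : plane R -> R) : Prop :=
  u \in Lfun (leb2 R) p%:E.

(* [f \_ Q] is f on Q and 0 elsewhere. *)
Definition LpQ (p : R) (f : plane R -> R) : Prop := LpR2 p (f \_ Q).

Definition dir_t : R * R := (1, 0).
Definition dir_x : R * R := (0, 1).

Definition smooth2 (phi : R * R -> R) : Prop :=
  forall (vs : seq (R * R)) (z : R * R),
    differentiable (foldr (fun v g => 'D_v g) phi vs) z.

Definition test2 (phi : R * R -> R) : Prop :=
  smooth2 phi /\ compact (closure [set z | phi z != 0]).

(* v is the generalized derivative of u in the direction d. *)
Definition weak_deriv (d : R * R) (u v : plane R -> R) : Prop :=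
  forall phi, test2 phi ->
    \int[leb2 R]_z (u z * 'D_d phi z) = - \int[leb2 R]_z (v z * phi z).

Definition W12 (p : R) (u : plane R -> R) : Prop :=
  LpR2 p u /\
  exists ux uxx ut : plane R -> R,
    [/\ LpR2 p ux, LpR2 p uxx & LpR2 p ut] /\
    [/\ weak_deriv dir_x u ux, weak_deriv dir_x ux uxx
      & weak_deriv dir_t u ut].

Definition W12_0 (p : R) (w : plane R -> R) : Prop :=
  exists W : plane R -> R,
    [/\ W12 p W, forall t x, t <= 0 -> W (t, x) = 0
      & forall z, Q z -> w z = W z].

End Plane.

Section Distributions.
Context {R : realType}.

Definition schwartz (phi : R -> R) : Prop :=
  (forall n x, derivable (derive1n n phi) x 1) /\
  (forall m n, exists C, forall x, `|x| ^+ m * `|derive1n n phi x| <= C).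

(* A generalized function on R is given by its values on real Schwartz
   functions; values at other functions are irrelevant, whence [deq]. *)
Definition dist := (R -> R) -> R.

Definition deq (S T : dist) : Prop := forall phi, schwartz phi -> S phi = T phi.

Definition reg (h : R -> R) : dist := fun phi => \int[leb]_x (h x * phi x).

Definition Ddist (T : dist) : dist := fun phi => - T (derive1 phi).

(* (1 - D^2)^(1/2) is the Fourier multiplier with symbol (1 + xi^2)^(1/2);
   as the symbol is even, only the cosine part of exp(i xi (x - y)) survives
   in the inversion formula. *)
Definition Lam (phi : R -> R) : R -> R := fun x =>
  (2 * pi)^-1 * \int[leb]_xi (Num.sqrt (1 + xi ^+ 2) *
                              \int[leb]_y (cos (xi * (x - y)) * phi y)).

(* Lam is symmetric, so it extends to generalized functions by duality. *)
Definition Lamdist (T : dist) : dist := fun phi => T (Lam phi).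

(* The norm of H^{-1}_p(R) = Lam L_p(R), namely the L_p-norm of Lam^{-1} T;
   it is +oo when T is not in H^{-1}_p(R). *)
Definition Hm1norm (p : R) (T : dist) : \bar R :=
  ereal_inf [set Lnorm leb p%:E (fun x : measurableTypeR R => (h x)%:E)
            | h in [set h | LpR p h /\ deq T (Lamdist (reg h))]].

Definition Hm1 (p : R) (T : dist) : Prop :=
  exists2 h, LpR p h & deq T (Lamdist (reg h)).

Definition slice (u : plane R -> R) (t : R) : dist := reg (fun x => u (t, x)).

(* The class Lam W12_0(Q), with Lam acting in x: for w in W12_0, Lam w is again
   (represented by) a function of class L_p(Q), since
   Lam w = Lam^{-1} (w - w_xx). *)
Definition calH1_0 (p : R) (u : plane R -> R) : Prop :=
  LpQ p u /\
  exists2 w, W12_0 p w &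
    {ae leb, forall t : R, 0 < t < 1 -> deq (slice u t) (Lamdist (slice w t))}.

Definition x_deriv (u ux : plane R -> R) : Prop :=
  {ae leb, forall t : R, 0 < t < 1 -> deq (slice ux t) (Ddist (slice u t))}.

(* ut is the strong t-derivative of u on (0, 1), as an H^{-1}_p(R)-valued
   function.  As u is a class of functions modulo null sets, difference
   quotients are those of some version U of t |-> u(t, .); the derivative does
   not depend on the version, up to a null set of t. *)
Definition strong_t_deriv (p : R) (u : plane R -> R) (ut : R -> dist) : Prop :=
  exists U : R -> dist,
    [/\ {ae leb, forall t : R, 0 < t < 1 -> deq (U t) (slice u t)},
        {ae leb, forall t : R, 0 < t < 1 -> Hm1 p (ut t)}
      & {ae leb, forall t : R, 0 < t < 1 ->
          Hm1norm p (fun phi => h^-1 * (U (t + h) phi - U t phi) - ut t phi)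
            @[h --> 0^'] --> 0%E}].

(* u_t = (a u_x)_x + Lam f in Q, for u in the class calH1_0. *)
Definition solves (p : R) (a f u : plane R -> R) : Prop :=
  exists (ut : R -> dist) (ux : plane R -> R),
    [/\ strong_t_deriv p u ut, LpQ p ux, x_deriv u ux
      & {ae leb, forall t : R, 0 < t < 1 ->
          deq (ut t)
              (fun phi => Ddist (slice (fun z => a z * ux z) t) phi
                          + Lamdist (slice f t) phi)}].

End Distributions.

Section Alpha.
Context {R : realType}.

Definition phi_ (lam x : R) : R :=
  \int[leb]_(r in `]0, +oo[) (expR (- 2 * x * r - r ^+ 2) * r `^ (- 1 - lam)).

Definition u_ (lam x : R) : R := phi_ lam x + phi_ lam (- x).

(* The c > 0 at which (g(x) exp(-x^2))'' vanishes; used only where it is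
   unique. *)
Definition inflection (g : R -> R) : R :=
  xget 0 [set c | 0 < c /\ derive1n 2 (fun x => g x * expR (- x ^+ 2)) c = 0].

Definition c0_ (lam : R) : R := inflection (u_ lam).
Definition c1_ (lam : R) : R := inflection (phi_ lam).

Definition a1_ (g : R) : R := c0_ (g - 1) / c1_ (g - 1).
Definition beta_ (g : R) : R := a1_ g ^+ 2.

Definition alpha_ (gamma : R -> R) (q : R) : R := beta_ (gamma q).

End Alpha.

(* Main.v *)
(** Put [q = p / (p - 1)], [g = gamma q] and [s = 1 - t].  The functions
    [phi_lam(x) exp(- x^2)] and [u_lam(x) exp(- x^2)] solve
    [y'' + 2 x y' + 2 g y = 0]; a Wronskian argument orders their inflection
    points as [c1 < c0].  Rescaled copies of them glue into a positive [C^2]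
    profile [h] with [b h'' = - (g / 2) h - (y / 2) h'], where [b] is [1]
    inside and [(c0 / c1)^2] outside: both second derivatives vanish at the
    gluing point, which is what fixes the value [(c0 / c1)^2].  Hence
    [V(t, x) = s^(- g / 2) h(x / sqrt s)] satisfies [V_t + a V_xx = 0] for
    [a(t, x) = b(x / sqrt s)].

    If [u] solved the equation, testing it with [V] (times [1 - delta / s],
    mollified in [x], then [delta -> 0]) would give [0] on the left: the
    remaining term is controlled by [|u_x| V / s], and [g < 3 / q - 2] says
    exactly that [V / s] is in [L_q(Q)].  For [f(t, x) = x exp(- n x^2)] the
    right-hand side is a nonzero multiple of the integral over [Q] of [V K],
    [K(x)] being the integral in [xi] of
    [(1 + xi^2)^(1/2) xi^2 exp(- kap xi^2) cos(xi x)] with [kap = 1 / (4 n)].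
    As [cos z >= 1 - z^2 / 2], that integral is positive for [kap] large,
    a contradiction. *)

Require Import Defs.
From HB Require Import structures.
From mathcomp Require Import all_boot all_order all_algebra.
From mathcomp Require Import all_classical all_reals all_analysis.
From mathcomp Require Import measurable_realfun ring lra.

Set Implicit Arguments.
Unset Strict Implicit.
Unset Printing Implicit Defensive.

Import Order.TTheory GRing.Theory Num.Theory.
Import numFieldNormedType.Exports.

Local Open Scope classical_set_scope.
Local Open Scope ring_scope.



(** * Real-valued integrable functions *)

(** Only [v = u_x] enters the estimates. Formally [v_t = (a v)_xx + Lam f_x], and the adjoint of the
    homogeneous equation is [V_t + a V_xx = 0]. This is why the equation is paired with
    [x]-derivatives of test functions, and why the jump of [a] is harmless: [a] multiplies the
    continuous [V_xx] and is never differentiated. As [V] does not vanish at [t = 1], where it is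
    singular at [x = 0], a boundary term has to be excluded. The factor [1 - delta / s] vanishes at
    [s = delta]; its derivative [- delta / s^2] leaves [- (delta / s) (V / s)], which tends to [0]
    pointwise and is dominated by [V / s] because [delta <= s] on the support. Since [x] scales like
    [sqrt s], the integral of [(V / s)^q] is a multiple of that of [s^(1 / 2 - (g / 2 + 1) q)],
    whence the bound [3 / q - 2] for [g]; a positive [g] below it exists because [q < 3 / 2], that
    is [p > 3]. The test functions [Lam phi] and [V] do not have compact support, so the weak
    derivatives must first be extended beyond the class [test2]. Decay in [x] is measured throughout
    by powers of the single weight [omega]. *)

Definition L1 {d} {T : measurableType d} {R : realType}
  (mu : {measure set T -> \bar R}) (f : T -> R) : Prop :=
  mu.-integrable setT (EFin \o f).

Section L1.
Context d (T : measurableType d) (R : realType) (mu : {measure set T -> \bar R}).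
Implicit Types f g : T -> R.

Lemma L1_meas f : L1 mu f -> measurable_fun setT f.
Proof. by move=> /(measurable_int mu) /measurable_EFinP. Qed.

Lemma L1_dom g f : measurable_fun setT f -> (forall x, `|f x| <= g x) ->
  L1 mu g -> L1 mu f.
Proof.
move=> mf fg ig; apply: (le_integrable measurableT _ _ ig).
  exact/measurable_EFinP.
by move=> x _; rewrite /= lee_fin (le_trans (fg x))// ler_norm.
Qed.

Lemma L1D f g : L1 mu f -> L1 mu g -> L1 mu (fun x => f x + g x).
Proof. by move=> fi gi; exact: (integrableD measurableT fi gi). Qed.

Lemma L1B f g : L1 mu f -> L1 mu g -> L1 mu (fun x => f x - g x).
Proof. by move=> fi gi; exact: (integrableB measurableT fi gi). Qed.

Lemma L1Z c f : L1 mu f -> L1 mu (fun x => c * f x).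
Proof. by move=> fi; exact: (integrableZl measurableT c fi). Qed.

Lemma L1N f : L1 mu f -> L1 mu (fun x => - f x).
Proof.
move=> fi; have := integrableN fi.
by apply: eq_integrable => // x _.
Qed.

Lemma L1_norm f : L1 mu f -> L1 mu (fun x => `|f x|).
Proof. by move=> fi; exact: (integrable_norm fi). Qed.

Lemma eq_L1 f g : f =1 g -> L1 mu f -> L1 mu g.
Proof. by move=> /funext ->. Qed.

Lemma L1Mb C f g : measurable_fun setT f -> (forall x, `|f x| <= C) -> L1 mu g ->
  L1 mu (fun x => f x * g x).
Proof.
move=> mf fC gi; apply: (@L1_dom (fun x => C * `|g x|)).
- by apply: measurable_funM => //; exact: L1_meas.
- by move=> x; rewrite normrM ler_wpM2r.
- exact/L1Z/L1_norm.
Qed.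

Lemma RintD f g : L1 mu f -> L1 mu g ->
  \int[mu]_x (f x + g x) = \int[mu]_x f x + \int[mu]_x g x.
Proof. exact: RintegralD. Qed.

Lemma RintB f g : L1 mu f -> L1 mu g ->
  \int[mu]_x (f x - g x) = \int[mu]_x f x - \int[mu]_x g x.
Proof. exact: RintegralB. Qed.

Lemma RintZ c f : L1 mu f -> \int[mu]_x (c * f x) = c * \int[mu]_x f x.
Proof. exact: RintegralZl. Qed.

Lemma RintN f : L1 mu f -> \int[mu]_x (- f x) = - \int[mu]_x f x.
Proof.
move=> fi; rewrite -mulN1r -RintZ//.
by apply: eq_Rintegral => x _; rewrite mulN1r.
Qed.

Lemma Rint0 : \int[mu]_x (0 : R) = 0.
Proof. by rewrite /Rintegral integral0. Qed.

Lemma Rint_ge0 f : (forall x, 0 <= f x) -> 0 <= \int[mu]_x f x.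
Proof. by move=> f0; exact: Rintegral_ge0. Qed.

Lemma eq_Rint f g : f =1 g -> \int[mu]_x f x = \int[mu]_x g x.
Proof. by move=> /funext ->. Qed.

Lemma eq_Rint_ae f g : measurable_fun setT f -> measurable_fun setT g ->
  {ae mu, forall x, f x = g x} -> \int[mu]_x f x = \int[mu]_x g x.
Proof.
move=> mf mg fg; congr fine; apply: ae_eq_integral => //.
- exact/measurable_EFinP.
- exact/measurable_EFinP.
- by apply: filterS fg => x -> _.
Qed.

Lemma le_Rint f g : L1 mu f -> L1 mu g -> (forall x, f x <= g x) ->
  \int[mu]_x f x <= \int[mu]_x g x.
Proof. by move=> fi gi fg; apply: le_Rintegral. Qed.

Lemma le_norm_Rint f g : L1 mu f -> L1 mu g -> (forall x, `|f x| <= g x) ->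
  `|\int[mu]_x f x| <= \int[mu]_x g x.
Proof.
move=> fi gi fg; apply: le_trans (le_normr_Rintegral measurableT fi) _.
by apply: le_Rint => //; exact: L1_norm.
Qed.

Lemma Rint_EFin f : L1 mu f ->
  (\int[mu]_x (f x)%:E)%E = (\int[mu]_x f x)%:E.
Proof. by move=> fi; rewrite fineK//; exact: integrable_fin_num. Qed.

Lemma Rint_eq0 f : L1 mu f -> (forall x, 0 <= f x) -> \int[mu]_x f x = 0 ->
  {ae mu, forall x, f x = 0}.
Proof.
move=> fi f0 If0.
have : ae_eq mu setT (EFin \o f) (cst 0%E).
  apply/(ae_eq_integral_abs mu measurableT).
    exact: (measurable_int mu).
  rewrite (eq_integral (fun x => (f x)%:E)); last first.
    by move=> x _; rewrite /= ger0_norm.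
  by rewrite Rint_EFin// If0.
by apply: filterS => x /(_ I)[].
Qed.

Lemma Rint_dct (f_ : nat -> T -> R) f g :
  (forall n, measurable_fun setT (f_ n)) ->
  (forall x, f_ n x @[n --> \oo] --> f x) -> L1 mu g ->
  (forall n x, `|f_ n x| <= g x) ->
  \int[mu]_x f_ n x @[n --> \oo] --> \int[mu]_x f x.
Proof.
move=> mf_ cf ig fg.
have mf : measurable_fun setT f.
  by apply: (@measurable_fun_cvg _ _ _ _ f_) => // x _; exact: cf.
have iF : L1 mu f.
  apply: (L1_dom mf _ ig) => x.
  have := cf x; move/cvg_norm => cn.
  by apply: (cvgr_to_le cn); apply: nearW => n; exact: fg.
apply: fine_cvg; rewrite -[X in _ --> X]/((\int[mu]_x f x)%:E) -Rint_EFin//.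
apply: (@dominated_cvg _ _ _ mu setT _ (fun n x => (f_ n x)%:E) _ (EFin \o g)).
- exact: measurableT.
- by move=> n; exact/measurable_EFinP.
- by move=> x _; apply: cvg_EFin; [exact: nearW|exact: cf].
- by [].
- exact: ig.
- by move=> n x _; rewrite /= lee_fin.
Qed.

Lemma ae_imp (P Q : T -> Prop) : (forall x, P x -> Q x) ->
  {ae mu, forall x, P x} -> {ae mu, forall x, Q x}.
Proof. by move=> PQ; apply: filterS. Qed.

Lemma ae_and (P Q : T -> Prop) : {ae mu, forall x, P x} -> {ae mu, forall x, Q x} ->
  {ae mu, forall x, P x /\ Q x}.
Proof. by move=> aP aQ; apply: filterS2 aP aQ. Qed.

Lemma L1_ge0 f : measurable_fun setT f -> (forall x, 0 <= f x) ->
  (\int[mu]_x (f x)%:E < +oo)%E -> L1 mu f.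
Proof.
move=> mf f0 fy; apply/integrableP; split; first exact/measurable_EFinP.
rewrite (eq_integral (fun x => (f x)%:E))// => x _.
by rewrite /= ger0_norm.
Qed.

End L1.

Lemma indic_in {T : Type} {R : realType} (A : set T) (x : T) : A x -> (\1_A x : R) = 1.
Proof. by move=> Ax; rewrite indicE mem_set. Qed.

Lemma indic_notin {T : Type} {R : realType} (A : set T) (x : T) : ~ A x -> (\1_A x : R) = 0.
Proof. by move=> Ax; rewrite indicE memNset. Qed.

Lemma norm_indic_le1 {T : Type} {R : realType} (A : set T) (x : T) : `|\1_A x : R| <= 1.
Proof. by rewrite indicE; case: (_ \in _); rewrite ?normr1 ?normr0. Qed.

Lemma Rint_set {d} {T : measurableType d} {R : realType}
    (mu : {measure set T -> \bar R}) (D : set T) (f : T -> R) :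
  \int[mu]_(x in D) f x = \int[mu]_x (\1_D x * f x).
Proof.
rewrite [LHS]Rintegral_mkcond; apply: eq_Rint => x.
by rewrite patchE indicE; case: (_ \in _); rewrite ?mul1r ?mul0r.
Qed.

(** * Fubini's theorem for real-valued integrals *)

Section prod.
Context d1 d2 (T1 : measurableType d1) (T2 : measurableType d2) (R : realType)
  (m1 : {sigma_finite_measure set T1 -> \bar R})
  (m2 : {sigma_finite_measure set T2 -> \bar R}).

Lemma L1_prod (F : T1 * T2 -> R) (A : T1 -> R) (B : T2 -> R) :
  measurable_fun setT F -> L1 m1 A -> L1 m2 B ->
  (forall x y, `|F (x, y)| <= A x * B y) -> L1 (m1 \x m2)%E F.
Proof.
move=> mF iA iB FAB.
apply/(integrable12ltyP m1 m2); first exact/measurable_EFinP.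
pose a (x : T1) : R := `|A x|; pose b (y : T2) : R := `|B y|.
have ia : L1 m1 a by exact: L1_norm.
have ib : L1 m2 b by exact: L1_norm.
apply: (@le_lt_trans _ _ (\int[m1]_x \int[m2]_y (a x * b y)%:E)%E).
  have mm : measurable_fun [set: T1 * T2] (fun z => (a z.1 * b z.2)%:E).
    apply/measurable_EFinP/measurable_funM.
      by apply: measurableT_comp => //; exact: L1_meas ia.
    by apply: measurableT_comp => //; exact: L1_meas ib.
  apply: ge0_le_integral => //.
  - by move=> x _; apply: integral_ge0 => y _.
  - apply: (measurable_fun_fubini_tonelli_F (m2 := m2) (fun z => `|(F z)%:E|%E)) => //.
    by apply/measurable_EFinP; exact: measurableT_comp.
  - have mm0 z : (0 <= (a z.1 * b z.2)%:E)%E by rewrite lee_fin mulr_ge0 ?normr_ge0.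
    exact: (measurable_fun_fubini_tonelli_F (m2 := m2) _ mm mm0).
  - move=> x _; apply: ge0_le_integral => //.
    + apply: (@measurableT_comp _ _ _ _ _ _ (fun z => `|(F z)%:E|%E) _ (pair x)).
        by apply/measurable_EFinP; exact: measurableT_comp.
      exact: measurable_pair1.
    + apply: (@measurableT_comp _ _ _ _ _ _ (fun z => (a z.1 * b z.2)%:E) _ (pair x)).
        exact: mm.
      exact: measurable_pair1.
    + by move=> y _; rewrite /= lee_fin (le_trans (FAB x y))// (le_trans (ler_norm _))// normrM.
under eq_integral do under eq_integral do rewrite EFinM.
under eq_integral => x _ do rewrite integralZl//.
rewrite (_ : (\int[m2]_x (b x)%:E)%E = (\int[m2]_x b x)%:E); last exact: Rint_EFin.
rewrite integralZr//; rewrite (_ : (\int[m1]_x (a x)%:E)%E = (\int[m1]_x a x)%:E); last exact: Rint_EFin.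
by rewrite -EFinM ltry.
Qed.

Context (F : T1 * T2 -> R) (iF : L1 (m1 \x m2)%E F).

Let H : (\int[m1]_x \int[m2]_y F (x, y)) = \int[(m1 \x m2)%E]_z F z /\
  L1 m1 (fun x => \int[m2]_y F (x, y)).
Proof.
have := integrable_fubini_F iF => iFF.
(* An inner integral may be infinite on a null set of [x], where [fine] replaces it by [0]; the two
   versions agree almost everywhere, which is all the outer integral sees. *)
have E1 : {ae m1, forall x, fubini_F m2 (EFin \o F) x = (\int[m2]_y F (x, y))%:E}.
  have := ae_integrable1 iF; apply: filterS => x ix.
  by rewrite /fubini_F -Rint_EFin.
have mi : measurable_fun setT (fun x => \int[m2]_y F (x, y)).
  exact: (measurableT_comp (fine_measurable measurableT) (measurable_int _ iFF)).
split.
  rewrite /Rintegral -[in RHS](integral12_prod_meas1 iF); congr fine.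
  apply: ae_eq_integral => //.
  - exact/measurable_EFinP.
  - exact: (measurable_int _ iFF).
  - by apply: filterS E1 => x ->.
apply/integrableP; split; first exact/measurable_EFinP.
rewrite (_ : \int[m1]_x _ = \int[m1]_x `|fubini_F m2 (EFin \o F) x|)%E.
  by case/integrableP : iFF.
apply: ae_eq_integral => //.
- by apply/measurable_EFinP; exact: measurableT_comp.
- by apply: measurableT_comp => //; exact: (measurable_int _ iFF).
- by apply: filterS E1 => x ->.
Qed.

Lemma Rint_fubini1 : (\int[m1]_x \int[m2]_y F (x, y)) = \int[(m1 \x m2)%E]_z F z.
Proof. by case: H. Qed.

Lemma L1_fubini1 : L1 m1 (fun x => \int[m2]_y F (x, y)).
Proof. by case: H. Qed.

Lemma ae_L1_fubini1 : {ae m1, forall x, L1 m2 (fun y => F (x, y))}.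
Proof. exact: (ae_integrable1 iF). Qed.

Let K : (\int[m2]_y \int[m1]_x F (x, y)) = \int[(m1 \x m2)%E]_z F z /\
  L1 m2 (fun y => \int[m1]_x F (x, y)).
Proof.
have mF : measurable_fun setT (EFin \o F) by exact: (measurable_int _ iF).
have iFF : m2.-integrable setT (fubini_G m1 (EFin \o F)).
  apply/integrableP; split; first exact: (measurable_fubini_G iF).
  apply: le_lt_trans ((integrable21ltyP m1 m2 mF).1 iF).
  apply: ge0_le_integral => //.
  - by apply: measurableT_comp => //; exact: (measurable_fubini_G iF).
  - exact: (measurable_fun_fubini_tonelli_G (m1 := m1) (fun z => `|(F z)%:E|%E)
      (measurableT_comp (@abse_measurable _ _) mF)).
  - move=> y _; apply: le_abse_integral => //.
    exact: (measurableT_comp mF (pair2_measurable y)).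
have E1 : {ae m2, forall y, fubini_G m1 (EFin \o F) y = (\int[m1]_x F (x, y))%:E}.
  have := ae_integrable2 iF; apply: filterS => x ix.
  by rewrite /fubini_G -Rint_EFin.
have mi : measurable_fun setT (fun y => \int[m1]_x F (x, y)).
  exact: (measurableT_comp (fine_measurable measurableT) (measurable_int _ iFF)).
split.
  rewrite /Rintegral -[in RHS](integral21_prod_meas1 iF); congr fine.
  apply: ae_eq_integral => //.
  - exact/measurable_EFinP.
  - exact: (measurable_int _ iFF).
  - by apply: filterS E1 => x ->.
apply/integrableP; split; first exact/measurable_EFinP.
rewrite (_ : \int[m2]_x _ = \int[m2]_x `|fubini_G m1 (EFin \o F) x|)%E.
  by case/integrableP : iFF.
apply: ae_eq_integral => //.
- by apply/measurable_EFinP; exact: measurableT_comp.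
- by apply: measurableT_comp => //; exact: (measurable_int _ iFF).
- by apply: filterS E1 => x ->.
Qed.

Lemma Rint_fubini2 : (\int[m2]_y \int[m1]_x F (x, y)) = \int[(m1 \x m2)%E]_z F z.
Proof. by case: K. Qed.

Lemma L1_fubini2 : L1 m2 (fun y => \int[m1]_x F (x, y)).
Proof. by case: K. Qed.

Lemma ae_L1_fubini2 : {ae m2, forall y, L1 m1 (fun x => F (x, y))}.
Proof. exact: (ae_integrable2 iF). Qed.

End prod.

(** * Differentiation rules on the line *)

Section derivatives.
Context {R : realType}.
Implicit Types (f g : R -> R) (x : R).

Lemma dcst (c x : R) : is_derive x 1 (fun _ : R => c) 0.
Proof. exact: is_derive_cst. Qed.

Lemma did x : is_derive x 1 (fun y : R => y) 1.
Proof. exact: is_derive_id. Qed.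

Lemma dadd f g x df dg : is_derive x 1 f df -> is_derive x 1 g dg ->
  is_derive x 1 (fun y => f y + g y) (df + dg).
Proof. by move=> ? ?; exact: is_deriveD. Qed.

Lemma dopp f x df : is_derive x 1 f df -> is_derive x 1 (fun y => - f y) (- df).
Proof. by move=> ?; exact: is_deriveN. Qed.

Lemma dmul f g x df dg : is_derive x 1 f df -> is_derive x 1 g dg ->
  is_derive x 1 (fun y => f y * g y) (df * g x + f x * dg).
Proof.
move=> ? ?; apply: is_derive_eq; rewrite addrC; congr (_ + _).
by rewrite /GRing.scale /= mulrC.
Qed.

Lemma dcomp f g x df dg : is_derive (g x) 1 f df -> is_derive x 1 g dg ->
  is_derive x 1 (fun y => f (g y)) (df * dg).
Proof. by move=> ? ?; exact: is_derive1_comp. Qed.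

Lemma dexpn f n x df : is_derive x 1 f df ->
  is_derive x 1 (fun y => f y ^+ n) (n%:R * f x ^+ n.-1 * df).
Proof.
move=> fx; have := is_deriveX n fx.
by rewrite exprfctE.
Qed.

Lemma dexpR g x dg : is_derive x 1 g dg ->
  is_derive x 1 (fun y => expR (g y)) (expR (g x) * dg).
Proof. by move=> ?; apply: dcomp. Qed.

Lemma dcos g x dg : is_derive x 1 g dg ->
  is_derive x 1 (fun y => cos (g y)) (- sin (g x) * dg).
Proof. by move=> ?; apply: dcomp. Qed.

Lemma dsin g x dg : is_derive x 1 g dg ->
  is_derive x 1 (fun y => sin (g y)) (cos (g x) * dg).
Proof. by move=> ?; apply: dcomp. Qed.

Lemma dsqrt g x dg : 0 < g x -> is_derive x 1 g dg ->
  is_derive x 1 (fun y => Num.sqrt (g y)) ((2 * Num.sqrt (g x))^-1 * dg).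
Proof. by move=> g0 ?; apply: dcomp; exact: is_derive1_sqrt. Qed.

Lemma dinv g x dg : g x != 0 -> is_derive x 1 g dg ->
  is_derive x 1 (fun y => (g y)^-1) (- (g x) ^- 2 * dg).
Proof. by move=> g0 ?; exact: is_deriveV. Qed.

Lemma dpowR (a x : R) : 0 < x ->
  is_derive x 1 (fun y => y `^ a) (a * x `^ (a - 1)).
Proof. by move=> x0; exact: is_derive1_powR. Qed.

Lemma is_derive_continuous f df : (forall x : R, is_derive x 1 f (df x)) -> continuous f.
Proof. by move=> dfE x; apply/differentiable_continuous/derivable1_diffP; case: (dfE x). Qed.

Lemma derive1_is_derive f df : (forall x : R, is_derive x 1 f (df x)) -> derive1 f = df.
Proof. by move=> dfE; apply/funext => x; rewrite derive1E; case: (dfE x). Qed.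

Lemma derivable_is_derive f x : derivable f x 1 -> is_derive x 1 f (derive1 f x).
Proof. by move=> fx; apply: DeriveDef => //; rewrite derive1E. Qed.

End derivatives.

(* [notypeclasses], as the instances of [is_derive] would otherwise be tried
   first and produce scalings [_ *: _]. *)
Ltac deriv1 := first
  [ notypeclasses refine (@dcst _ _ _)
  | notypeclasses refine (@did _ _)
  | notypeclasses refine (@dadd _ _ _ _ _ _ _ _)
  | notypeclasses refine (@dopp _ _ _ _ _)
  | notypeclasses refine (@dmul _ _ _ _ _ _ _ _)
  | notypeclasses refine (@dexpR _ _ _ _ _)
  | notypeclasses refine (@dcos _ _ _ _ _)
  | notypeclasses refine (@dsin _ _ _ _ _)
  | notypeclasses refine (@dexpn _ _ _ _ _ _) ].
Ltac deriv := notypeclasses refine (@is_derive_eq _ _ _ _ _ _ _ _ _ _);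
  [ repeat deriv1 | rewrite /= ].
Ltac deriv_with tac := notypeclasses refine (@is_derive_eq _ _ _ _ _ _ _ _ _ _);
  [ repeat first [ tac | deriv1 ] | rewrite /= ].

(** * Integrals over the line *)

Section Lebesgue.
Context {R : realType}.
Notation mu := (@lebesgue_measure R).
Implicit Types (f g F : R -> R) (a b : R).

Lemma cont_meas f : continuous f -> measurable_fun setT f.
Proof. exact: continuous_measurable_fun. Qed.

Lemma L1_cont f g : continuous f -> (forall x, `|f x| <= g x) -> L1 mu g -> L1 mu f.
Proof. by move=> cf; apply: (@L1_dom _ _ _ mu g f); exact: cont_meas. Qed.

Lemma itv_bnd_cvg f : L1 mu f ->
  \int[mu]_x (\1_(`[- n%:R, n%:R]%classic : set R) x * f x) @[n --> \oo] --> \int[mu]_x f x.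
Proof.
move=> fi; apply: (@Rint_dct _ _ _ mu _ _ (fun x => `|f x|)).
- by move=> n; apply: measurable_funM => //; exact: L1_meas fi.
- move=> x; apply: cvg_near_cst; near=> n.
  rewrite indicE mem_set ?mul1r//= in_itv/= -ler_norml.
  by near: n; exact: nbhs_infty_ger.
- exact: L1_norm.
- by move=> n x; rewrite indicE; case: (_ \in _); rewrite ?mul1r ?mul0r ?normr0.
Unshelve. all: by end_near. Qed.

Lemma Rint_itv f a b : \int[mu]_x (\1_(`[a, b]%classic : set R) x * f x) =
  \int[mu]_(x in `[a, b]) f x.
Proof.
rewrite [RHS]Rintegral_mkcond; apply: eq_Rint => x.
by rewrite patchE indicE; case: (_ \in _); rewrite ?mul1r ?mul0r.
Qed.

Lemma FTC2_cont f F a b : a <= b -> continuous f ->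
  (forall x : R, is_derive x 1 F (f x)) -> \int[mu]_(x in `[a, b]) f x = F b - F a.
Proof.
rewrite le_eqVlt => /predU1P[<-|ab] cf dF.
  by rewrite subrr set_itv1 Rintegral_set1.
have cF := is_derive_continuous dF.
rewrite /Rintegral (@continuous_FTC2 _ f F)//.
- exact: continuous_subspaceT.
- split.
  + by move=> x _; case: (dF x).
  + exact/cvg_at_right_filter/cF.
  + exact/cvg_at_left_filter/cF.
- by move=> x _; rewrite (derive1_is_derive dF).
Qed.

(** The one weight that measures decay in [x]: it is integrable, bounded by [1] and, by Peetre's
    inequality below, changes under translations by controlled factors only. *)
Definition omega (x : R) : R := (1 + x ^+ 2)^-1.

Lemma omega_gt0 x : 0 < omega x.
Proof. by rewrite invr_gt0 ltr_wpDr// sqr_ge0. Qed.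

Lemma omega_le1 x : omega x <= 1.
Proof. by rewrite invf_le1 ?lerDl ?sqr_ge0// ltr_wpDr// sqr_ge0. Qed.

Lemma omegaN x : omega (- x) = omega x.
Proof. by rewrite /omega sqrrN. Qed.

Lemma le_omega x y : `|x| <= `|y| -> omega y <= omega x.
Proof.
move=> xy; rewrite lef_pV2 ?posrE ?ltr_wpDr ?sqr_ge0// lerD2l.
by rewrite -(real_normK (num_real x)) -(real_normK (num_real y)) lerXn2r ?nnegrE.
Qed.

Lemma continuous_omega : continuous omega.
Proof. exact: continuous_oneDsqrV. Qed.

(* Peetre's inequality. *)
Lemma omegaM_le x y : omega (x - y) * omega y <= 2 * omega x.
Proof.
rewrite /omega -invfM -ler_pdivrMl// -[2^-1 * _]invfM lef_pV2 ?posrE.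
- have := sqr_ge0 (x - 2 * y); have : 0 <= ((x - y) * y) ^+ 2 by exact: sqr_ge0.
  by move=> h1 h2; nra.
- by rewrite !mulr_gt0// ltr_wpDr// sqr_ge0.
- by rewrite ltr_wpDr// sqr_ge0.
Qed.

Lemma L1_omega : L1 mu omega.
Proof.
apply: (@L1_ge0 _ _ _ mu).
- by apply: cont_meas; exact: continuous_omega.
- by move=> x; exact/ltW/omega_gt0.
rewrite ge0_symfun_integralT.
- rewrite (_ : [set x | 0 <= x] = `[0, +oo[%classic); last first.
    by apply/seteqP; split => x/=; rewrite in_itv/= andbT.
  by rewrite (integral0y_oneDsqr R) -EFinM ltry.
- by move=> x; rewrite ltW// omega_gt0.
- exact: continuous_omega.
- by move=> x /=; rewrite omegaN.
Qed.

Lemma omega_cvg0 : omega n%:R @[n --> \oo] --> (0 : R).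
Proof.
apply: (@squeeze_cvgr _ _ _ _ (cst 0) (fun n => (n.+1%:R)^-1)).
- near=> n; rewrite ltW ?omega_gt0//= lef_pV2 ?posrE// ?ltr_wpDr ?sqr_ge0//.
  rewrite -natrX -[1 in leRHS]/(1%:R) -natrD ler_nat add1n ltnS.
  by rewrite -[leqLHS]expn1 leq_pexp2l//; near: n; exact: nbhs_infty_gt.
- exact: cvg_cst.
- exact: cvg_harmonic.
Unshelve. all: by end_near. Qed.

(** A primitive bounded by a multiple of [omega] vanishes at both infinities. The integrations by
    parts on the whole line are instances, with [F] a product. *)
Lemma Rint_derive0 F f C : (forall x : R, is_derive x 1 F (f x)) -> continuous f ->
  L1 mu f -> (forall x, `|F x| <= C * omega x) -> \int[mu]_x f x = 0.
Proof.
move=> dF cf fi FC; apply: cvg_unique (itv_bnd_cvg fi) _ => //.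
rewrite (_ : (fun n : nat => _) = (fun n => F n%:R - F (- n%:R))); last first.
  apply/funext => n; rewrite Rint_itv (FTC2_cont _ cf dF)//.
  by rewrite ge0_cp.
apply: norm_cvg0.
have c0 : 2 * C * omega n%:R @[n --> \oo] --> (0 : R).
  by rewrite -[0](mulr0 (2 * C)); apply: cvgM; [exact: cvg_cst|exact: omega_cvg0].
apply: (squeeze_cvgr _ (cvg_cst _) c0).
near=> n; rewrite normr_ge0/= (le_trans (ler_normB _ _))//.
rewrite -mulrA mulr_natl mulr2n lerD ?FC//.
by rewrite (le_trans (FC _))// omegaN.
Unshelve. all: by end_near. Qed.

End Lebesgue.

Section calculus.
Context {R : realType}.
Notation mu := (@lebesgue_measure R).
Implicit Types (f g F : R -> R) (a b : R).

(** Serves for functions with a singularity: truncations away from it are integrated explicitly by a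
    primitive, with a bound independent of the truncation. *)
Lemma L1_fatou d (T : measurableType d) (nu : {measure set T -> \bar R})
    (f_ : nat -> T -> R) (f : T -> R) C :
  (forall n, L1 nu (f_ n)) -> (forall n x, 0 <= f_ n x) ->
  (forall x, f_ n x @[n --> \oo] --> f x) ->
  (forall n, \int[nu]_x f_ n x <= C) -> L1 nu f.
Proof.
move=> if_ f_0 cf fC.
have mf : measurable_fun setT f.
  by apply: (@measurable_fun_cvg _ _ _ _ f_) => [n|x _]; [exact: L1_meas|exact: cf].
have f0 x : 0 <= f x.
  by apply: (cvgr_to_ge (cf x)); apply: nearW => n; exact: f_0.
apply: L1_ge0 => //.
have E x : limn_einf (fun n => (f_ n x)%:E) = (f x)%:E.
  have cx : (f_ n x)%:E @[n --> \oo] --> (f x)%:E.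
    by apply: cvg_EFin; [exact: nearW|exact: cf].
  by rewrite is_cvg_limn_einfE; [exact/cvg_lim|apply/cvg_ex; exists (f x)%:E].
rewrite (eq_integral (fun x => limn_einf (fun n => (f_ n x)%:E))); last first.
  by move=> x _; rewrite E.
apply: le_lt_trans (ltry C).
apply: (le_trans (@fatou _ _ _ nu setT measurableT (fun n x => (f_ n x)%:E) _ _)).
- by move=> n; apply/measurable_EFinP; exact: L1_meas.
- by move=> n x _; rewrite lee_fin.
rewrite limn_einf_lim; apply: lime_le; first exact: is_cvg_einfs.
apply: nearW => n; apply: (@le_trans _ _ (\int[nu]_x (f_ n x)%:E)%E).
  by apply: ereal_inf_lbound; exists n => /=.
by rewrite Rint_EFin// lee_fin.
Qed.

Lemma mvt f (df : R -> R) a b : a < b -> (forall x : R, is_derive x 1 f (df x)) ->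
  exists2 c, a < c < b & f b - f a = df c * (b - a).
Proof.
move=> ab dfE; have [|c] := @MVT R f df a b ab (fun x _ => dfE x).
  by apply: continuous_subspaceT; exact: is_derive_continuous dfE.
by rewrite in_itv => cab E; exists c.
Qed.

Lemma FTC2_in f F a b : a <= b ->
  (forall x : R, a <= x <= b -> is_derive x 1 F (f x)) ->
  (forall x : R, a <= x <= b -> {for x, continuous f}) ->
  \int[mu]_(x in `[a, b]) f x = F b - F a.
Proof.
rewrite le_eqVlt => /predU1P[<-|ab] dF cf.
  by rewrite subrr set_itv1 Rintegral_set1.
have cF x : a <= x <= b -> {for x, continuous F}.
  by move=> /dF[+ _]; move=> /derivable1_diffP/differentiable_continuous.
rewrite /Rintegral (@continuous_FTC2 _ f F)//.
- by apply: continuous_in_subspaceT => x /[!inE]/=; rewrite in_itv; exact: cf.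
- split.
  + by move=> x; rewrite in_itv/= => /andP[ax xb]; case: (dF x) => //; rewrite !ltW.
  + by apply/cvg_at_right_filter/cF; rewrite lexx ltW.
  + by apply/cvg_at_left_filter/cF; rewrite lexx ltW.
- move=> x; rewrite in_itv/= => /andP[ax xb].
  by rewrite derive1E; case: (dF x) => //; rewrite !ltW.
Qed.

Lemma L1_itv f a b : (forall x : R, a <= x <= b -> {for x, continuous f}) ->
  L1 mu (fun x => \1_(`[a, b]%classic : set R) x * f x).
Proof.
move=> cf.
have fi : mu.-integrable `[a, b] (EFin \o f).
  apply: continuous_compact_integrable; first exact: segment_compact.
  by apply: continuous_in_subspaceT => x /[!inE]/=; rewrite in_itv; exact: cf.
have := (@integrable_mkcond _ _ _ mu `[a, b] (EFin \o f) (measurable_itv _)).1 fi.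
apply: eq_integrable => // x _ /=; rewrite restrict_EFin /= patchE indicE.
by case: (_ \in _); rewrite ?mul1r ?mul0r.
Qed.

Lemma Rint_derive d (T : measurableType d) (nu : {measure set T -> \bar R})
    (f df : R -> T -> R) a e (G : T -> R) : 0 < e ->
  (forall x, `|x - a| < e -> L1 nu (f x)) ->
  (forall (x : R) y, `|x - a| < e -> is_derive x 1 (f^~ y) (df x y)) ->
  (forall x y, `|x - a| < e -> `|df x y| <= G y) -> L1 nu G ->
  is_derive a 1 (fun x => \int[nu]_y f x y) (\int[nu]_y df a y).
Proof.
move=> e0 fi dfE dfG Gi.
have I x : `](a - e), (a + e)[%classic x -> `|x - a| < e.
  by rewrite /= in_itv/= => /andP[? ?]; rewrite ltr_norml; apply/andP; split; lra.
have Ia : `](a - e), (a + e)[%classic a by rewrite /= in_itv/=; apply/andP; split; lra.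
have G0 y : 0 <= G y by apply: le_trans (dfG a y _); rewrite ?subrr ?normr0.
have pE x y : `](a - e), (a + e)[%classic x -> partial1of2 f x y = df x y.
  by move=> /I xa; rewrite partial1of2E; case: (dfE x y xa).
have d1 x y : `](a - e), (a + e)[%classic x -> setT y -> derivable (f ^~ y) x 1.
  by move=> /I xa _; case: (dfE x y xa).
have b1 x y : `](a - e), (a + e)[%classic x -> setT y -> `|partial1of2 f x y| <= G y.
  by move=> xI _; rewrite pE// dfG//; exact: I.
have fi' x : `](a - e), (a + e)[%classic x -> nu.-integrable setT (EFin \o f x).
  by move=> /I; exact: fi.
have [D1 D2] := (derivable_under_integral measurableT Ia fi' d1 G0 Gi b1,
   differentiation_under_integral measurableT Ia fi' d1 G0 Gi b1).
apply: DeriveDef => //; rewrite -derive1E D2.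
by apply: eq_Rintegral => y _; rewrite pE.
Qed.

Lemma Rint_cont d (T : measurableType d) (nu : {measure set T -> \bar R})
    (f : R -> T -> R) (G : T -> R) :
  (forall x, measurable_fun setT (f x)) -> (forall y, continuous (f^~ y)) ->
  (forall x y, `|f x y| <= G y) -> L1 nu G ->
  continuous (fun x => \int[nu]_y f x y).
Proof.
move=> mf cf fG Gi x; apply/(@cvg_nbhsP _ R^o) => u ux.
apply: (@Rint_dct _ _ _ nu _ _ G) => // y.
by have /(@cvg_nbhsP _ R^o) := cf y x; apply.
Qed.

End calculus.

(** * Gaussian bounds and improper integrals *)

Section bounds.
Context {R : realType}.
Notation mu := (@lebesgue_measure R).

(** From [y <= expR y] at [y = x / n], raised to the power [n]. *)
Lemma expn_le_expR n (x : R) : 0 <= x -> x ^+ n <= n%:R ^+ n * expR x.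
Proof.
move=> x0; case: n => [|n]; first by rewrite !expr0 mul1r -expR0 ler_expR.
have -> : expR x = expR (x / n.+1%:R) ^+ n.+1.
  by rewrite -expRM_natl mulrCA divff ?mulr1// pnatr_eq0.
have e1 : x / n.+1%:R <= expR (x / n.+1%:R).
  by apply: le_trans (expR_ge1Dx _); rewrite lerDr.
rewrite -exprMn lerXn2r ?nnegrE ?mulr_ge0 ?expR_ge0//.
by rewrite mulrC -ler_pdivrMr// ltr0n.
Qed.

(** Every factor is dominated by an exponential: [|x|^n] by [n^n exp |x|], and [(1 + x^2)^m] by
    [exp (2 m |x|)]. The resulting exponent [b |x| - k x^2] is at most [b^2 / (4 k)], by completing
    the square. *)
Lemma gauss_bound (k c : R) n m : 0 < k ->
  exists2 C : R, 0 <= C & forall x : R,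
    `|x| ^+ n * expR (c * `|x| - k * x ^+ 2) <= C * omega x ^+ m.
Proof.
move=> k0; pose b := 1 + c + 2 * m%:R.
exists (n%:R ^+ n * expR (b ^+ 2 / (4 * k))); first by rewrite mulr_ge0 ?exprn_ge0 ?expR_ge0.
move=> x; rewrite /omega exprVn ler_pdivlMr ?exprn_gt0 ?ltr_wpDr ?sqr_ge0//.
have h1 := expn_le_expR n (normr_ge0 x).
have h2 : (1 + x ^+ 2) ^+ m <= expR (2 * m%:R * `|x|).
  rewrite -mulrA mulrCA expRM_natl lerXn2r ?nnegrE ?addr_ge0 ?sqr_ge0 ?expR_ge0//.
  rewrite expRM_natl; apply: (@le_trans _ _ ((1 + `|x|) ^+ 2)).
    rewrite sqrrD real_normK ?num_real// expr1n -addrA lerD2l lerDr mul1r.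
    by rewrite mulrn_wge0.
  by rewrite lerXn2r ?nnegrE ?addr_ge0 ?expR_ge0// expR_ge1Dx.
apply: (@le_trans _ _ ((n%:R ^+ n * expR `|x|) * expR (c * `|x| - k * x ^+ 2)
   * expR (2 * m%:R * `|x|))).
  apply: ler_pM (ler_wpM2r (expR_ge0 _) h1) h2.
    by apply: mulr_ge0; [exact: exprn_ge0|exact: expR_ge0].
  by apply: exprn_ge0; rewrite addr_ge0// sqr_ge0.
rewrite -!mulrA ler_wpM2l ?exprn_ge0// -!expRD ler_expR.
rewrite -(real_normK (num_real x)) [leRHS]mulrA ler_pdivlMr ?mulr_gt0//.
have := sqr_ge0 (b - 2 * k * `|x|); rewrite /b; nra.
Qed.

Lemma powR_cont (e x : R) : 0 < x -> {for x, continuous (fun r : R => r `^ e)}.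
Proof.
by move=> x0; apply/differentiable_continuous/derivable1_diffP; case: (dpowR e x0).
Qed.

(** The half-line is exhausted by the intervals [[1 / (n + 1), n + 1]], since the integrands at hand
    are powers singular at [0]. *)
Lemma FTC_pos (f F : R -> R) (l0 l1 : R) : (forall r : R, 0 < r -> is_derive r 1 F (f r)) ->
  (forall r : R, 0 < r -> {for r, continuous f}) ->
  L1 mu (fun r => \1_(`]0, +oo[%classic : set R) r * f r) ->
  F (n.+1%:R^-1) @[n --> \oo] --> l0 -> F (n.+1%:R) @[n --> \oo] --> l1 ->
  \int[mu]_r (\1_(`]0, +oo[%classic : set R) r * f r) = l1 - l0.
Proof.
move=> dF cf fi c0 c1.
have ab n : (n.+1%:R^-1 : R) <= n.+1%:R.
  by rewrite (@le_trans _ _ 1)// ?ler1n// invf_le1 ?ler1n.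
pose A n : set R := `[n.+1%:R^-1, n.+1%:R]%classic.
have AE n : \int[mu]_r (\1_(A n) r * f r) = F n.+1%:R - F n.+1%:R^-1.
  rewrite Rint_itv; apply: FTC2_in => // x /andP[x1 _].
    by apply: dF; apply: lt_le_trans x1; rewrite invr_gt0.
  by apply: cf; apply: lt_le_trans x1; rewrite invr_gt0.
have c2 : \int[mu]_r (\1_(A n) r * f r) @[n --> \oo] --> l1 - l0.
  rewrite (_ : (fun n : nat => _) = (fun n => F n.+1%:R - F n.+1%:R^-1)); last first.
    by apply/funext => n; rewrite AE.
  exact: cvgB.
apply: (cvg_unique _ _ c2) => //.
apply: (@Rint_dct _ _ _ mu _ _ (fun r => `|\1_(`]0, +oo[%classic : set R) r * f r|)).
- move=> n; apply: L1_meas; apply: L1_itv => x /andP[x1 _].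
  by apply: cf; apply: lt_le_trans x1; rewrite invr_gt0.
- move=> x; apply: cvg_near_cst; have [x0|x0] := ltP 0 x.
    have xp : `]0, +oo[%classic x by rewrite /= in_itv/= x0.
    near=> n; rewrite !indicE (mem_set xp).
    suff xA : A n x by rewrite (mem_set xA).
    rewrite /A/= in_itv/=; apply/andP; split.
      by rewrite ltW//; near: n; exact: (near_infty_natSinv_lt (PosNum x0)).
    apply: (@le_trans _ _ n%:R); last by rewrite ler_nat.
    by near: n; exact: nbhs_infty_ger.
  near=> n; rewrite !indicE.
  rewrite memNset; last first.
    rewrite /A/= in_itv/= => /andP[+ _]; apply/negP; rewrite -ltNge.
    by rewrite (le_lt_trans x0)// invr_gt0.
  by rewrite memNset// /= in_itv/= andbT; apply/negP; rewrite -leNgt.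
- exact: L1_norm.
- move=> n x; have [x0|x0] := ltP 0 x.
    have xp : `]0, +oo[%classic x by rewrite /= in_itv/= x0.
    rewrite [\1_(`]0, +oo[%classic) x]indicE (mem_set xp) mul1r indicE.
    by case: (_ \in _); rewrite ?mul1r ?mul0r ?normr0.
  rewrite indicE memNset ?mul0r ?normr0// /A/= in_itv/=.
  by move=> /andP[+ _]; apply/negP; rewrite -ltNge (le_lt_trans x0)// invr_gt0.
Unshelve. all: by end_near. Qed.

End bounds.

(** * The integrals defining [phi_lam], and the self-similar equation *)

Section weights.
Context {R : realType}.
Notation mu := (@lebesgue_measure R).

Lemma L1_powR01 (e : R) : -1 < e ->
  L1 mu (fun s => \1_(`]0, 1]%classic : set R) s * s `^ e).
Proof.
move=> e1; have e0 : 0 < e + 1 by lra.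
pose A n : set R := `[n.+1%:R^-1, 1]%classic.
have ab n : (n.+1%:R^-1 : R) <= 1 by rewrite invf_le1 ?ler1n.
have An n (x : R) : n.+1%:R^-1 <= x <= 1 -> 0 < x.
  by move=> /andP[x1 _]; apply: lt_le_trans x1; rewrite invr_gt0.
apply: (@L1_fatou _ _ _ mu (fun n s => \1_(A n) s * s `^ e) _ (e + 1)^-1).
- by move=> n; apply: L1_itv => x /An; exact: powR_cont.
- by move=> n x; rewrite mulr_ge0// powR_ge0.
- move=> x; apply: cvg_near_cst; have [x0|x0] := ltP 0 x.
    have [x1|x1] := leP x 1.
      have xp : `]0, 1]%classic x by rewrite /= in_itv/= x0.
      near=> n; rewrite !indicE (mem_set xp).
      suff xA : A n x by rewrite (mem_set xA).
      rewrite /A/= in_itv/= x1 andbT.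
      by rewrite ltW//; near: n; exact: (near_infty_natSinv_lt (PosNum x0)).
    near=> n; rewrite !indic_notin// /A/= in_itv/= => /andP[_];
      by apply/negP; rewrite -ltNge.
  near=> n; rewrite !indic_notin// /A/= in_itv/= => /andP[+ _]; apply/negP.
    by rewrite -leNgt.
  by rewrite -ltNge (le_lt_trans x0)// invr_gt0.
- move=> n; rewrite Rint_itv.
  pose F (s : R) := (e + 1)^-1 * s `^ (e + 1).
  have dF (x : R) : n.+1%:R^-1 <= x <= 1 -> is_derive x 1 F (x `^ e).
    move=> /An x0; apply: is_derive_eq; first by apply: dmul; exact: dpowR.
    by rewrite mul0r add0r mulrA mulVf ?mul1r ?gt_eqF// addrK.
  rewrite (FTC2_in (ab n) dF (fun x h => @powR_cont _ e x (An n x h))) /F.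
  by rewrite powR1 mulr1 gerBl mulr_ge0 ?powR_ge0// invr_ge0 ltW.
Unshelve. all: by end_near. Qed.

Context (g : R) (g01 : 0 < g < 1).

(** With [lam = g - 1] this is the factor [r^(- 1 - lam)] of [phi_], set to [0] off the open
    half-line. *)
Definition wt (r : R) : R := \1_(`]0, +oo[%classic : set R) r * r `^ (- g).

Lemma wtN r : r <= 0 -> wt r = 0.
Proof.
move=> r0; rewrite /wt indicE memNset ?mul0r//= in_itv/= andbT.
by apply/negP; rewrite -leNgt.
Qed.

Lemma wtE r : 0 < r -> wt r = r `^ (- g).
Proof. by move=> r0; rewrite /wt indicE mem_set ?mul1r//= in_itv/= r0. Qed.

Lemma wt_ge0 r : 0 <= wt r.
Proof. by rewrite mulr_ge0 ?powR_ge0. Qed.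

Lemma measurable_wt : measurable_fun setT wt.
Proof. by apply: measurable_funM => //; exact: measurable_powR. Qed.

Lemma L1_wt (h : R -> R) (C : R) : measurable_fun setT h -> (forall r, `|h r| <= C * omega r) ->
  L1 mu (fun r => wt r * h r).
Proof.
move=> mh hC; have C0 : 0 <= C.
  by have := hC 0; rewrite /omega expr0n/= addr0 invr1 mulr1; apply: le_trans.
apply: (@L1_dom _ _ _ mu (fun s => C * (\1_(`]0, 1]%classic : set R) s * s `^ (- g)) + C * omega s)).
- by apply: measurable_funM => //; exact: measurable_wt.
- move=> r /=; rewrite normrM (ger0_norm (wt_ge0 r)).
  have [r0|r0] := ltP 0 r; last first.
    by rewrite wtN// mul0r addr_ge0 ?mulr_ge0 ?powR_ge0// ltW// omega_gt0.
  rewrite wtE//; have [r1|r1] := leP r 1.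
    rewrite indic_in; last by rewrite /= in_itv/= r0.
    rewrite mul1r; apply: (@le_trans _ _ (C * r `^ (- g))).
      by rewrite mulrC ler_wpM2r ?powR_ge0// (le_trans (hC r))// ler_piMr// omega_le1.
    by rewrite lerDl mulr_ge0// ltW// omega_gt0.
  apply: (@le_trans _ _ (C * omega r)).
    rewrite -[leRHS]mul1r ler_pM ?powR_ge0//.
    have : - g <= 0 by case/andP: g01 => g0 _; rewrite lerNl oppr0 ltW.
    by move=> /(ler_powR (ltW r1)); rewrite powRr0.
  by rewrite lerDr mulr_ge0// mulr_ge0// powR_ge0.
- apply: L1D; last exact/L1Z/L1_omega.
  by apply: L1Z; apply: L1_powR01; case/andP: g01; lra.
Qed.

Definition Jint (j : nat) (x r : R) : R := r ^+ j * expR (- 2 * x * r - r ^+ 2).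
(** [J 0] is [phi_ (g - 1)], see [phi_E]; by [dJ] its [j]-th derivative is [(-2)^j] times [J j]. *)
Definition J j x : R := \int[mu]_r (wt r * Jint j x r).
(** A majorant uniform in [|x| <= X], as differentiation under the integral requires. *)
Definition Jbnd j X r : R := wt r * (`|r| ^+ j * expR (2 * X * `|r| - 1 * r ^+ 2)).

Lemma L1_Jbnd j X : L1 mu (Jbnd j X).
Proof.
have [C C0 HC] := gauss_bound (2 * X) j 1 (ltr01 : 0 < 1 :> R).
apply: (@L1_wt _ C) => [|r]; last first.
  by rewrite -[omega r]expr1 ger0_norm// mulr_ge0// expR_ge0.
apply: measurable_funM; first by apply: measurable_funX; exact: normr_measurable.
apply: measurableT_comp => //; apply: measurable_funB.
  by apply: measurable_funM => //; exact: normr_measurable.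
by apply: measurable_funM => //; exact: measurable_funX.
Qed.

Lemma cont_Jint j x : continuous (Jint j x).
Proof.
have : forall r : R, is_derive r 1 (Jint j x)
  (j%:R * r ^+ j.-1 * expR (- 2 * x * r - r ^+ 2) +
   r ^+ j * (expR (- 2 * x * r - r ^+ 2) * (- 2 * x - 2 * r))).
  by move=> r; deriv; ring.
exact: is_derive_continuous.
Qed.

Lemma measurable_Jint j x : measurable_fun setT (fun r => wt r * Jint j x r).
Proof.
by apply: measurable_funM; [exact: measurable_wt|by apply: cont_meas; exact: cont_Jint].
Qed.

Lemma Jint_bnd j x X r : `|x| <= X -> `|wt r * Jint j x r| <= Jbnd j X r.
Proof.
move=> xX; rewrite normrM ger0_norm ?wt_ge0// ler_wpM2l ?wt_ge0//.
rewrite normrM normrX ler_wpM2l// ger0_norm ?expR_ge0// ler_expR mul1r lerD2r.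
rewrite -mulrA -mulrA mulNr -mulrN ler_wpM2l//.
rewrite (le_trans (ler_norm _))// normrN normrM ler_wpM2r//.
Qed.

Lemma L1_J j x : L1 mu (fun r => wt r * Jint j x r).
Proof.
apply: (@L1_dom _ _ _ mu (Jbnd j `|x|)).
- exact: measurable_Jint.
- by move=> r; exact: Jint_bnd.
- exact: L1_Jbnd.
Qed.

Lemma dJ j (x : R) : is_derive x 1 (J j) (-2 * J j.+1 x).
Proof.
apply: is_derive_eq.
  apply: (@Rint_derive R _ _ mu (fun x r => wt r * Jint j x r)
    (fun x r => wt r * (- 2 * Jint j.+1 x r)) x 1 (fun r => 2 * Jbnd j.+1 (`|x| + 1) r)) => //.
  - by move=> y _; exact: L1_J.
  - by move=> y r _; rewrite /Jint [r ^+ j.+1]exprS; deriv; ring.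
  - move=> y r yx; rewrite mulrCA normrM normrN (ger0_norm (ler0n _ 2)) ler_wpM2l//.
    apply: Jint_bnd; rewrite addrC -lerBlDr (le_trans _ (ltW yx))//.
    exact: lerB_dist.
  - exact/L1Z/L1_Jbnd.
rewrite -RintZ; last exact: L1_J.
by apply: eq_Rint => r; rewrite mulrCA.
Qed.

(** A nonnegative function of zero integral vanishes almost everywhere, whereas this one is positive
    on []0, 1[]. The same argument recurs for the other strict inequalities between integrals. *)
Lemma J_gt0 j x : 0 < J j x.
Proof.
have J0 r : 0 <= wt r * Jint j x r.
  have [r0|r0] := ltP 0 r; last by rewrite wtN ?mul0r.
  by rewrite mulr_ge0 ?wt_ge0// mulr_ge0 ?expR_ge0// exprn_ge0// ltW.
rewrite lt_neqAle Rint_ge0// andbT; apply/negP => /eqP/esym E.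
have := Rint_eq0 (L1_J j x) J0 E.
move=> [N [mN N0 sN]].
have : (mu (`]0%R, 1%R[%classic : set R) <= mu N)%E.
  apply: le_measure; rewrite ?inE//; apply: subset_trans sN => r /=.
  rewrite in_itv/= => /andP[r0 r1]; apply/eqP; rewrite wtE// !mulf_neq0//.
  - by rewrite gt_eqF// powR_gt0.
  - by rewrite expf_neq0// gt_eqF.
  - by rewrite gt_eqF// expR_gt0.
by rewrite N0 lebesgue_measure_itv/= lte_fin ltr01 oppr0 adde0 lee_fin ler10.
Qed.

Lemma J_le j x y : x <= y -> J j y <= J j x.
Proof.
move=> xy; apply: le_Rint; [exact: L1_J|exact: L1_J|move=> r].
have [r0|r0] := ltP 0 r; last by rewrite wtN ?mul0r.
rewrite ler_wpM2l ?wt_ge0// /Jint ler_wpM2l ?exprn_ge0 ?(ltW r0)//.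
by rewrite ler_expR lerD2r ler_wpM2r ?(ltW r0)//; lra.
Qed.

(* The integral over (0, oo) of the derivative of r^(1-g) exp(-2xr-r^2). *)
Lemma J_rec x : (1 - g) * J 0 x - 2 * x * J 1 x - 2 * J 2 x = 0.
Proof.
case/andP: g01 => g0 g1.
pose F r : R := r `^ (1 - g) * expR (- 2 * x * r - r ^+ 2).
pose f r : R := (1 - g) * (r `^ (- g) * Jint 0 x r)
  - 2 * x * (r `^ (- g) * Jint 1 x r) - 2 * (r `^ (- g) * Jint 2 x r).
have dF (r : R) : 0 < r -> is_derive r 1 F (f r).
  move=> r0; rewrite /F; apply: is_derive_eq.
    by notypeclasses refine (@dmul _ _ _ _ _ _ _ _); [exact: dpowR|repeat deriv1].
  rewrite (_ : 1 - g - 1 = - g); last by ring.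
  have -> : r `^ (1 - g) = r * r `^ (- g).
    by rewrite powRD ?powRr1 ?ltW//; apply/implyP => _; rewrite gt_eqF.
  by rewrite /f /Jint/=; ring.
have cf (r : R) : 0 < r -> {for r, continuous f}.
  move=> r0; have cw := @powR_cont _ (- g) r r0.
  have cJ j : {for r, continuous (fun r => r `^ (- g) * Jint j x r)}.
    by apply: cvgM; [exact: cw|exact: cont_Jint].
  apply: cvgB; first apply: cvgB.
  - by apply: cvgM; [exact: cvg_cst|exact: cJ].
  - by apply: cvgM; [exact: cvg_cst|exact: cJ].
  - by apply: cvgM; [exact: cvg_cst|exact: cJ].
have E r : \1_(`]0, +oo[%classic : set R) r * f r =
    (1 - g) * (wt r * Jint 0 x r) - 2 * x * (wt r * Jint 1 x r) - 2 * (wt r * Jint 2 x r).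
  by rewrite /f /wt; ring.
have i0 := L1Z (1 - g) (L1_J 0 x).
have i1 := L1Z (2 * x) (L1_J 1 x).
have i2 := L1Z 2 (L1_J 2 x).
have fi : L1 mu (fun r => \1_(`]0, +oo[%classic : set R) r * f r).
  by apply: eq_L1 (L1B (L1B i0 i1) i2) => r; rewrite E.
have := FTC_pos dF cf fi.
rewrite (@eq_Rint _ _ _ mu _ _ E) (RintB (L1B i0 i1) i2) (RintB i0 i1) !RintZ; try exact: L1_J.
(* The boundary terms: at [0] the factor [r^(1 - g)] tends to [0] because [g < 1]; at infinity it is
   at most [r], and the Gaussian wins. *)
move=> /(_ 0 0); rewrite subr0; apply.
  have r0 : (n.+1%:R^-1 : R) @[n --> \oo] --> (0 : R) by exact: cvg_harmonic.
  rewrite (_ : (fun n => F n.+1%:R^-1) =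
    (fun n => n.+1%:R^-1 `^ (1 - g) * Jint 0 x n.+1%:R^-1)); last first.
    by apply/funext => n; rewrite /F /Jint mul1r.
  rewrite -[0](mul0r (Jint 0 x 0)); apply: cvgM.
    have g10 : 0 < 1 - g by rewrite subr_gt0.
    apply: ((cvg_at_rightP _ _ _).1 (powR_cvg0 g10)).
    by split => // n; rewrite invr_gt0.
  exact: (cvg_comp _ _ r0 (@cont_Jint 0 x 0)).
have [C C0 HC] := gauss_bound (2 * `|x|) 1 1 (ltr01 : 0 < 1 :> R).
have cC : C * omega n.+1%:R @[n --> \oo] --> (0 : R).
  rewrite -[0](mulr0 C); apply: cvgM; first exact: cvg_cst.
  by have := @omega_cvg0 R; rewrite -(cvg_shiftS (fun n => omega n%:R)).
apply: (squeeze_cvgr _ (cvg_cst 0) cC); near=> n.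
rewrite mulr_ge0 ?powR_ge0 ?expR_ge0//=.
apply: le_trans (le_trans (HC n.+1%:R) _); last by rewrite expr1.
apply: ler_pM; rewrite ?powR_ge0 ?expR_ge0//.
  by rewrite expr1 (ger0_norm (ler0n R n.+1)) ler1_powR ?ler1n// gerBl ltW.
rewrite ler_expR mul1r lerD2r (ger0_norm (ler0n R n.+1)) ler_wpM2r//.
by rewrite mulNr -mulrN ler_wpM2l// (le_trans (ler_norm _))// normrN.
Unshelve. all: by end_near. Qed.

End weights.
Section self_similar_ode.
Context {R : realType}.
Variables (g : R) (g01 : 0 < g < 1).
Let g0 : 0 < g. Proof. by case/andP: g01. Qed.

(* [y1] is the derivative of [y], and [y'' + 2 x y' + 2 g y = 0]. *)
Definition sol (y y1 : R -> R) : Prop :=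
  (forall x : R, is_derive x 1 y (y1 x)) /\
  (forall x : R, is_derive x 1 y1 (-2 * x * y1 x - 2 * g * y x)).

Definition snd_der (y y1 : R -> R) (x : R) : R := -2 * x * y1 x - 2 * g * y x.

Section positive_solution.
Variables (y y1 : R -> R).
Hypotheses (soly : sol y y1) (y_gt0 : forall x, 0 < y x) (y1_le0 : y1 0 <= 0).
Notation y2 := (snd_der y y1).

(** The equation reads [(y1 exp(x^2))' = - 2 g y exp(x^2)], and the right-hand side is negative. *)
Lemma sol_decr x : 0 < x -> y1 x < 0.
Proof.
move=> x0; case: soly => dy dy1.
have d (z : R) : is_derive z 1 (fun z => y1 z * expR (z ^+ 2)) (- (2 * g * y z * expR (z ^+ 2))).
  by deriv_with ltac:(exact: dy1); ring.
have [c _ E] := mvt x0 d.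
move: E; rewrite subr0 expr0n/= expR0 mulr1 => E.
have : y1 x * expR (x ^+ 2) < 0.
  have : 0 < 2 * g * y c * expR (c ^+ 2) * x by rewrite !mulr_gt0// expR_gt0.
  by move: y1_le0 E; lra.
by rewrite pmulr_llt0// expR_gt0.
Qed.

Lemma dsnd_der (z : R) : is_derive z 1 y2 (-2 * y1 z - 2 * z * y2 z - 2 * g * y1 z).
Proof.
case: soly => dy dy1; rewrite /snd_der.
by deriv_with ltac:(first [exact: dy1 | exact: dy]); ring.
Qed.

(** The differentiated equation reads [(y2 exp(x^2))' = - 2 (1 + g) y1 exp(x^2)], which is positive
    by [sol_decr]. So [y2] changes sign at most once on the half-line. *)
Lemma sol_snd_incr a b : 0 <= a -> a < b ->
  y2 a * expR (a ^+ 2) < y2 b * expR (b ^+ 2).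
Proof.
move=> a0 ab; case: soly => dy dy1.
have d (z : R) : is_derive z 1 (fun z => y2 z * expR (z ^+ 2)) (-2 * (1 + g) * y1 z * expR (z ^+ 2)).
  by deriv_with ltac:(exact: dsnd_der); rewrite /snd_der; ring.
have [c /andP[ac cb] E] := mvt ab d.
rewrite -subr_gt0 E mulr_gt0 ?subr_gt0// mulr_gt0 ?expR_gt0//.
rewrite nmulr_lgt0 ?sol_decr//; last exact: le_lt_trans ac.
by have := g0; lra.
Qed.

(** At [0] the equation gives [y2 0 = - 2 g y 0 < 0]. On the other hand a positive decreasing
    function is not concave on a whole half-line, so [y2] is positive somewhere. *)
Lemma sol_root : exists2 c, 0 < c & y2 c = 0.
Proof.
case: soly => dy dy1.
have [x x0 yx] : exists2 x, 0 < x & 0 < y2 x.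
  apply: contrapT => N.
  have y2le x : 0 < x -> y2 x <= 0.
    by move=> x0; rewrite leNgt; apply/negP => yx; apply: N; exists x.
  (* If [y] were concave, it would lie below its tangent at [1], of slope [- m], which reaches [0]
     at [1 + y 1 / m]. *)
  pose m := - y1 1; have m0 : 0 < m by rewrite oppr_gt0 sol_decr.
  have x1 : 1 < 1 + y 1 / m by rewrite ltrDl divr_gt0.
  have [c /andP[c1 _] E] := mvt x1 dy.
  have [c' /andP[c'1 _] E'] := mvt c1 dy1.
  have cm : 0 <= c - 1 by rewrite subr_ge0 ltW.
  have := mulr_le0_ge0 (y2le c' (lt_trans ltr01 c'1)) cm.
  rewrite -E' => h1.
  have : y (1 + y 1 / m) <= 0.
    have -> : y (1 + y 1 / m) = y 1 + y1 c * (y 1 / m).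
      by rewrite addrAC subrr add0r in E; rewrite -E; ring.
    have : y1 c * (y 1 / m) <= - m * (y 1 / m).
      apply: ler_wpM2r; first by rewrite divr_ge0 ?ltW.
      by rewrite /m opprK; lra.
    by rewrite mulNr [m * _]mulrCA divff ?gt_eqF// mulr1; lra.
  by apply/negP; rewrite -ltNge.
have y20 : y2 0 < 0.
  by rewrite /snd_der mulr0 mul0r sub0r oppr_lt0 !mulr_gt0.
have cy2 : {within `[0, x], continuous y2}.
  by apply: continuous_subspaceT; exact: is_derive_continuous dsnd_der.
have [|c] := IVT (ltW x0) cy2 (v := 0).
  by rewrite ge_min le_max (ltW yx) (ltW y20) orbT.
rewrite in_itv/= => /andP[c0 _] yc; exists c => //.
rewrite lt_neqAle c0 andbT; apply/eqP => E.
by move: yc y20; rewrite -E => ->; rewrite ltxx.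
Qed.

Lemma sol_lt_root c x : 0 < c -> y2 c = 0 -> 0 < x -> 0 < y2 x -> c < x.
Proof.
move=> c0 yc x0 yx; rewrite ltNge; apply/negP; rewrite le_eqVlt => /predU1P[E|xc].
  by move: yx; rewrite E yc ltxx.
have := sol_snd_incr (ltW x0) xc; rewrite yc mul0r.
by apply/negP; rewrite -leNgt mulr_ge0 ?expR_ge0// ltW.
Qed.

End positive_solution.

(** Abel's identity: the Wronskian [w] solves [w' = - 2 x w]. *)
Lemma wronskian y y1 z z1 : sol y y1 -> sol z z1 -> forall x : R, 0 < x ->
  (y x * z1 x - y1 x * z x) * expR (x ^+ 2) = y 0 * z1 0 - y1 0 * z 0.
Proof.
move=> [dy dy1] [dz dz1] x x0.
have d (t : R) : is_derive t 1
    (fun t => (y t * z1 t - y1 t * z t) * expR (t ^+ 2)) 0.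
  by deriv_with ltac:(first [exact: dy1 | exact: dy | exact: dz1 | exact: dz]); ring.
have [c _] := mvt x0 d; rewrite mul0r expr0n/= expR0 mulr1.
by move=> /eqP; rewrite subr_eq0 => /eqP.
Qed.

(* [G] and [U] are [phi_ lam] and [u_ lam], [lam = g - 1], times [exp(- x^2)]; see [c1_E] and [c0_E]. *)
Definition G (x : R) : R := J g 0 x * expR (- x ^+ 2).
Definition G1 (x : R) : R := (-2 * J g 1 x - 2 * x * J g 0 x) * expR (- x ^+ 2).
Definition U (x : R) : R := G x + G (- x).
Definition U1 (x : R) : R := G1 x - G1 (- x).

Lemma G_gt0 x : 0 < G x.
Proof. by rewrite mulr_gt0 ?expR_gt0 ?J_gt0. Qed.

Lemma U_gt0 x : 0 < U x.
Proof. by rewrite addr_gt0 ?G_gt0. Qed.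

Lemma solG : sol G G1.
Proof.
split=> x.
  by rewrite /G; deriv_with ltac:(exact: (dJ g01)); rewrite /G1; ring.
rewrite /G1; deriv_with ltac:(exact: (dJ g01)).
have -> : J g 2 x = ((1 - g) * J g 0 x - 2 * x * J g 1 x) / 2.
  by have := J_rec g01 x; lra.
by rewrite /G1 /G /=; field.
Qed.

Lemma solU : sol U U1.
Proof.
have [dg dg1] := solG.
have dgN (x : R) : is_derive x 1 (fun x => G (- x)) (G1 (- x) * -1).
  by notypeclasses refine (@dcomp _ G (fun x => - x) _ _ _ _ _); [exact: dg|repeat deriv1].
have dg1N (x : R) : is_derive x 1 (fun x => G1 (- x))
    ((-2 * - x * G1 (- x) - 2 * g * G (- x)) * -1).
  by notypeclasses refine (@dcomp _ G1 (fun x => - x) _ _ _ _ _); [exact: dg1|repeat deriv1].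
split=> x.
  by rewrite /U; deriv_with ltac:(first [exact: dg | exact: dgN]); rewrite /U1; ring.
rewrite /U1; deriv_with ltac:(first [exact: dg1 | exact: dg1N]).
by rewrite /U1 /U; ring.
Qed.

Lemma UN x : U (- x) = U x.
Proof. by rewrite /U opprK addrC. Qed.

Lemma U1N x : U1 (- x) = - U1 x.
Proof. by rewrite /U1 opprK opprB. Qed.

Let G10 : G1 0 < 0.
Proof.
rewrite /G1 mulr0 mul0r subr0 pmulr_llt0 ?expR_gt0//.
by rewrite mulNr oppr_lt0 mulr_gt0// J_gt0.
Qed.

Let U10 : U1 0 = 0.
Proof. by rewrite /U1 oppr0 subrr. Qed.

Notation G2 := (snd_der G G1).
Notation U2 := (snd_der U U1).

Lemma phi_E : phi_ (g - 1) = J g 0.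
Proof.
apply/funext => x; rewrite /phi_ Rintegral_mkcond; apply: eq_Rint => r.
rewrite patchE /wt /Jint indicE; case: (_ \in _); last by rewrite !mul0r.
by rewrite !mul1r mulrC (_ : -1 - (g - 1) = - g)//; ring.
Qed.

(** [xget] returns a root as soon as there is one, and [sol_root] supplies it. *)
Lemma inflectionP phi y y1 : sol y y1 -> (forall x, 0 < y x) -> y1 0 <= 0 ->
  (forall x, phi x * expR (- x ^+ 2) = y x) ->
  0 < inflection phi /\ snd_der y y1 (inflection phi) = 0.
Proof.
move=> sy y0 y10 E; have [dy dy1] := sy.
have dd x : derive1n 2 y x = snd_der y y1 x.
  by rewrite derive1nS derive1n1 (derive1_is_derive dy) (derive1_is_derive dy1).
have [c c0 yc] := sol_root sy y0 y10.
have H : exists x, [set x | 0 < x /\ derive1n 2 y x = 0] x.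
  by exists c; split => //; rewrite dd.
have [p1 p2] := xgetPex 0 H.
by rewrite /inflection (funext E) -dd; split.
Qed.

Definition c1 : R := inflection (J g 0).
Definition c0 : R := inflection (fun x => J g 0 x + J g 0 (- x)).

Lemma c1_E : c1_ (g - 1) = c1.
Proof. by rewrite /c1_ phi_E. Qed.

Lemma c0_E : c0_ (g - 1) = c0.
Proof. by rewrite /c0_ /c0 /u_ phi_E. Qed.

Lemma c1P : 0 < c1 /\ G2 c1 = 0.
Proof.
by apply: inflectionP => [|||x]; [exact: solG|exact: G_gt0|exact: ltW|].
Qed.

Lemma c0P : 0 < c0 /\ U2 c0 = 0.
Proof.
apply: inflectionP => [|||x]; [exact: solU|exact: U_gt0|by rewrite U10|].
by rewrite /U /G sqrrN mulrDl.
Qed.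

Let alg (c u u1 v v1 : R) : -2 * c * u1 = 2 * g * u ->
  (-2 * c * v1 - 2 * g * v) * u = -2 * c * (u * v1 - u1 * v).
Proof.
move=> E; have -> : (-2 * c * v1 - 2 * g * v) * u =
  -2 * c * v1 * u - (2 * g * u) * v by ring.
by rewrite -E; ring.
Qed.

(** At an inflection point [c] of [U], the identity [alg] gives [U c * G2 c = - 2 c W], where [W] is
    the Wronskian of [U] and [G]. Its sign is that of [U 0 * G1 0 < 0], because [U1 0 = 0] by
    evenness. Hence [c0] lies beyond the sign change [c1] of [G2]. *)
Let snd_der_gt0 c : 0 < c -> U2 c = 0 -> 0 < G2 c.
Proof.
move=> c_gt0; rewrite /snd_der => /eqP; rewrite subr_eq0 => /eqP E.
have := wronskian solU solG c_gt0; rewrite U10 mul0r subr0 => W.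
have W0 : U c * G1 c - U1 c * G c < 0.
  rewrite -(@pmulr_llt0 _ (expR (c ^+ 2))) ?expR_gt0// W.
  by rewrite nmulr_llt0// U_gt0.
rewrite -(@pmulr_lgt0 _ (U c)) ?U_gt0// (alg (G c) (G1 c) E).
by rewrite nmulr_lgt0// mulNr oppr_lt0 mulr_gt0.
Qed.

Lemma c1_lt_c0 : c1 < c0.
Proof.
have [c0_gt0 Uc] := c0P; have [c1_gt0 Gc] := c1P.
apply: (sol_lt_root solG G_gt0 (ltW G10) c1_gt0 Gc c0_gt0).
exact: snd_der_gt0.
Qed.

Lemma beta_E : beta_ g = (c0 / c1) ^+ 2.
Proof. by rewrite /beta_ /a1_ c0_E c1_E. Qed.

End self_similar_ode.


(** * The self-similar profile *)

Section glue.
Context {R : realType}.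
Implicit Types (f : R -> R) (c x : R).

Definition glue (c : R) (f1 f2 : R -> R) (x : R) : R := if x < c then f1 x else f2 x.

(** This form makes the continuity of the glued function evident, as [min] and [max] are
    continuous. *)
Lemma glueE c (f1 f2 : R -> R) x : f1 c = f2 c ->
  glue c f1 f2 x = f1 (Num.min x c) + f2 (Num.max x c) - f1 c.
Proof.
by move=> E; rewrite /glue minEle maxEle; case: ltgtP => [h|h|->]; rewrite ?E; ring.
Qed.

Lemma glue_cont c (f1 f2 : R -> R) : continuous f1 -> continuous f2 -> f1 c = f2 c ->
  continuous (glue c f1 f2).
Proof.
move=> cf1 cf2 E; rewrite (_ : glue c f1 f2 =
    (fun x => f1 (Num.min x c) + f2 (Num.max x c) - f1 c)); last first.
  by apply/funext => x; exact: glueE.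
move=> x; apply: cvgB; last exact: cvg_cst.
apply: cvgD.
  apply: (cvg_comp (fun x => Num.min x c) f1); last exact: cf1.
  by apply: (@continuous_min _ _ (fun x : R => x) (fun=> c)); [exact: cvg_id|exact: cvg_cst].
apply: (cvg_comp (fun x => Num.max x c) f2); last exact: cf2.
by apply: (@continuous_max _ _ (fun x : R => x) (fun=> c)); [exact: cvg_id|exact: cvg_cst].
Qed.

(** At [c] each difference quotient is one of [f1] or one of [f2], and both kinds have the same
    limit. *)
Lemma glue_derive c (f1 f2 d1 d2 : R -> R) :
  (forall x : R, is_derive x 1 f1 (d1 x)) -> (forall x : R, is_derive x 1 f2 (d2 x)) ->
  f1 c = f2 c -> d1 c = d2 c ->
  forall x : R, is_derive x 1 (glue c f1 f2) (glue c d1 d2 x).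
Proof.
move=> df1 df2 E Ed x; rewrite {2}/glue; have [xc|xc] := ltP x c.
  apply: near_eq_is_derive (df1 x).
  by near=> y; rewrite /glue ifT//; near: y; exact: lt_nbhsl.
move: xc; rewrite le_eqVlt => /predU1P[<-|xc]; last first.
  apply: near_eq_is_derive (df2 x).
  near=> y; rewrite /glue ifF//; apply/negbTE; rewrite -leNgt ltW//.
  by near: y; exact: lt_nbhsr.
have cv f d : is_derive c 1 f d -> h^-1 * (f (h + c) - f c) @[h --> 0^'] --> d.
  move=> [+ <-]; rewrite /derivable /derive => /cvg_ex[l] H.
  by rewrite (cvg_lim _ H)//; move: H; under eq_fun do rewrite /= [_%:A]mulr1.
have H1 := cv _ _ (df1 c); have H2 := cv _ _ (df2 c); rewrite Ed in H1.
have H : h^-1 * (glue c f1 f2 (h + c) - glue c f1 f2 c) @[h --> 0^'] --> d2 c.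
  apply/cvgrPdist_lt => e e0.
  move/cvgrPdist_lt : H1 => /(_ e e0) N1; move/cvgrPdist_lt : H2 => /(_ e e0) N2.
  apply: filterS2 N1 N2 => h n1 n2.
  by rewrite /glue ltxx; case: ifP => // _; rewrite -E.
have dc : derivable (glue c f1 f2) c 1.
  by apply/cvg_ex; exists (d2 c); under eq_fun do rewrite /= [_%:A]mulr1.
apply: DeriveDef => //; apply: cvg_lim => //.
by under eq_fun do rewrite /= [_%:A]mulr1.
Unshelve. all: by end_near. Qed.

(** On the compact interval [[- Y, Y]] the quotient by [omega ^+ n] is continuous, hence bounded.
    Only the tails need an estimate, and for the profile these involve the outer branch alone. *)
Lemma omega_bound f (Y C : R) n : continuous f -> 0 < Y ->
  (forall x, Y <= `|x| -> `|f x| <= C * omega x ^+ n) ->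
  exists2 C', 0 <= C' & forall x, `|f x| <= C' * omega x ^+ n.
Proof.
move=> cf Y0 fC.
have o0 x : 0 < omega x ^+ n :> R by rewrite exprn_gt0// omega_gt0.
pose F x := `|f x / omega x ^+ n|.
have cF : continuous F.
  move=> x; apply: cvg_norm; apply: cvgM; first exact: cf.
  apply: cvgV; first by rewrite gt_eqF.
  apply: (cvg_comp omega (fun x => x ^+ n)); [exact: continuous_omega|exact: exprn_continuous].
have NYY : - Y <= Y by lra.
have [m _ mP] := EVT_max NYY (continuous_subspaceT cF).
exists (Num.max (F m) C).
  by rewrite le_max normr_ge0.
move=> x; rewrite -ler_pdivrMr//.
have -> : `|f x| / omega x ^+ n = F x by rewrite /F normrM normfV (gtr0_norm (o0 x)).
rewrite le_max; have [Yx|xY] := leP Y `|x|.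
  apply/orP; right; rewrite /F normrM normfV (gtr0_norm (o0 x)) ler_pdivrMr//.
  exact: fC.
by apply/orP; left; apply: mP; rewrite in_itv/= -ler_norml ltW.
Qed.

End glue.

Section profile.
Context {R : realType}.
Variables (g : R) (g01 : 0 < g < 1) (c0 c1 : R).
Notation G := (G g).
Notation G1 := (G1 g).
Notation U := (U g).
Notation U1 := (U1 g).
Notation G2 := (snd_der g G G1).
Notation U2 := (snd_der g U U1).
Hypotheses (c0_gt0 : 0 < c0) (c1_gt0 : 0 < c1) (Uc0 : U2 c0 = 0) (Gc1 : G2 c1 = 0).

Let g0 : 0 < g. Proof. by case/andP: g01. Qed.

Definition a1 : R := c0 / c1.
Let a1_gt0 : 0 < a1. Proof. exact: divr_gt0. Qed.

(** The factor that makes the two branches take the same value at [ystar]. *)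
Definition kap : R := U c0 / G c1.
Definition ystar : R := 2 * c0.
Definition hi (y : R) := U (2^-1 * y).
Definition hi1 (y : R) := 2^-1 * U1 (2^-1 * y).
Definition hi2 (y : R) := 2^-1 * (2^-1 * U2 (2^-1 * y)).
(** Equal to [c1 / ystar], so that the inner branch reaches [c0] and the outer branch reaches [c1]
    at the same point [ystar]. Being [1 / (2 a1)], it is also the scaling that turns the equation of
    [G] into the one with coefficient [a1 ^+ 2]. *)
Definition bq : R := (2 * a1)^-1.
Definition ho (y : R) := kap * G (bq * y).
Definition ho1 (y : R) := kap * (bq * G1 (bq * y)).
Definition ho2 (y : R) := kap * (bq * (bq * G2 (bq * y))).

Lemma ystar_gt0 : 0 < ystar. Proof. exact: mulr_gt0. Qed.
Let bq_gt0 : 0 < bq. Proof. by rewrite invr_gt0 mulr_gt0. Qed.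
Let kap_gt0 : 0 < kap. Proof. by rewrite divr_gt0 ?U_gt0 ?G_gt0. Qed.

Let dscale (f d : R -> R) (b x : R) : (forall z : R, is_derive z 1 f (d z)) ->
  is_derive x 1 (fun y => f (b * y)) (b * d (b * x)).
Proof.
move=> df; notypeclasses refine (@is_derive_eq _ _ _ _ _ _ _ _ _ _).
  by notypeclasses refine (@dcomp _ f (fun y => b * y) _ _ _ _ _); [exact: df|repeat deriv1].
by rewrite /=; ring.
Qed.

Let dhi (x : R) : is_derive x 1 hi (hi1 x).
Proof. by apply: dscale; case: (solU g01). Qed.

Let dhi1 (x : R) : is_derive x 1 hi1 (hi2 x).
Proof.
have dU1 := (dscale _ _ (solU g01).2).
by rewrite /hi1; deriv_with ltac:(exact: dU1); rewrite /hi2/snd_der; ring.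
Qed.

Let dho (x : R) : is_derive x 1 ho (ho1 x).
Proof.
have dG := (dscale _ _ (solG g01).1).
by rewrite /ho; deriv_with ltac:(exact: dG); rewrite /ho1; ring.
Qed.

Let dho1 (x : R) : is_derive x 1 ho1 (ho2 x).
Proof.
have dG1 := (dscale _ _ (solG g01).2).
by rewrite /ho1; deriv_with ltac:(exact: dG1); rewrite /ho2/snd_der; ring.
Qed.

Let cont_snd f f1 : sol g f f1 -> continuous (snd_der g f f1).
Proof.
move=> [df df1]; have cf := is_derive_continuous df.
have cf1 := is_derive_continuous df1.
move=> x; rewrite /snd_der; apply: cvgB.
  apply: cvgM; last exact: cf1.
  by apply: cvgM; [exact: cvg_cst|exact: cvg_id].
by apply: cvgM; [exact: cvg_cst|exact: cf].
Qed.

Let cont_scale (f : R -> R) (b : R) : continuous f -> continuous (fun y => f (b * y)).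
Proof.
move=> cf x; apply: (cvg_comp (fun y => b * y) f); last exact: cf.
by apply: cvgM; [exact: cvg_cst|exact: cvg_id].
Qed.

Let chi2 : continuous hi2.
Proof.
move=> x; apply: cvgM; first exact: cvg_cst.
apply: cvgM; first exact: cvg_cst.
exact/cont_scale/cont_snd/solU.
Qed.

Let cho2 : continuous ho2.
Proof.
move=> x; do 3 (apply: cvgM; first exact: cvg_cst).
exact/cont_scale/cont_snd/solG.
Qed.

Let Ei : 2^-1 * ystar = c0. Proof. by rewrite /ystar; lra. Qed.
Let Eo : bq * ystar = c1.
Proof. by rewrite /bq /ystar /a1; field; rewrite !gt_eqF. Qed.

Let m0 : hi ystar = ho ystar.
Proof. by rewrite /hi /ho Ei Eo /kap divfK// gt_eqF// G_gt0. Qed.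

(** At an inflection point the equation prescribes the logarithmic derivative [- g / c]. After
    scaling, both branches have the logarithmic derivative [- g / ystar] at [ystar]: equality of the
    values thus entails that of the first derivatives. *)
Let root1 f f1 c : 0 < c -> snd_der g f f1 c = 0 -> f1 c = - g * f c / c.
Proof.
rewrite /snd_der => c_gt0 /eqP; rewrite subr_eq0 => /eqP E.
have c_neq0 : c != 0 by rewrite gt_eqF.
apply: (mulIf c_neq0); rewrite divfK//.
by move: E; lra.
Qed.

Let m1 : hi1 ystar = ho1 ystar.
Proof.
rewrite /hi1 /ho1 Ei Eo (root1 c0_gt0 Uc0) (root1 c1_gt0 Gc1).
rewrite /kap /bq /a1; field.
by rewrite !gt_eqF ?G_gt0.
Qed.

Let m2 : hi2 ystar = ho2 ystar.
Proof. by rewrite /hi2 /ho2 Ei Eo Uc0 Gc1 !mulr0. Qed.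

Let hi2_0 : hi2 ystar = 0.
Proof. by rewrite /hi2 Ei Uc0 !mulr0. Qed.

(* [hi] and [ho] have the same 2-jet at [ystar], where both second derivatives vanish. *)
Definition prof : R -> R := glue (- ystar) (fun y => ho (- y)) (glue ystar hi ho).
Definition prof1 : R -> R := glue (- ystar) (fun y => - ho1 (- y)) (glue ystar hi1 ho1).
Definition prof2 : R -> R := glue (- ystar) (fun y => ho2 (- y)) (glue ystar hi2 ho2).

Let Nystar : - ystar < ystar. Proof. by have := ystar_gt0; lra. Qed.
Let hiN y : hi (- y) = hi y. Proof. by rewrite /hi mulrN UN. Qed.
Let hi1N y : hi1 (- y) = - hi1 y. Proof. by rewrite /hi1 mulrN U1N mulrN. Qed.
Let hi2N y : hi2 (- y) = hi2 y.
Proof. by rewrite /hi2 /snd_der mulrN U1N UN; ring. Qed.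

Lemma dprof (x : R) : is_derive x 1 prof (prof1 x).
Proof.
apply: glue_derive => [{}x|{}x||].
- notypeclasses refine (@is_derive_eq _ _ _ _ _ _ _ _ _ _).
    by notypeclasses refine (@dcomp _ ho (fun x => - x) _ _ _ _ _); [exact: dho|repeat deriv1].
  by rewrite mulrN1.
- exact: glue_derive.
- by rewrite /glue Nystar opprK hiN m0.
- by rewrite /glue Nystar opprK hi1N m1.
Qed.

Lemma dprof1 (x : R) : is_derive x 1 prof1 (prof2 x).
Proof.
apply: glue_derive => [{}x|{}x||].
- notypeclasses refine (@is_derive_eq _ _ _ _ _ _ _ _ _ _).
    notypeclasses refine (@dopp _ _ _ _ _).
    by notypeclasses refine (@dcomp _ ho1 (fun x => - x) _ _ _ _ _); [exact: dho1|repeat deriv1].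
  by rewrite mulrN1 opprK.
- exact: glue_derive.
- by rewrite /glue Nystar opprK hi1N m1.
- by rewrite /glue Nystar opprK hi2N m2.
Qed.

Lemma prof2_cont : continuous prof2.
Proof.
apply: glue_cont.
- move=> x; apply: (cvg_comp (fun x => - x) ho2); last exact: cho2.
  exact: cvgN.
- exact: glue_cont.
- by rewrite /glue Nystar opprK hi2N m2.
Qed.

Definition coef (y : R) : R := if `|y| < ystar then 1 else a1 ^+ 2.

Lemma prof_ode y : coef y * prof2 y = - (g / 2) * prof y - y / 2 * prof1 y.
Proof.
have Oi z : hi2 z = - (g / 2) * hi z - z / 2 * hi1 z.
  by rewrite /hi2 /hi /hi1 /snd_der; field.
have Oo z : a1 ^+ 2 * ho2 z = - (g / 2) * ho z - z / 2 * ho1 z.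
  rewrite /ho2 /ho /ho1 /snd_der /bq; field.
  by rewrite gt_eqF.
have s0 := ystar_gt0.
rewrite /coef /prof2 /prof /prof1 /glue; have [y1|y1] := ltP y (- ystar).
  have -> : (`|y| < ystar) = false.
    by apply/negbTE; rewrite -leNgt ler_normr; apply/orP; right; lra.
  by rewrite Oo; ring.
have [y2|y2] := ltP y ystar.
  have [y3|y3] := ltP `|y| ystar; first by rewrite mul1r.
  (* At this point [prof] follows the inner branch while [coef] already has its outer value. The
     equation holds all the same since the second derivative is [0] there. *)
  have -> : y = - ystar.
    by move: y3; rewrite ler_normr => /orP[|]; lra.
  by rewrite -Oi hi2N hi2_0 mulr0.
have -> : (`|y| < ystar) = false.
  by apply/negbTE; rewrite -leNgt ler_normr y2.
exact: Oo.
Qed.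

Lemma prof_gt0 y : 0 < prof y.
Proof.
rewrite /prof /glue; case: ifP => _; first by rewrite mulr_gt0 ?G_gt0.
by case: ifP => _; rewrite ?U_gt0// mulr_gt0 ?G_gt0.
Qed.

Let gauss_pow n : exists2 C, 0 <= C & forall y : R,
  `|bq * y| ^+ n * expR (- (bq * y) ^+ 2) <= C * omega y ^+ 3.
Proof.
have k0 : 0 < bq ^+ 2 by rewrite exprn_gt0.
have [C C0 HC] := gauss_bound 0 n 3 k0.
exists (bq ^+ n * C) => [|y]; first by rewrite mulr_ge0// exprn_ge0// ltW.
rewrite normrM (gtr0_norm bq_gt0) exprMn -!mulrA ler_wpM2l ?exprn_ge0 ?(ltW bq_gt0)//.
by have := HC y; rewrite mul0r sub0r exprMn.
Qed.

(** For nonnegative arguments [J] is at most its value at [0], and the factor [exp(- x^2)] of [G]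
    gives the decay. The restriction to [0 <= y] matters since [J] is decreasing and grows to the
    left; this is why the left part of the profile is a reflection of the right one. *)
Let GB : exists2 C, 0 <= C & forall y : R, 0 <= y ->
  [/\ G (bq * y) <= C * omega y ^+ 3, `|G1 (bq * y)| <= C * omega y ^+ 3 &
   `|G2 (bq * y)| <= C * omega y ^+ 3].
Proof.
have [A0 A00 H0] := gauss_pow 0; have [A1 A10 H1] := gauss_pow 1.
have [A2 A20 H2] := gauss_pow 2.
pose j0 := J g 0 0; pose j1 := J g 1 0.
have j0_gt0 : 0 < j0 by exact: J_gt0.
have j1_gt0 : 0 < j1 by exact: J_gt0.
pose B0 := j0 * A0; pose B1 := 2 * j1 * A0 + 2 * j0 * A1.
pose B2 := 4 * j1 * A1 + 4 * j0 * A2 + 2 * g * j0 * A0.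
have B00 : 0 <= B0 by rewrite mulr_ge0// ltW.
have B10 : 0 <= B1 by rewrite addr_ge0// !mulr_ge0// ltW.
have B20 : 0 <= B2 by rewrite !addr_ge0// !mulr_ge0// ltW.
exists (B0 + B1 + B2) => [|y y0]; first exact: (addr_ge0 (addr_ge0 B00 B10) B20).
pose x := bq * y; have x0 : 0 <= x by rewrite mulr_ge0// ltW.
have := H0 y; have := H1 y; have := H2 y; rewrite -/x expr0 expr1 mul1r (ger0_norm x0).
set E := expR _; set w := omega y ^+ 3 => h2 h1 h0.
rewrite -/x; clearbody x.
have E0 : 0 <= E by exact: expR_ge0.
have w0 : 0 <= w by rewrite exprn_ge0// ltW// omega_gt0.
have k0 : 0 < J g 0 x <= j0 by rewrite J_gt0 ?J_le.
have k1 : 0 < J g 1 x <= j1 by rewrite J_gt0 ?J_le.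
case/andP: k0 => k00 k0; case/andP: k1 => k10 k1.
have bG : G x <= B0 * w.
  rewrite /G -/E /B0 -mulrA; apply: ler_pM => //; exact: ltW.
have bG1 : `|G1 x| <= 2 * j1 * E + 2 * j0 * (x * E).
  have xE : 0 <= x * E by exact: mulr_ge0.
  have -> : G1 x = - (2 * (J g 1 x * E) + 2 * (J g 0 x * (x * E))).
    by rewrite /G1 -/E; ring.
  have p0 := mulr_ge0 (ltW k00) xE; have p1 := mulr_ge0 (ltW k10) E0.
  rewrite normrN ger0_norm; last by rewrite addr_ge0// mulr_ge0.
  by rewrite -!(mulrA 2); apply: lerD; rewrite ler_wpM2l// ler_wpM2r.
have bG1' : `|G1 x| <= B1 * w.
  apply: (le_trans bG1).
  have -> : B1 * w = (2 * j1) * (A0 * w) + (2 * j0) * (A1 * w) by rewrite /B1; ring.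
  by apply: lerD; apply: ler_wpM2l => //; rewrite mulr_ge0// ltW.
have bG2 : `|G2 x| <= B2 * w.
  have x20 : 0 <= 2 * x by rewrite mulr_ge0.
  have g20 : 0 <= 2 * g by rewrite mulr_ge0// ltW.
  have e1 : `|2 * x * G1 x| = 2 * x * `|G1 x| by rewrite normrM (ger0_norm x20).
  have e2 : `|2 * g * G x| = 2 * g * G x.
    by rewrite ger0_norm// mulr_ge0// ltW// G_gt0.
  have -> : G2 x = - (2 * x * G1 x + 2 * g * G x) by rewrite /snd_der; ring.
  rewrite normrN (le_trans (ler_normD _ _))// e1 e2.
  apply: (@le_trans _ _ (2 * x * (2 * j1 * E + 2 * j0 * (x * E)) + 2 * g * (j0 * E))).
    apply: lerD; first exact: ler_wpM2l.
    apply: ler_wpM2l => //; rewrite /G -/E; exact: ler_wpM2r.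
  have -> : 2 * x * (2 * j1 * E + 2 * j0 * (x * E)) + 2 * g * (j0 * E) =
    (4 * j1) * (x * E) + (4 * j0) * (x ^+ 2 * E) + (2 * g * j0) * E by ring.
  have -> : B2 * w = (4 * j1) * (A1 * w) + (4 * j0) * (A2 * w) + (2 * g * j0) * (A0 * w).
    by rewrite /B2; ring.
  apply: lerD; [apply: lerD|]; apply: ler_wpM2l => //; rewrite !mulr_ge0//; exact: ltW.
clearbody B0 B1 B2; split.
- by apply: (le_trans bG); rewrite ler_wpM2r//; lra.
- by apply: (le_trans bG1'); rewrite ler_wpM2r//; lra.
- by apply: (le_trans bG2); rewrite ler_wpM2r//; lra.
Qed.

(** Powers of [omega] to be spent later: [swap] uses one for Peetre's inequality and one for
    integrability, and [L1_x2V] uses one to absorb [y^2]. *)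
Lemma prof_bound : exists2 C, 0 <= C & forall y,
  [/\ `|prof y| <= C * omega y ^+ 3, `|prof1 y| <= C * omega y ^+ 3 &
      `|prof2 y| <= C * omega y ^+ 3].
Proof.
have [B B0 HB] := GB; have s0 := ystar_gt0.
(* For [ystar <= |y|] the glued function is the outer branch at [|y|] up to sign, except at
   [- ystar], where it is the inner branch; hence the matching hypothesis. *)
have out (f f' fi : R -> R) K y : (forall y, `|f' y| = `|f (- y)|) ->
    `|fi (- ystar)| = `|f ystar| -> 0 <= K ->
    (forall y, 0 <= y -> `|f y| <= K * (B * omega y ^+ 3)) -> ystar <= `|y| ->
    `|glue (- ystar) f' (glue ystar fi f) y| <= (K * B) * omega y ^+ 3.
  move=> E Efi K0 fK; rewrite ler_normr => /orP[yy|yy]; rewrite /glue -mulrA.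
    rewrite ifF; last by apply/negbTE; rewrite -leNgt; lra.
    rewrite ifF; last by apply/negbTE; rewrite -leNgt; lra.
    by apply: fK; lra.
  have [h|h] := ltP y (- ystar).
    by rewrite E -omegaN; apply: fK; lra.
  have -> : y = - ystar by lra.
  by rewrite Nystar Efi omegaN; apply: fK; lra.
have cE (f d : R -> R) : (forall x : R, is_derive x 1 f (d x)) -> continuous f.
  exact: is_derive_continuous.
have k0 := ltW kap_gt0; have b0 := ltW bq_gt0.
have [C0 C00 H0] : exists2 C', 0 <= C' & forall x, `|prof x| <= C' * omega x ^+ 3.
  apply: (omega_bound (C := kap * B) (Y := ystar)) => //; first exact: cE dprof.
  move=> x; apply: out => //; first by rewrite hiN m0.
  move=> y y0; have [h _ _] := HB y y0.
  by rewrite normrM (ger0_norm k0) ler_wpM2l// ger0_norm// ltW// G_gt0.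
have [C1 C10 H1] : exists2 C', 0 <= C' & forall x, `|prof1 x| <= C' * omega x ^+ 3.
  apply: (omega_bound (C := (kap * bq) * B) (Y := ystar)) => //; first exact: cE dprof1.
  move=> x; apply: out => //; [by move=> y; rewrite normrN|by rewrite hi1N m1 normrN|exact: (mulr_ge0 k0 b0)|].
  move=> y y0; have [_ h _] := HB y y0.
  by rewrite /ho1 mulrA normrM (ger0_norm (mulr_ge0 k0 b0)) ler_wpM2l//; exact: (mulr_ge0 k0 b0).
have [C2 C20 H2] : exists2 C', 0 <= C' & forall x, `|prof2 x| <= C' * omega x ^+ 3.
  apply: (omega_bound (C := (kap * (bq * bq)) * B) (Y := ystar)) => //; first exact: prof2_cont.
  move=> x; apply: out => //; [by rewrite hi2N m2|exact: (mulr_ge0 k0 (mulr_ge0 b0 b0))|].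
  move=> y y0; have [_ _ h] := HB y y0.
  rewrite /ho2 [bq * (bq * _)]mulrA [kap * _]mulrA normrM.
  by rewrite (ger0_norm (mulr_ge0 k0 (mulr_ge0 b0 b0))) ler_wpM2l//; exact: (mulr_ge0 k0 (mulr_ge0 b0 b0)).
exists (C0 + C1 + C2) => [|y]; first by rewrite !addr_ge0.
have w0 : 0 <= omega y ^+ 3 :> R by rewrite exprn_ge0// ltW// omega_gt0.
split.
- by apply: le_trans (H0 y) _; rewrite ler_wpM2r//; lra.
- by apply: le_trans (H1 y) _; rewrite ler_wpM2r//; lra.
- by apply: le_trans (H2 y) _; rewrite ler_wpM2r//; lra.
Qed.

End profile.


(** * Smooth test functions *)

Section smooth.
Context {R : realType}.
Notation mu := (@lebesgue_measure R).
Implicit Types (f : R -> R).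

Definition smooth1 f : Prop := forall n (x : R), derivable (derive1n n f) x 1.

(** Induction on the order: all iterated derivatives stay in the class [C]. *)
Lemma smooth1_class (C : (R -> R) -> Prop) :
  (forall f, C f -> exists2 f', C f' & forall x : R, is_derive x 1 f (f' x)) ->
  forall f, C f -> smooth1 f.
Proof.
move=> CC f Cf.
have Cn n : C (derive1n n f).
  elim: n => [|n IHn]//; have [f' Cf' df] := CC _ IHn.
  by rewrite derive1nS (derive1_is_derive df).
by move=> n x; have [f' _ df] := CC _ (Cn n); case: (df x).
Qed.

Lemma smooth1_derive1 f : smooth1 f -> smooth1 (derive1 f).
Proof. by move=> sf n x; rewrite -derive1Sn; exact: sf. Qed.

Lemma smooth1_is_derive f (x : R) : smooth1 f -> is_derive x 1 f (derive1 f x).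
Proof. by move=> sf; apply: derivable_is_derive; exact: (sf 0%N). Qed.

Lemma smooth1_antideriv f (f' : R -> R) : (forall x : R, is_derive x 1 f (f' x)) ->
  smooth1 f' -> smooth1 f.
Proof.
move=> df sf' [|n] x; first by case: (df x).
by rewrite derive1Sn (derive1_is_derive df); exact: sf'.
Qed.

Lemma smooth1_cont f : smooth1 f -> continuous f.
Proof. by move=> sf; apply: is_derive_continuous => x; exact: smooth1_is_derive. Qed.

(** Polynomial expressions in the generators [B]. By Leibniz' rule this class is stable under
    derivation as soon as it contains the derivatives of the generators. *)
Inductive alg (B : (R -> R) -> Prop) : (R -> R) -> Prop :=
| alg_base f : B f -> alg B f
| alg_cst c : alg B (fun=> c)
| alg_add f g : alg B f -> alg B g -> alg B (fun x => f x + g x)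
| alg_mul f g : alg B f -> alg B g -> alg B (fun x => f x * g x).

Lemma alg_smooth (B : (R -> R) -> Prop) :
  (forall f, B f -> exists2 f', alg B f' & forall x : R, is_derive x 1 f (f' x)) ->
  forall f, alg B f -> smooth1 f.
Proof.
move=> BB; apply: smooth1_class => f; elim => [{}f|c|{}f g af [f' af' df] ag [g' ag' dg]
    |{}f g af [f' af' df] ag [g' ag' dg]].
- exact: BB.
- by exists (fun=> 0); [exact: alg_cst|move=> x; exact: dcst].
- by exists (fun x => f' x + g' x); [exact: alg_add|move=> x; exact: dadd].
- exists (fun x => f' x * g x + f x * g' x); last by move=> x; exact: dmul.
  by apply: alg_add; exact: alg_mul.
Qed.

Lemma smooth1_alg f : alg smooth1 f -> smooth1 f.
Proof.
apply: alg_smooth => {}f sf; exists (derive1 f).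
  exact/alg_base/smooth1_derive1.
by move=> x; exact: smooth1_is_derive.
Qed.

Lemma smooth1M f g : smooth1 f -> smooth1 g -> smooth1 (fun x => f x * g x).
Proof. by move=> sf sg; apply: smooth1_alg; apply: alg_mul; exact: alg_base. Qed.

Lemma smooth1D f g : smooth1 f -> smooth1 g -> smooth1 (fun x => f x + g x).
Proof. by move=> sf sg; apply: smooth1_alg; apply: alg_add; exact: alg_base. Qed.

Lemma smooth1Z c f : smooth1 f -> smooth1 (fun x => c * f x).
Proof.
by move=> sf; apply: smooth1_alg; apply: alg_mul; [exact: alg_cst|exact: alg_base].
Qed.

Lemma smooth1_affine f a b : smooth1 f -> smooth1 (fun x => f (a * x + b)).
Proof.
move=> sf; pose C h := exists c, exists2 k, smooth1 k & h = (fun x => c * k (a * x + b)).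
apply: (@smooth1_class C) => [h [c [k sk ->]]|]; last first.
  by exists 1, f => //; apply/funext => x; rewrite mul1r.
exists (fun x => (c * a) * derive1 k (a * x + b)).
  by exists (c * a), (derive1 k) => //; exact: smooth1_derive1.
move=> x.
have dk : is_derive x 1 (fun x => k (a * x + b)) (derive1 k (a * x + b) * (0 * x + a * 1 + 0)).
  notypeclasses refine (@dcomp _ k (fun x => a * x + b) _ _ _ _ _).
    exact: smooth1_is_derive.
  by repeat deriv1.
by deriv_with ltac:(exact: dk); ring.
Qed.

Lemma smooth1_omega : smooth1 omega.
Proof.
pose B f := f = omega \/ f = (fun x : R => x).
apply: (@alg_smooth B) => [f [->|->]|]; last by apply: alg_base; left.
- exists (fun x => -2 * (x * (omega x * omega x))).
    apply: alg_mul; first exact: alg_cst.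
    apply: alg_mul; first by apply: alg_base; right.
    by apply: alg_mul; apply: alg_base; left.
  move=> x; rewrite /omega; have n0 : 1 + x ^+ 2 != 0 :> R.
    by rewrite gt_eqF// ltr_wpDr// sqr_ge0.
  have d2 : is_derive x 1 (fun x => 1 + x ^+ 2) (0 + 2 * x ^+ 1 * 1) by repeat deriv1.
  notypeclasses refine (@is_derive_eq _ _ _ _ _ _ _ _ (@dinv _ (fun x => 1 + x ^+ 2) _ _ n0 d2) _).
  by field.
- by exists (fun=> 1); [exact: alg_cst|move=> x; exact: did].
Qed.

Lemma is_derive0_quad f (c C : R) : (forall x, `|f x - f c| <= C * (x - c) ^+ 2) ->
  is_derive c 1 f 0.
Proof.
move=> fC.
have H : h^-1 * (f (h + c) - f c) @[h --> 0^'] --> (0 : R).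
  apply/cvgrPdist_le => e e0; near=> h.
  rewrite sub0r normrN normrM normfV.
  have h0 : 0 < `|h|.
    by rewrite normr_gt0; near: h; exact: nbhs_dnbhs_neq.
  rewrite mulrC ler_pdivrMr//; apply: le_trans (fC _) _.
  rewrite addrK -real_normK ?num_real// expr2 mulrA ler_wpM2r//.
  have : `|h| * (`|C| + 1) <= e.
    rewrite -ler_pdivlMr ?ltr_wpDl//; near: h.
    apply: dnbhs0_le; rewrite divr_gt0// ltr_wpDl//.
  apply: le_trans; rewrite mulrC ler_wpM2l//.
  by apply: le_trans (ler_norm _) _; rewrite lerDl.
have dc : derivable f c 1.
  by apply/cvg_ex; exists 0; under eq_fun do rewrite /= [_%:A]mulr1.
apply: DeriveDef => //; apply: cvg_lim => //.
by under eq_fun do rewrite /= [_%:A]mulr1.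
Unshelve. all: by end_near. Qed.

(** The classical flat function [exp(- 1 / x)] with the powers of [1 / x] that its derivatives
    produce. The quadratic bound [flat_quad] gives the derivative [0] at the origin for every [n] at
    once. *)
Definition flat n (x : R) : R := if 0 < x then x^-1 ^+ n * expR (- x^-1) else 0.

Lemma flat_ge0 n x : 0 <= flat n x.
Proof.
rewrite /flat; case: ltP => // x0.
by rewrite mulr_ge0 ?expR_ge0// exprn_ge0// invr_ge0 ltW.
Qed.

Lemma flat_quad n x : flat n x <= n.+2%:R ^+ n.+2 * x ^+ 2.
Proof.
rewrite /flat; case: ltP => x0; last by apply: mulr_ge0; [exact: exprn_ge0|exact: sqr_ge0].
have y0 : 0 <= x^-1 by rewrite invr_ge0 ltW.
have h := expn_le_expR n.+2 y0.
have -> : x^-1 ^+ n * expR (- x^-1) = (x^-1 ^+ n.+2 * expR (- x^-1)) * x ^+ 2.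
  rewrite [x^-1 ^+ n.+2]exprSr [x^-1 ^+ n.+1]exprSr.
  by field; rewrite gt_eqF.
rewrite ler_wpM2r ?sqr_ge0// expRN ler_pdivrMr ?expR_gt0//.
Qed.

Lemma dflat n (x : R) : is_derive x 1 (flat n) (- n%:R * flat n.+1 x + flat n.+2 x).
Proof.
have [x0|x0|<-] := ltgtP 0 x.
- have x_neq0 : x != 0 by rewrite gt_eqF.
  apply: (@near_eq_is_derive _ _ _ (fun x : R => x^-1 ^+ n * expR (- x^-1))).
    by near=> y; rewrite /flat ifT//; near: y; exact: lt_nbhsr.
  have d2 : is_derive x 1 (fun x : R => x^-1) (- x ^- 2 * 1).
    by apply: dinv => //; exact: did.
  deriv_with ltac:(exact: d2); rewrite /flat x0.
  by case: n => [|n] /=; rewrite ?exprS; field.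
- apply: (@near_eq_is_derive _ _ _ (fun _ : R => 0)).
    near=> y; rewrite /flat ifF//; apply/negbTE; rewrite -leNgt ltW//.
    by near: y; exact: lt_nbhsl.
  rewrite /flat ifF; last by apply/negbTE; rewrite -leNgt ltW.
  rewrite ifF; last by apply/negbTE; rewrite -leNgt ltW.
  by rewrite mulr0 addr0; exact: dcst.
- have fl0 k : flat k 0 = 0 by rewrite /flat ltxx.
  rewrite !fl0 mulr0 addr0.
  apply: (@is_derive0_quad _ _ (n.+2%:R ^+ n.+2)) => z.
  by rewrite fl0 !subr0 ger0_norm ?flat_ge0//; exact: flat_quad.
Unshelve. all: by end_near. Qed.

Lemma smooth1_flat : smooth1 (flat 0).
Proof.
pose B f := exists n, f = flat n.
apply: (@alg_smooth B) => [f [n ->]|]; last by apply: alg_base; exists 0%N.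
exists (fun x => - n%:R * flat n.+1 x + flat n.+2 x); last exact: dflat.
apply: alg_add; last by apply: alg_base; exists n.+2.
by apply: alg_mul; [exact: alg_cst|apply: alg_base; exists n.+1].
Qed.

Lemma flat0_le1 x : flat 0 x <= 1.
Proof.
rewrite /flat; case: ltP => // x0.
by rewrite expr0 mul1r -expR0 ler_expR oppr_le0 invr_ge0 ltW.
Qed.

Lemma flat0_gt0 x : 0 < x -> 0 < flat 0 x.
Proof. by move=> x0; rewrite /flat x0 expr0 mul1r expR_gt0. Qed.

Lemma flat0_le0 x : x <= 0 -> flat 0 x = 0.
Proof. by move=> x0; rewrite /flat ltNge x0. Qed.

(* Smooth functions increasing to the indicator function of an interval. *)
Definition bump (a b : R) n (x : R) : R :=
  flat 0 (n.+1%:R * x + - (n.+1%:R * a)) * flat 0 (- n.+1%:R * x + n.+1%:R * b).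

Lemma smooth1_bump a b n : smooth1 (bump a b n).
Proof. by apply: smooth1M; apply: smooth1_affine; exact: smooth1_flat. Qed.

Lemma bump_ge0 a b n x : 0 <= bump a b n x.
Proof. by rewrite mulr_ge0// flat_ge0. Qed.

Lemma bump_le1 a b n x : bump a b n x <= 1.
Proof. by rewrite mulr_ile1 ?flat_ge0 ?flat0_le1. Qed.

Lemma bump_out a b n x : ~ (a < x < b) -> bump a b n x = 0.
Proof.
move=> /negP; rewrite negb_and -!leNgt => /orP[h|h]; rewrite /bump.
  by rewrite flat0_le0 ?mul0r// subr_le0 ler_wpM2l.
by rewrite [X in _ * X]flat0_le0 ?mulr0// addrC mulNr subr_le0 ler_wpM2l.
Qed.

Lemma bump_gt0 a b n x : a < x < b -> 0 < bump a b n x.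
Proof.
move=> /andP[ax xb]; rewrite mulr_gt0// flat0_gt0//.
  by rewrite subr_gt0 ltr_pM2l.
by rewrite addrC mulNr subr_gt0 ltr_pM2l.
Qed.

Lemma bump_le a b n x : bump a b n x <= \1_(`]a, b[%classic : set R) x.
Proof.
have [h|h] := pselect (a < x < b).
  by rewrite indic_in ?bump_le1//= in_itv.
by rewrite bump_out.
Qed.

Lemma bump_cvg a b x :
  bump a b n x @[n --> \oo] --> (\1_(`]a, b[%classic : set R) x : R).
Proof.
have [h|h] := pselect (a < x < b); last first.
  rewrite indic_notin; last by rewrite /= in_itv.
  by under eq_fun do rewrite bump_out//; exact: cvg_cst.
rewrite indic_in; last by rewrite /= in_itv.
case/andP: h => ax xb.
have fE c : 0 < c -> flat 0 (n.+1%:R * c) @[n --> \oo] --> (1 : R).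
  move=> c0; rewrite (_ : (fun n => _) = (fun n => expR (- (n.+1%:R^-1 * c^-1)))); last first.
    by apply/funext => n; rewrite /flat mulr_gt0// expr0 mul1r invfM.
  have h : (n.+1%:R^-1 : R) @[n --> \oo] --> (0 : R) by exact: cvg_harmonic.
  have := cvg_comp _ expR (cvgN (cvgM h (cvg_cst c^-1))) (@continuous_expR R _).
  by rewrite mul0r oppr0 expR0 => H; exact: H.
have xa : 0 < x - a by rewrite subr_gt0.
have bx : 0 < b - x by rewrite subr_gt0.
have H := cvgM (fE _ xa) (fE _ bx); rewrite mulr1 in H.
rewrite (_ : (fun n => bump a b n x) =
  (fun n => flat 0 (n.+1%:R * (x - a)) * flat 0 (n.+1%:R * (b - x)))); last first.
  by apply/funext => n; rewrite /bump; congr (flat 0 _ * flat 0 _); ring.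
exact: H.
Qed.

Lemma L1_bump a b n : L1 mu (bump a b n).
Proof.
apply: (@L1_dom _ _ _ mu (\1_(`]a, b[%classic : set R))).
- by apply: cont_meas; apply: smooth1_cont; exact: smooth1_bump.
- by move=> x; rewrite ger0_norm ?bump_ge0// bump_le.
- exact: integrable_indic_itv.
Qed.

(** The primitive of [r] from [-oo] is identically zero, and by Lebesgue's differentiation theorem
    [r] is almost everywhere its derivative. *)
Lemma Rint_itv_eq0 (r : R -> R) : L1 mu r ->
  (forall a b, \int[mu]_x (\1_(`]a, b[%classic : set R) x * r x) = 0) ->
  {ae mu, forall x, r x = 0}.
Proof.
move=> ri r0; pose A (y : R) : set R := `]-oo, y]%classic.
have iA y : mu.-integrable (A y) (EFin \o r).
  by apply: (integrableS measurableT) ri => //; exact: measurable_itv.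
have F0 y : \int[mu]_(x in A y) r x = 0.
  rewrite Rint_set.
  have c : \int[mu]_x (\1_(`](y - n%:R), y[%classic : set R) x * r x) @[n --> \oo]
      --> \int[mu]_x (\1_(`]-oo, y[%classic : set R) x * r x).
    apply: (@Rint_dct _ _ _ mu _ _ (fun x => `|r x|)).
    - by move=> n; apply: measurable_funM => //; exact: L1_meas ri.
    - move=> x; apply: cvg_near_cst; have [xy|xy] := ltP x y.
        near=> n; congr (_ * _); rewrite [RHS]indic_in/= ?in_itv//.
        rewrite indic_in// /= in_itv/= xy andbT ltrBlDr -ltrBlDl.
        by near: n; exact: nbhs_infty_gtr.
      near=> n; congr (_ * _); rewrite [RHS]indic_notin/= ?in_itv/=; last first.
        by apply/negP; rewrite -leNgt.
      by rewrite indic_notin//= in_itv/= => /andP[_]; apply/negP; rewrite -leNgt.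
    - exact: L1_norm.
    - by move=> n x; rewrite indicE; case: (_ \in _); rewrite ?mul1r ?mul0r ?normr0.
  have {c} : \int[mu]_x (\1_(`]-oo, y[%classic : set R) x * r x) = 0.
    apply: cvg_unique c _ => //.
    rewrite (_ : (fun n : nat => _) = (fun=> 0)); first exact: cvg_cst.
    by apply/funext => n; exact: r0.
  move=> <-; apply: eq_Rint_ae.
  - apply: measurable_funM; last exact: L1_meas ri.
    by apply: measurable_indic; exact: measurable_itv.
  - by apply: measurable_funM => //; exact: L1_meas ri.
  - exists [set y]; split => //; first exact: lebesgue_measure_set1.
    move=> x /=; apply: contra_notP => xy.
    rewrite !indicE; suff -> : (x \in A y) = (x \in (`]-oo, y[%classic : set R)) by [].
    apply/idP/idP; rewrite !inE /A /= !in_itv/=; last exact: ltW.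
    by rewrite le_eqVlt => /predU1P[].
have lr : locally_integrable setT r.
  split; [exact: L1_meas ri|exact: openT|move=> K _ cK].
  have mK : measurable K by exact: compact_measurable.
  have /integrableP[_] : mu.-integrable K (EFin \o r) by apply: (integrableS measurableT) ri.
  by [].
apply: ae_imp (FTC1Ny iA lr) => x [_].
rewrite (_ : (fun x => _) = (fun=> 0)); last by apply/funext => y; exact: F0.
by rewrite derive1_cst.
Unshelve. all: by end_near. Qed.

(** The fundamental lemma of the calculus of variations for one concrete family of test functions,
    by dominated convergence towards the indicators of intervals. *)
Lemma Rint_bump_eq0 (r : R -> R) : L1 mu r ->
  (forall a b n, a < b -> \int[mu]_x (bump a b n x * r x) = 0) ->
  {ae mu, forall x, r x = 0}.
Proof.
move=> ri r0; apply: Rint_itv_eq0 => // a b.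
have [ab|ba] := ltP a b; last first.
  rewrite -[RHS](Rint0 mu); apply: eq_Rint => x; rewrite indic_notin ?mul0r//=.
  by rewrite in_itv/= => /andP[ax xb]; have := lt_trans ax xb; apply/negP; rewrite -leNgt.
have c : \int[mu]_x (bump a b n x * r x) @[n --> \oo] -->
    \int[mu]_x (\1_(`]a, b[%classic : set R) x * r x).
  apply: (@Rint_dct _ _ _ mu _ _ (fun x => `|r x|)).
  - move=> n; apply: measurable_funM; last exact: L1_meas ri.
    by apply: cont_meas; apply: smooth1_cont; exact: smooth1_bump.
  - by move=> x; apply: cvgM; [exact: bump_cvg|exact: cvg_cst].
  - exact: L1_norm.
  - by move=> n x; rewrite normrM ger0_norm ?bump_ge0// ler_piMl// bump_le1.
apply: cvg_unique c _ => //.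
rewrite (_ : (fun n : nat => _) = (fun=> 0)); first exact: cvg_cst.
by apply/funext => n; exact: r0.
Qed.

Lemma antideriv f A : continuous f -> (forall x, x <= A -> f x = 0) ->
  exists2 F : R -> R, (forall x : R, is_derive x 1 F (f x)) & (forall x, x <= A -> F x = 0).
Proof.
(* The base point lies strictly below [A], so that each [x >= A] is interior to an interval of
   integration. *)
move=> cf f0; pose F x := \int[mu]_(t in `[A - 1, x]) f t.
have F0 x : x <= A -> F x = 0.
  move=> xA; rewrite /F Rint_set -[RHS](Rint0 mu); apply: eq_Rint => y.
  have [|yI] := pselect (`[A - 1, x]%classic y); last by rewrite indic_notin ?mul0r.
  by rewrite /= in_itv/= => /andP[_ yx]; rewrite f0 ?mulr0// (le_trans yx).
exists F => // x; have [xA|xA] := ltP x A.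
  rewrite f0; last exact: ltW.
  apply: near_eq_is_derive (dcst 0 x).
  by near=> y; rewrite F0// ltW//; near: y; exact: lt_nbhsl.
have [] := @continuous_FTC1 _ f (BLeft (A - 1)) x (x + 1).
- by rewrite ltrDl.
- apply: continuous_compact_integrable; first exact: segment_compact.
  exact: continuous_subspaceT.
- by rewrite /= lte_fin; lra.
- exact: cf.
by move=> dF FE; rewrite -FE; exact: derivable_is_derive.
Unshelve. all: by end_near. Qed.

End smooth.

(** * Test functions of two variables *)

Section tensor.
Context {R : realType}.
Notation mu := (@lebesgue_measure R).

(** Combinations of products [th t * ka x]. They are stable under directional derivatives, which
    gives [smooth2], and are the only test functions put into [weak_deriv]. *)
Inductive tens : (R * R -> R) -> Prop :=
| tens_mul (th ka : R -> R) : smooth1 th -> smooth1 ka -> tens (fun z => th z.1 * ka z.2)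
| tens_add f g : tens f -> tens g -> tens (fun z => f z + g z)
| tens_scale c f : tens f -> tens (fun z => c * f z).

Let dfst (z : R * R) : differentiable (fst : R * R -> R) z.
Proof. by apply: linear_differentiable => x; exact: cvg_fst. Qed.

Let dsnd (z : R * R) : differentiable (snd : R * R -> R) z.
Proof. by apply: linear_differentiable => x; exact: cvg_snd. Qed.

Let dfstE (th : R -> R) (z v : R * R) : smooth1 th ->
  differentiable (fun z : R * R => th z.1) z /\
  'D_v (fun z : R * R => th z.1) z = v.1 * derive1 th z.1.
Proof.
move=> sth; have d0 := sth 0%N z.1.
have d1 : differentiable th z.1 by exact/derivable1_diffP.
have d2 : differentiable (fun z : R * R => th z.1) z.
  exact: (@differentiable_comp _ _ _ _ fst th).
split => //; rewrite deriveE// (@diff_comp _ _ _ _ fst th)//= (deriv1E d0).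
have -> // : 'd (fst : R * R -> R) z = fst :> (R * R -> R).
by apply: diff_lin => x; exact: cvg_fst.
Qed.

Let dsndE (th : R -> R) (z v : R * R) : smooth1 th ->
  differentiable (fun z : R * R => th z.2) z /\
  'D_v (fun z : R * R => th z.2) z = v.2 * derive1 th z.2.
Proof.
move=> sth; have d0 := sth 0%N z.2.
have d1 : differentiable th z.2 by exact/derivable1_diffP.
have d2 : differentiable (fun z : R * R => th z.2) z.
  exact: (@differentiable_comp _ _ _ _ snd th).
split => //; rewrite deriveE// (@diff_comp _ _ _ _ snd th)//= (deriv1E d0).
have -> // : 'd (snd : R * R -> R) z = snd :> (R * R -> R).
by apply: diff_lin => x; exact: cvg_snd.
Qed.

Lemma derive_tens (th ka : R -> R) (z v : R * R) : smooth1 th -> smooth1 ka ->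
  differentiable (fun z : R * R => th z.1 * ka z.2) z /\
  'D_v (fun z : R * R => th z.1 * ka z.2) z =
    v.1 * (derive1 th z.1 * ka z.2) + v.2 * (th z.1 * derive1 ka z.2).
Proof.
move=> sth ska; have [d1 e1] := dfstE z v sth; have [d2 e2] := dsndE z v ska.
split; first exact: differentiableM.
rewrite deriveM; [|exact: diff_derivable|exact: diff_derivable].
by rewrite e1 e2 /GRing.scale/=; ring.
Qed.

Lemma tens_smooth f : tens f -> smooth2 f.
Proof.
have D g : tens g -> (forall z, differentiable g z) /\ forall v, tens ('D_v g).
  elim => [th ka sth ska|{}g h tg [dg Dg] th [dh Dh]|c {}g tg [dg Dg]].
  - split=> [z|v]; first by have [] := derive_tens z 0 sth ska.
    rewrite (_ : 'D_v _ = (fun z => v.1 * (derive1 th z.1 * ka z.2) +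
      v.2 * (th z.1 * derive1 ka z.2))); last first.
      by apply/funext => z; have [_ ->] := derive_tens z v sth ska.
    by apply: tens_add; apply: tens_scale; apply: tens_mul => //; exact: smooth1_derive1.
  - split=> [z|v]; first exact: differentiableD.
    rewrite (_ : 'D_v _ = (fun z => 'D_v g z + 'D_v h z)); first exact: tens_add.
    by apply/funext => z; rewrite deriveD//; exact: diff_derivable.
  - split=> [z|v]; first exact: differentiableZ.
    rewrite (_ : 'D_v _ = (fun z => c * 'D_v g z)); first exact: tens_scale.
    by apply/funext => z; rewrite deriveZ//; exact: diff_derivable.
move=> tf vs z; have tfv : tens (foldr (fun v g => 'D_v g) f vs).
  by elim: vs => [//|v vs IH] /=; have [_] := D _ IH; apply.
by have [dd _] := D _ tfv; exact: dd.
Qed.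

Lemma test2_tens (th ka : R -> R) (M : R) : smooth1 th -> smooth1 ka ->
  (forall t, M < `|t| -> th t = 0) -> (forall x, M < `|x| -> ka x = 0) ->
  test2 (fun z : R * R => th z.1 * ka z.2).
Proof.
move=> sth ska th0 ka0; split; first exact/tens_smooth/tens_mul.
have cI : compact (`[- M, M]%classic : set R) by exact: segment_compact.
have cB := compact_setX cI cI.
apply: (subclosed_compact _ cB); first exact: closed_closure.
rewrite closureE => z; apply; split.
  by apply: compact_closed cB; exact: norm_hausdorff.
move=> [t x] /= n0; split => /=; rewrite in_itv/= -ler_norml leNgt;
  apply/negP => h; move: n0.
  by rewrite (th0 _ h) mul0r eqxx.
by rewrite (ka0 _ h) mulr0 eqxx.
Qed.

End tensor.

(** * Integrability against functions of class L_p on the plane *)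

Section weak.
Context {R : realType}.
Notation mu := (@lebesgue_measure R).
Variables (p : R) (p1 : 1 <= p).

Lemma LpR2_L1p (u : plane R -> R) : LpR2 p u -> L1 (leb2 R) (fun z => `|u z| `^ p).
Proof. by move=> up; exact: (Lfun_integrable p1 up). Qed.

Lemma LpR2_meas (u : plane R -> R) : LpR2 p u -> measurable_fun setT u.
Proof. by move=> /sub_Lfun_mfun /set_mem/=. Qed.

Lemma mul_le_powRD (a b : R) : 0 <= a -> 0 <= b <= 1 -> a * b <= a `^ p + b.
Proof.
move=> a0 /andP[b0 b1]; have [a1|a1] := leP a 1.
  by apply: (@le_trans _ _ b); [rewrite ler_piMl|rewrite lerDr powR_ge0].
apply: (@le_trans _ _ (a `^ p)); last by rewrite lerDl.
by rewrite (@le_trans _ _ a)// ?ler_piMr// le1r_powR// ltW.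
Qed.

Definition strip (M : R) (z : plane R) : R :=
  \1_(`[- M, M]%classic : set R) z.1 * omega z.2.

Lemma strip01 M z : 0 <= strip M z <= 1.
Proof.
have o0 := ltW (omega_gt0 z.2); have o1 := omega_le1 z.2.
have i0 : 0 <= (\1_(`[- M, M]%classic : set R) z.1 : R) by rewrite indicE.
have i1 : (\1_(`[- M, M]%classic : set R) z.1 : R) <= 1.
  by rewrite indicE; case: (_ \in _).
by apply/andP; split; [exact: mulr_ge0|exact: mulr_ile1].
Qed.

Lemma L1_indic_itv M : L1 mu (\1_(`[- M, M]%classic : set R)).
Proof. exact: integrable_indic_itv. Qed.

Lemma meas_fst (f : measurableTypeR R -> R) : measurable_fun setT f ->
  measurable_fun setT (fun z : plane R => f z.1).
Proof. by move=> mf; exact: (measurableT_comp mf measurable_fst). Qed.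

Lemma meas_snd (f : measurableTypeR R -> R) : measurable_fun setT f ->
  measurable_fun setT (fun z : plane R => f z.2).
Proof. by move=> mf; exact: (measurableT_comp mf measurable_snd). Qed.

Lemma measurable_strip M : measurable_fun setT (strip M).
Proof.
apply: measurable_funM; [apply: meas_fst|apply: meas_snd].
  by apply: measurable_indic; exact: measurable_itv.
by apply: cont_meas; exact: continuous_omega.
Qed.

Lemma L1_strip M : L1 (leb2 R) (strip M).
Proof.
apply: (@L1_prod _ _ _ _ _ mu mu _ (\1_(`[- M, M]%classic : set R)) omega).
- exact: measurable_strip.
- exact: L1_indic_itv.
- exact: L1_omega.
- by move=> t x; rewrite ger0_norm//; case/andP: (strip01 M (t, x)).
Qed.

Lemma L1_LpR2 (u b : plane R -> R) (M C : R) : LpR2 p u -> measurable_fun setT b ->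
  (forall z, `|b z| <= C * strip M z) -> L1 (leb2 R) (fun z => u z * b z).
Proof.
move=> up mb bC.
apply: (@L1_dom _ _ _ (leb2 R) (fun z => `|C| * (`|u z| `^ p + strip M z))).
- by apply: measurable_funM => //; exact: LpR2_meas.
- move=> z; rewrite normrM; apply: (@le_trans _ _ (`|u z| * (`|C| * strip M z))).
    rewrite ler_wpM2l// (le_trans (bC z))// ler_wpM2r ?ler_norm//.
    by case/andP: (strip01 M z).
  by rewrite mulrCA ler_wpM2l// mul_le_powRD// strip01.
- by apply: L1Z; apply: L1D; [exact: LpR2_L1p|exact: L1_strip].
Qed.

End weak.


(** * The weak time derivative *)

Section fubini_weight.
Context d1 d2 (T1 : measurableType d1) (T2 : measurableType d2) (R : realType)
  (m1 : {sigma_finite_measure set T1 -> \bar R})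
  (m2 : {sigma_finite_measure set T2 -> \bar R}).
Variables (F : T1 * T2 -> R) (iF : L1 (m1 \x m2)%E F) (K : R).

(** The factor leaves the inner integral where the section is integrable, that is almost
    everywhere. *)
Lemma fubini_weight1 (b : T1 -> R) : measurable_fun setT b -> (forall x, `|b x| <= K) ->
  \int[(m1 \x m2)%E]_z (F z * b z.1) = \int[m1]_x (b x * \int[m2]_y F (x, y)).
Proof.
move=> mb bK.
have iFb : L1 (m1 \x m2)%E (fun z => F z * b z.1).
  apply: eq_L1 (@L1Mb _ _ _ _ K (fun z => b z.1) F _ _ iF) => [z||z].
  - by rewrite mulrC.
  - exact: (measurableT_comp mb measurable_fst).
  - exact: bK.
rewrite -(Rint_fubini1 iFb); apply: eq_Rint_ae.
- exact: L1_meas (L1_fubini1 iFb).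
- by apply: measurable_funM => //; exact: L1_meas (L1_fubini1 iF).
- apply: filterS (ae_L1_fubini1 iF) => x ix; rewrite -RintZ//.
  by apply: eq_Rint => y /=; rewrite mulrC.
Qed.

Lemma fubini_weight2 (b : T2 -> R) : measurable_fun setT b -> (forall x, `|b x| <= K) ->
  \int[(m1 \x m2)%E]_z (F z * b z.2) = \int[m2]_y (b y * \int[m1]_x F (x, y)).
Proof.
move=> mb bK.
have iFb : L1 (m1 \x m2)%E (fun z => F z * b z.2).
  apply: eq_L1 (@L1Mb _ _ _ _ K (fun z => b z.2) F _ _ iF) => [z||z].
  - by rewrite mulrC.
  - exact: (measurableT_comp mb measurable_snd).
  - exact: bK.
rewrite -(Rint_fubini2 iFb); apply: eq_Rint_ae.
- exact: L1_meas (L1_fubini2 iFb).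
- by apply: measurable_funM => //; exact: L1_meas (L1_fubini2 iF).
- apply: filterS (ae_L1_fubini2 iF) => x ix; rewrite -RintZ//.
  by apply: eq_Rint => y /=; rewrite mulrC.
Qed.

End fubini_weight.

Section localized.
Context {R : realType}.
Notation mu := (@lebesgue_measure R).

(** Applies [Rint_itv_eq0] to the restriction of [r]; clipping []a, b[] to []a', b'[] leaves only
    bumps supported in [[A, B]]. *)
Lemma Rint_bump_eq0_on (A B : R) (r : R -> R) : L1 mu r ->
  (forall a b n, A <= a -> a < b -> b <= B -> \int[mu]_x (bump a b n x * r x) = 0) ->
  {ae mu, forall x, A < x < B -> r x = 0}.
Proof.
move=> ri r0; pose r' x := \1_(`]A, B[%classic : set R) x * r x.
have r'i : L1 mu r'.
  apply: (@L1_dom _ _ _ mu (fun x => `|r x|)).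
  - by apply: measurable_funM; [apply: measurable_indic; exact: measurable_itv|exact: L1_meas ri].
  - by move=> x; rewrite /r' indicE; case: (_ \in _); rewrite ?mul1r ?mul0r ?normr0.
  - exact: L1_norm.
suff : {ae mu, forall x, r' x = 0}.
  apply: ae_imp => x r'x /andP[Ax xB]; move: r'x; rewrite /r' indic_in ?mul1r//=.
  by rewrite in_itv/= Ax.
apply: Rint_itv_eq0 => // a b.
pose a' := Num.max a A; pose b' := Num.min b B.
rewrite (_ : \int[mu]_x _ = \int[mu]_x (\1_(`]a', b'[%classic : set R) x * r x)); last first.
  apply: eq_Rint => x; rewrite /r' mulrA; congr (_ * _).
  have [h|h] := pselect (`]a', b'[%classic x).
    rewrite (indic_in h); move: h; rewrite /= in_itv/= gt_max lt_min => /andP[/andP[? ?] /andP[? ?]].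
    by rewrite !indic_in ?mulr1//= in_itv/=; apply/andP.
  rewrite (indic_notin h); have [h1|h1] := pselect (`]a, b[%classic x); last by rewrite (indic_notin h1) mul0r.
  have [h2|h2] := pselect (`]A, B[%classic x); last by rewrite (indic_notin h2) mulr0.
  exfalso; apply: h; move: h1 h2; rewrite /= !in_itv/= gt_max lt_min.
  by move=> /andP[-> ->] /andP[-> ->].
have [ab|ba] := ltP a' b'; last first.
  rewrite -[RHS](Rint0 mu); apply: eq_Rint => x; rewrite indic_notin ?mul0r//=.
  by rewrite in_itv/= => /andP[ax xb]; have := lt_trans ax xb; apply/negP; rewrite -leNgt.
have c : \int[mu]_x (bump a' b' n x * r x) @[n --> \oo] -->
    \int[mu]_x (\1_(`]a', b'[%classic : set R) x * r x).
  apply: (@Rint_dct _ _ _ mu _ _ (fun x => `|r x|)).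
  - move=> n; apply: measurable_funM; last exact: L1_meas ri.
    by apply: cont_meas; apply: smooth1_cont; exact: smooth1_bump.
  - by move=> x; apply: cvgM; [exact: bump_cvg|exact: cvg_cst].
  - exact: L1_norm.
  - by move=> n x; rewrite normrM ger0_norm ?bump_ge0// ler_piMl// bump_le1.
apply: cvg_unique c _ => //.
rewrite (_ : (fun n : nat => _) = (fun=> 0)); first exact: cvg_cst.
by apply/funext => n; apply: r0 => //; rewrite ?le_max ?ge_min lexx orbT.
Qed.

Lemma cpt_bound (f : R -> R) (M : R) : continuous f -> (forall t, M < `|t| -> f t = 0) ->
  exists2 K, 0 <= K & forall t, `|f t| <= K * \1_(`[- M, M]%classic : set R) t.
Proof.
move=> cf f0; have [M0|M0] := leP 0 M; last first.
  by exists 0 => // t; rewrite mul0r f0 ?normr0// (lt_le_trans M0).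
have NMM : - M <= M by lra.
have cF : continuous (fun t => `|f t|) by move=> x; apply: cvg_norm; exact: cf.
have [c _ cP] := EVT_max NMM (continuous_subspaceT cF).
exists `|f c| => // t; have [tM|tM] := pselect (`[- M, M]%classic t).
  by rewrite (indic_in tM) mulr1; exact: cP.
rewrite (indic_notin tM) mulr0 f0 ?normr0// ltNge ler_norml.
by apply/negP => h; apply: tM; rewrite /= in_itv.
Qed.

Lemma derive1_supp (f : R -> R) (M : R) : (forall t, M < `|t| -> f t = 0) ->
  forall t : R, M < `|t| -> derive1 f t = 0.
Proof.
move=> f0 t tM; rewrite derive1E.
suff H : is_derive t 1 f 0 by case: H.
apply: near_eq_is_derive (dcst 0 t); near=> y; rewrite f0//.
near: y; apply: (cvgr_gt `|t|) => //; apply: cvg_norm; exact: cvg_id.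
Unshelve. all: by end_near. Qed.

End localized.

Section time_derivative.
Context {R : realType}.
Notation mu := (@lebesgue_measure R).
Variables (p : R) (p1 : 1 <= p) (W Wt : plane R -> R).
Hypotheses (Wp : LpR2 p W) (Wtp : LpR2 p Wt) (dW : weak_deriv dir_t W Wt).
Hypothesis W0 : forall t x, t <= 0 -> W (t, x) = 0.
Variables (m : R -> R) (C : R).
Hypotheses (mm : measurable_fun setT (m : measurableTypeR R -> R))
  (mC : forall x, `|m x| <= C * omega x).

Let strip_bnd (th : R -> R) (k : R -> R) M K K' : 0 <= K -> 
  (forall t, `|th t| <= K * \1_(`[- M, M]%classic : set R) t) ->
  (forall x, `|k x| <= K' * omega x) ->
  forall z : plane R, `|th z.1 * k z.2| <= (K * K') * strip M z.
Proof.
move=> K0 hth hk z; rewrite normrM /strip mulrACA.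
by apply: ler_pM.
Qed.

Let weak_t_bump (th : R -> R) (M : R) (a b : R) n : smooth1 th ->
  (forall t, M < `|t| -> th t = 0) ->
  \int[leb2 R]_z (W z * (derive1 th z.1 * (bump a b n z.2 * omega z.2))) =
  - \int[leb2 R]_z (Wt z * (th z.1 * (bump a b n z.2 * omega z.2))).
Proof.
move=> sth th0.
have ska : smooth1 (fun x => bump a b n x * omega x).
  by apply: smooth1M; [exact: smooth1_bump|exact: smooth1_omega].
pose M' := Num.max M (Num.max `|a| `|b|).
have := dW (test2_tens (M := M') sth ska _ _).
rewrite (eq_Rint _ (g := fun z => W z * (derive1 th z.1 * (bump a b n z.2 * omega z.2)))).
  apply.
    by move=> t; rewrite gt_max => /andP[h _]; exact: th0.
  move=> x; rewrite !gt_max => /andP[_ /andP[ha hb]]; rewrite bump_out ?mul0r//.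
  move=> /andP[ax xb]; move: ha hb.
  have := ler_norm b; have := ler_norm (- a); rewrite normrN.
  by have [h|h] := leP 0 x; rewrite ?(ger0_norm h) ?(ltr0_norm h); lra.
move=> z; congr (_ * _); have [_ ->] := derive_tens z dir_t sth ska.
by rewrite /dir_t/= mul1r mul0r addr0.
Qed.

(** Replaces the compactly supported factor in [x] by any measurable [m] bounded by a multiple of
    [omega], such as [Lam phi]. The function [h] of [x] that remains after integrating in [t],
    weighted by [omega], is integrable and orthogonal to all bumps, hence zero almost everywhere; it
    is then integrated against the bounded quotient [m / omega]. *)
Lemma weak_t_test (th : R -> R) (M : R) : smooth1 th ->
  (forall t, M < `|t| -> th t = 0) ->
  \int[leb2 R]_z (W z * (derive1 th z.1 * m z.2)) =
  - \int[leb2 R]_z (Wt z * (th z.1 * m z.2)).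
Proof.
move=> sth th0; have sth' := smooth1_derive1 sth.
have [K K0 HK] := cpt_bound (smooth1_cont sth) th0.
have [K' K'0 HK'] := cpt_bound (smooth1_cont sth') (derive1_supp th0).
have mth : measurable_fun setT (th : measurableTypeR R -> R) := cont_meas (smooth1_cont sth).
have mth' : measurable_fun setT (derive1 th : measurableTypeR R -> R) := cont_meas (smooth1_cont sth').
have mo : measurable_fun setT (omega : measurableTypeR R -> R) := cont_meas (@continuous_omega R).
have oo x : `|omega x| <= 1 * omega x :> R by rewrite mul1r ger0_norm// ltW// omega_gt0.
have i1 (k : R -> R) c : measurable_fun setT (k : measurableTypeR R -> R) ->
    (forall x, `|k x| <= c * omega x) -> L1 (leb2 R) (fun z => W z * (derive1 th z.1 * k z.2)).
  move=> mk hk; apply: (L1_LpR2 p1 Wp _ (strip_bnd K'0 HK' hk)).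
  by apply: measurable_funM; [exact: meas_fst|exact: meas_snd].
have i2 (k : R -> R) c : measurable_fun setT (k : measurableTypeR R -> R) ->
    (forall x, `|k x| <= c * omega x) -> L1 (leb2 R) (fun z => Wt z * (th z.1 * k z.2)).
  move=> mk hk; apply: (L1_LpR2 p1 Wtp _ (strip_bnd K0 HK hk)).
  by apply: measurable_funM; [exact: meas_fst|exact: meas_snd].
pose F (z : plane R) := W z * (derive1 th z.1 * omega z.2) + Wt z * (th z.1 * omega z.2).
have iF : L1 (leb2 R) F by apply: L1D; [exact: i1 oo|exact: i2 oo].
pose h x := \int[mu]_t F (t, x).
have ih : L1 mu h := L1_fubini2 iF.
have h0 : {ae mu, forall x, h x = 0}.
  apply: Rint_bump_eq0 => // a b n _.
  have mb : measurable_fun setT (bump a b n : measurableTypeR R -> R).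
    by apply: cont_meas; apply: smooth1_cont; exact: smooth1_bump.
  have b1 x : `|bump a b n x| <= 1 by rewrite ger0_norm ?bump_ge0// bump_le1.
  rewrite /h -(fubini_weight2 iF mb b1).
  have mbo : measurable_fun setT ((fun x => bump a b n x * omega x) : measurableTypeR R -> R).
    by apply: measurable_funM.
  have bo x : `|bump a b n x * omega x| <= 1 * omega x.
    by rewrite normrM (ger0_norm (ltW (omega_gt0 x))) ler_wpM2r// ltW// omega_gt0.
  rewrite (eq_Rint _ (g := fun z => W z * (derive1 th z.1 * (bump a b n z.2 * omega z.2)) +
     Wt z * (th z.1 * (bump a b n z.2 * omega z.2)))); last by move=> z; rewrite /F; ring.
  rewrite RintD; [|exact: i1 bo|exact: i2 bo].
  by rewrite (weak_t_bump _ _ _ sth th0) addNr.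
have mq : measurable_fun setT ((fun x => m x * (1 + x ^+ 2)) : measurableTypeR R -> R).
  apply: measurable_funM => //; apply: cont_meas => x.
  apply: cvgD; first exact: cvg_cst.
  exact: exprn_continuous.
have oE x : omega x * (1 + x ^+ 2) = 1 :> R.
  by rewrite mulVf// gt_eqF// ltr_wpDr// sqr_ge0.
have qC x : `|m x * (1 + x ^+ 2)| <= C.
  have o0 : 0 < 1 + x ^+ 2 :> R by rewrite ltr_wpDr// sqr_ge0.
  rewrite normrM (gtr0_norm o0) -ler_pdivlMr//; exact: mC.
have := fubini_weight2 iF mq qC.
rewrite (eq_Rint _ (g := fun z => W z * (derive1 th z.1 * m z.2) + Wt z * (th z.1 * m z.2))).
  rewrite RintD; [|exact: i1 mC|exact: i2 mC].
  move=> E; apply/eqP; rewrite -addr_eq0 E; apply/eqP.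
  rewrite -[RHS](Rint0 mu); apply: eq_Rint_ae.
  - by apply: measurable_funM => //; exact: L1_meas ih.
  - exact: measurable_cst.
  - by apply: ae_imp h0 => x; rewrite /h => ->; rewrite mulr0.
move=> z; rewrite /F.
have -> : (W z * (derive1 th z.1 * omega z.2) + Wt z * (th z.1 * omega z.2)) * (m z.2 * (1 + z.2 ^+ 2)) =
  (W z * (derive1 th z.1 * m z.2) + Wt z * (th z.1 * m z.2)) * (omega z.2 * (1 + z.2 ^+ 2)) by ring.
by rewrite oE mulr1.
Qed.

End time_derivative.
Section absolute_continuity.
Context {R : realType}.
Notation mu := (@lebesgue_measure R).
Variables (p : R) (p1 : 1 <= p) (W Wt : plane R -> R).
Hypotheses (Wp : LpR2 p W) (Wtp : LpR2 p Wt) (dW : weak_deriv dir_t W Wt).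
Hypothesis W0 : forall t x, t <= 0 -> W (t, x) = 0.
Variables (m : R -> R) (C : R).
Hypotheses (mm : measurable_fun setT (m : measurableTypeR R -> R))
  (mC : forall x, `|m x| <= C * omega x).

(** A window in time: a function of class [L_p] on the plane is integrable in [t] only over bounded
    times. It reaches below [0], where [W] vanishes. *)
Definition win (t : R) : R := \1_(`[- 1, 1]%classic : set R) t.
Definition pairing (V : plane R -> R) (t : R) : R := \int[mu]_x (V (t, x) * (win t * m x)).

Lemma L1_win_mul V : LpR2 p V -> L1 (leb2 R) (fun z => V z * (win z.1 * m z.2)).
Proof.
move=> Vp; apply: (@L1_LpR2 R p p1 V _ 1 C Vp).
  apply: measurable_funM; [apply: meas_fst|exact: meas_snd].
  by apply: measurable_indic; exact: measurable_itv.
move=> z; rewrite normrM /strip mulrCA ger0_norm; last by rewrite /win indicE.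
by rewrite ler_wpM2l// /win indicE.
Qed.

Lemma L1_pairing V : LpR2 p V -> L1 mu (pairing V).
Proof. by move=> /L1_win_mul iV; exact: (L1_fubini1 iV). Qed.

Lemma pairingE V t : -1 <= t <= 1 -> pairing V t = \int[mu]_x (V (t, x) * m x).
Proof.
move=> t1; apply: eq_Rint => x; rewrite /win indic_in ?mul1r//=.
Qed.

Lemma pairing_weight V (th : R -> R) K : LpR2 p V -> measurable_fun setT (th : measurableTypeR R -> R) ->
  (forall t, `|th t| <= K) -> (forall t, 1 < `|t| -> th t = 0) ->
  \int[leb2 R]_z (V z * (th z.1 * m z.2)) = \int[mu]_t (th t * pairing V t).
Proof.
move=> Vp mth thK th0; rewrite /pairing -(fubini_weight1 (L1_win_mul Vp) mth thK).
apply: eq_Rint => z; have [h|h] := leP `|z.1| 1.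
  have hw : win z.1 = 1 by rewrite /win indic_in//= in_itv/= -ler_norml.
  by rewrite hw; ring.
by rewrite th0//; ring.
Qed.

Let gl := pairing W.
Let Gl := pairing Wt.
Let igl : L1 mu gl. Proof. exact: L1_pairing. Qed.
Let iGl : L1 mu Gl. Proof. exact: L1_pairing. Qed.

(** On []-1, 1[] the scalar function [pairing W] has the weak derivative [pairing Wt]; from here on
    the argument is one-dimensional. *)
Lemma pairing_test (th : R -> R) : smooth1 th -> (forall t, 1 < `|t| -> th t = 0) ->
  \int[mu]_t (derive1 th t * gl t) = - \int[mu]_t (th t * Gl t).
Proof.
move=> sth th0; have sth' := smooth1_derive1 sth.
have th'0 := derive1_supp th0.
have bd (f : R -> R) : smooth1 f -> (forall t, 1 < `|t| -> f t = 0) ->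
    exists K, forall t, `|f t| <= K.
  move=> sf f0; have [K K0 HK] := cpt_bound (smooth1_cont sf) f0.
  exists K => t; apply: le_trans (HK t) _; by rewrite ler_piMr// (le_trans (ler_norm _))// norm_indic_le1.
have [K HK] := bd _ sth th0; have [K' HK'] := bd _ sth' th'0.
rewrite -(pairing_weight Wp (cont_meas (smooth1_cont sth')) HK' th'0).
rewrite -(pairing_weight Wtp (cont_meas (smooth1_cont sth)) HK th0).
exact: (weak_t_test p1 Wp Wtp dW mm mC sth th0).
Qed.

Let gl0 t : t <= 0 -> gl t = 0.
Proof.
move=> t0; rewrite /gl /pairing -[RHS](Rint0 mu); apply: eq_Rint => x.
by rewrite W0// mul0r.
Qed.

Let Gl0 : {ae mu, forall t, -1 < t < 0 -> Gl t = 0}.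
Proof.
apply: Rint_bump_eq0_on => // a b n a1 ab b0.
have th0 t : 1 < `|t| -> bump a b n t = 0.
  move=> t1; apply: bump_out => /andP[ta tb]; move: t1; apply/negP; rewrite -leNgt ler_norml.
  by apply/andP; split; lra.
apply/eqP; rewrite -oppr_eq0 -(pairing_test (@smooth1_bump _ a b n) th0).
rewrite -[X in _ == X](Rint0 mu); apply/eqP; apply: eq_Rint => t.
have [t0|t0] := ltP 0 t; last by rewrite gl0 ?mulr0.
rewrite derive1E.
suff H : is_derive t 1 (bump a b n) 0 by case: H => _ ->; rewrite mul0r.
apply: near_eq_is_derive (dcst 0 t); near=> y; rewrite bump_out//.
move=> /andP[_ yb]; have : 0 < y by near: y; exact: lt_nbhsr.
by lra.
Unshelve. all: by end_near. Qed.

Lemma L1_indM (A : set (measurableTypeR R)) (r : R -> R) : measurable A -> L1 mu r ->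
  L1 mu (fun s => \1_A s * r s).
Proof.
move=> mA ir; apply: (@L1Mb _ _ _ mu 1 (\1_A)) ir => [|x].
  exact: measurable_indic.
exact: norm_indic_le1.
Qed.

Definition cum (r : R -> R) (t : R) : R :=
  \int[mu]_s (\1_(`]0, t]%classic : set R) s * r s).

Let Tb (b : R -> R) s : R := \int[mu]_t (\1_(`[s, 1]%classic : set R) t * b t).

Lemma L1_prodM (r b : R -> R) : L1 mu r -> L1 mu b -> L1 (leb2 R) (fun z => r z.1 * b z.2).
Proof.
move=> ir ib; apply: (@L1_prod _ _ _ _ _ mu mu _ (fun x => `|r x|) (fun x => `|b x|)).
- by apply: measurable_funM; [exact: (meas_fst (L1_meas ir))|exact: (meas_snd (L1_meas ib))].
- exact: L1_norm.
- exact: L1_norm.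
- by move=> x y; rewrite normrM.
Qed.

Lemma measurable_lez : measurable [set z : plane R | z.1 <= z.2].
Proof.
have -> : [set z : plane R | z.1 <= z.2] =
    setT `&` (fun z : plane R => z.2 - z.1) @^-1` (`[0, +oo[%classic : set R).
  by apply/seteqP; split => z /=; rewrite in_itv/= andbT subr_ge0 => H; [split|case: H].
have mf : measurable_fun setT (fun z : plane R => z.2 - z.1).
  have mi : measurable_fun setT ((fun x => x) : measurableTypeR R -> R).
    by apply: cont_meas => x; exact: cvg_id.
  by apply: measurable_funB; [exact: (meas_snd mi)|exact: (meas_fst mi)].
by apply: mf => //; exact: measurable_itv.
Qed.

Lemma measurable_gez : measurable [set z : plane R | z.2 <= z.1].
Proof.
have -> : [set z : plane R | z.2 <= z.1] =
    setT `&` (fun z : plane R => z.1 - z.2) @^-1` (`[0, +oo[%classic : set R).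
  by apply/seteqP; split => z /=; rewrite in_itv/= andbT subr_ge0 => H; [split|case: H].
have mf : measurable_fun setT (fun z : plane R => z.1 - z.2).
  have mi : measurable_fun setT ((fun x => x) : measurableTypeR R -> R).
    by apply: cont_meas => x; exact: cvg_id.
  by apply: measurable_funB; [exact: (meas_fst mi)|exact: (meas_snd mi)].
by apply: mf => //; exact: measurable_itv.
Qed.

(* Integration by parts, as Fubini's theorem on the triangle [0 < s <= t <= 1]. *)
Lemma cum_fubini (r b : R -> R) : L1 mu r -> L1 mu b ->
  \int[mu]_t (\1_(`]0, 1]%classic : set R) t * (cum r t * b t)) =
  \int[mu]_s (\1_(`]0, 1]%classic : set R) s * (r s * Tb b s)).
Proof.
move=> ir ib.
pose ch (z : plane R) : R := \1_[set z : plane R | z.1 <= z.2] z *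
  (\1_(`]0, 1]%classic : set R) z.1 * \1_(`]0, 1]%classic : set R) z.2).
have mch : measurable_fun setT ch.
  apply: measurable_funM; first by apply: measurable_indic; exact: measurable_lez.
  by apply: measurable_funM; [apply: meas_fst|apply: meas_snd];
    apply: measurable_indic; exact: measurable_itv.
have ch1 z : `|ch z| <= 1.
  by rewrite /ch !normrM !mulr_ile1// norm_indic_le1.
have iF : L1 (leb2 R) (fun z => ch z * (r z.1 * b z.2)).
  by apply: L1Mb mch ch1 _; exact: L1_prodM.
have E1 t s : ch (s, t) = \1_(`]0, 1]%classic : set R) t * \1_(`]0, t]%classic : set R) s.
  rewrite /ch /=; have [ht|ht] := pselect (`]0, 1]%classic t); last first.
    by rewrite (indic_notin ht) mulr0 mulr0 mul0r.
  have := ht; rewrite /= in_itv/= => /andP[t0 t1].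
  rewrite (indic_in ht) mulr1 mul1r.
  have [/= h1|h1] := pselect ([set z : plane R | z.1 <= z.2] (s, t)).
    rewrite indic_in// mul1r; have [s0|s0] := ltP 0 s.
      by rewrite !indic_in//= in_itv/= s0// (le_trans h1).
    by rewrite !indic_notin//= in_itv/= => /andP[+ _]; apply/negP; rewrite -leNgt.
  rewrite (indic_notin h1) mul0r indic_notin//= in_itv/= => /andP[_ st].
  by apply: h1.
have E2 t s : ch (s, t) = \1_(`]0, 1]%classic : set R) s * \1_(`[s, 1]%classic : set R) t.
  rewrite /ch /=; have [hs|hs] := pselect (`]0, 1]%classic s); last first.
    by rewrite (indic_notin hs) mul0r mulr0 mul0r.
  have := hs; rewrite /= in_itv/= => /andP[s0 s1].
  rewrite (indic_in hs) !mul1r.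
  have [/= h1|h1] := pselect ([set z : plane R | z.1 <= z.2] (s, t)).
    rewrite indic_in// mul1r; have [t1|t1] := leP t 1.
      by rewrite !indic_in//= in_itv/= ?t1 ?andbT// (lt_le_trans s0).
    by rewrite !indic_notin//= in_itv/= => /andP[_]; apply/negP; rewrite -ltNge.
  rewrite (indic_notin h1) mul0r indic_notin//= in_itv/= => /andP[st _].
  by apply: h1.
transitivity (\int[mu]_t \int[mu]_s (ch (s, t) * (r s * b t))).
  apply: eq_Rint => t; rewrite /cum.
  transitivity ((\1_(`]0, 1]%classic : set R) t * b t) *
     \int[mu]_s (\1_(`]0, t]%classic : set R) s * r s)); first by ring.
  rewrite -RintZ; last by apply: L1_indM => //; exact: measurable_itv.
  by apply: eq_Rint => s; rewrite E1; ring.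
rewrite (Rint_fubini2 iF) -(Rint_fubini1 iF); apply: eq_Rint => s; rewrite /Tb.
transitivity ((\1_(`]0, 1]%classic : set R) s * r s) *
     \int[mu]_t (\1_(`[s, 1]%classic : set R) t * b t)); last by ring.
rewrite -RintZ; last by apply: L1_indM => //; exact: measurable_itv.
by apply: eq_Rint => t; rewrite E2; ring.
Qed.

(** The primitive is a partial integral of a function on the triangle [s <= t], so Fubini's theorem
    gives measurability and integrability together. *)
Lemma L1_cum (r : R -> R) : L1 mu r -> L1 mu (fun t => \1_(`]0, 1]%classic : set R) t * cum r t).
Proof.
move=> ir.
pose H (z : plane R) : R := \1_(`]0, 1]%classic : set R) z.1 *
  (\1_[set z : plane R | z.2 <= z.1] z * (\1_(`]0, 1]%classic : set R) z.2 * r z.2)).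
have mH : measurable_fun setT H.
  apply: measurable_funM; first by apply: meas_fst; apply: measurable_indic; exact: measurable_itv.
  apply: measurable_funM; last first.
    apply: (@meas_snd _ (fun s => \1_(`]0, 1]%classic : set R) s * r s)).
    apply: measurable_funM; last exact: L1_meas ir.
    by apply: measurable_indic; exact: measurable_itv.
  by apply: measurable_indic; exact: measurable_gez.
have iH : L1 (leb2 R) H.
  apply: (@L1_prod _ _ _ _ _ mu mu _ (\1_(`]0, 1]%classic : set R)) (fun x => `|r x|)) => //.
  - exact: integrable_indic_itv.
  - exact: L1_norm.
  - move=> x y; rewrite /H/= !normrM; apply: ler_pM => //.
      by rewrite ger0_norm// indicE.
    by rewrite mulrA ler_piMl// mulr_ile1// norm_indic_le1.
apply: eq_L1 (L1_fubini1 iH) => t.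
have [ht|ht] := pselect (`]0, 1]%classic t); last first.
  rewrite (indic_notin ht) mul0r -[RHS](Rint0 mu); apply: eq_Rint => s.
  by rewrite /H /= (indic_notin ht) mul0r.
have := ht; rewrite /= in_itv/= => /andP[t0 t1].
rewrite (indic_in ht) mul1r; apply: eq_Rint => s; rewrite /H /= (indic_in ht) mul1r mulrA.
congr (_ * _); have [hs|hs] := pselect (`]0, t]%classic s).
  rewrite (indic_in hs); move: hs; rewrite /= in_itv/= => /andP[s0 st].
  by rewrite !indic_in ?mulr1//= in_itv/= s0 (le_trans st).
rewrite (indic_notin hs); have [s0|s0] := ltP 0 s; last first.
  rewrite [X in _ * X]indic_notin ?mulr0//= in_itv/= => /andP[+ _].
  by apply/negP; rewrite -leNgt.
rewrite indic_notin ?mul0r//= => st; apply: hs.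
by rewrite /= in_itv/= s0.
Qed.

(** The vanishing of [W] for [t <= 0] fixes the constant of integration. A bump [B] in time is not
    the derivative of a compactly supported function, its integral being positive; subtracting a
    multiple of a bump [BJ] in negative times repairs this, and [BJ] is not seen by [pairing W],
    which is zero there. *)
Lemma pairing_cum : {ae mu, forall t, 0 < t < 1 -> pairing W t = cum (pairing Wt) t}.
Proof.
pose r t := \1_(`]0, 1]%classic : set R) t * gl t - \1_(`]0, 1]%classic : set R) t * cum Gl t.
have m01 : measurable (`]0%R, 1%R]%classic : set (measurableTypeR R)) by exact: measurable_itv.
have ir : L1 mu r by apply: L1B; [exact: L1_indM|exact: L1_cum].
suff : {ae mu, forall t, 0 < t < 1 -> r t = 0}.
  apply: ae_imp => t + t01; move=> /(_ t01); rewrite /r indic_in ?mul1r.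
    by move=> /eqP; rewrite subr_eq0 => /eqP.
  by case/andP: t01 => t0 t1; rewrite /= in_itv/= t0 ltW.
apply: Rint_bump_eq0_on => // a b n a0 ab b1.
pose B : R -> R := bump a b n; pose BJ : R -> R := bump (-1) 0 0%N.
have iB : L1 mu B by exact: L1_bump.
have iBJ : L1 mu BJ by exact: L1_bump.
have Bout t : ~ (0 < t < 1) -> B t = 0.
  by move=> h; apply: bump_out => /andP[h1 h2]; apply: h; apply/andP; split; lra.
have BJout t : ~ (-1 < t < 0) -> BJ t = 0 by exact: bump_out.
pose d := \int[mu]_t B t; pose e := \int[mu]_t BJ t.
have e_neq0 : e != 0.
  apply/eqP => e0; have := Rint_eq0 iBJ (fun x => bump_ge0 (-1) 0 0%N x) e0.
  move=> [N [mN N0 sN]].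
  have : (mu (`](-1)%R, 0%R[%classic : set R) <= mu N)%E.
    apply: le_measure; rewrite ?inE//; apply: subset_trans sN => t /=.
    by rewrite in_itv/= => ht; apply/eqP; rewrite gt_eqF// bump_gt0.
  rewrite N0 lebesgue_measure_itv/= lte_fin ltrN10 add0e lee_fin.
  by rewrite opprK ler10.
pose c := d / e; pose f t := B t + - c * BJ t.
have sf : smooth1 f by apply: smooth1D; [|apply: smooth1Z]; exact: smooth1_bump.
have cf := smooth1_cont sf.
have f0 t : ~ (-1 < t < 1) -> f t = 0.
  move=> h; rewrite /f Bout ?BJout ?mulr0 ?addr0// => /andP[h1 h2]; apply: h; apply/andP; split; lra.
have f0' t : t <= -1 -> f t = 0.
  by move=> h; apply: f0 => /andP[h1 h2]; lra.
have [F dF F0] := antideriv cf f0'.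
have itvE (g : R -> R) (s : R) : (forall t : R, ~ (-1 < t < 1) -> g t = 0) -> s <= -1 ->
    \int[mu]_(t in `[s, 1]) g t = \int[mu]_t g t.
  move=> g0 s1; rewrite Rint_set; apply: eq_Rint => t.
  have [h|h] := pselect (-1 < t < 1); last by rewrite g0 ?mulr0.
  rewrite indic_in ?mul1r//= in_itv/=; case/andP: h => h1 h2; apply/andP; split; lra.
have F1 : F 1 = 0.
  have N11 : (-1 : R) <= 1 by lra.
  have := FTC2_cont N11 cf dF.
  rewrite (F0 _ (lexx _)) subr0 itvE// => <-.
  rewrite RintD// ?RintZ//; last exact: L1Z.
  by rewrite -/d -/e /c mulNr divfK// subrr.
have Fge1 t : 1 < t -> F t = 0.
  move=> t1; have [c' /andP[c1 _]] := mvt t1 dF.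
  rewrite f0 ?mul0r ?F1 ?subr0//.
  by move=> /andP[_]; apply/negP; rewrite -leNgt ltW.
have Fout t : 1 < `|t| -> F t = 0.
  by rewrite ltr_normr => /orP[|] h; [exact: Fge1|apply: F0; lra].
have sF : smooth1 F := smooth1_antideriv dF sf.
have FT s : 0 < s <= 1 -> F s = - Tb B s.
  move=> /andP[s0 s1]; have := FTC2_cont s1 cf dF; rewrite F1 sub0r => E.
  apply: oppr_inj; rewrite opprK -E /Tb Rint_set; apply: eq_Rint => t.
  have [h|h] := pselect (`[s, 1]%classic t); last by rewrite (indic_notin h) !mul0r.
  congr (_ * _); rewrite /f BJout ?mulr0 ?addr0//.
  by move: h; rewrite /= in_itv/= => /andP[h1 h2] /andP[h3 h4]; lra.
have := pairing_test sF Fout; rewrite (derive1_is_derive dF).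
have -> : \int[mu]_t (f t * gl t) = \int[mu]_t (B t * (\1_(`]0, 1]%classic : set R) t * gl t)).
  apply: eq_Rint => t; have [t0|t0] := ltP 0 t; last by rewrite gl0 ?mulr0.
  rewrite /f BJout ?mulr0 ?addr0; last by move=> /andP[_ h]; lra.
  have [h|h] := pselect (0 < t < 1); last by rewrite Bout ?mul0r.
  by rewrite indic_in ?mul1r//= in_itv/=; case/andP: h => -> /ltW.
have -> : \int[mu]_t (F t * Gl t) = - \int[mu]_s (\1_(`]0, 1]%classic : set R) s * (Gl s * Tb B s)).
  have mFG : measurable_fun setT (fun t => F t * Gl t).
    apply: measurable_funM; last exact: L1_meas iGl.
    by apply: cont_meas; exact: smooth1_cont.
  transitivity (\int[mu]_s - - (\1_(`]0, 1]%classic : set R) s * (F s * Gl s))).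
    apply: eq_Rint_ae => //.
      do 2 (apply: measurableT_comp => //).
      by apply: measurable_funM => //; apply: measurable_indic.
    have a0' : {ae mu, forall t : R, t <> 0}.
      exists [set 0]; split => //; first exact: lebesgue_measure_set1.
      by move=> t /= /contrapT ->.
    apply: ae_imp (ae_and Gl0 a0') => t [G0 t_neq0]; rewrite opprK.
    have [h|h] := pselect (0 < t <= 1).
      by rewrite indic_in ?mul1r.
    rewrite indic_notin ?mul0r//; have [t0|t0] := ltP 0 t.
      by rewrite Fge1 ?mul0r// ltNge; apply/negP => t1; apply: h; rewrite t0.
    have [t1|t1] := ltP (-1) t; last by rewrite F0 ?mul0r.
    by rewrite G0 ?mulr0// t1/= lt_neqAle t0 andbT; apply/eqP.
  rewrite RintN; last first.
    apply: L1N; apply: L1_indM => //.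
    have [K K0 HK] := cpt_bound (smooth1_cont sF) Fout.
    apply: (@L1Mb _ _ _ mu K) iGl => [|t]; first by apply: cont_meas; exact: smooth1_cont.
    by apply: le_trans (HK t) _; rewrite ler_piMr// (le_trans (ler_norm _))// norm_indic_le1.
  congr (- _); apply: eq_Rint => s.
  have [h|h] := pselect (`]0, 1]%classic s); last by rewrite (indic_notin h) !mul0r oppr0.
  by rewrite (indic_in h) !mul1r FT; [ring|move: h; rewrite /= in_itv].
rewrite opprK -(cum_fubini iGl iB) => E.
rewrite /r; transitivity (\int[mu]_t (B t * (\1_(`]0, 1]%classic : set R) t * gl t) -
   \1_(`]0, 1]%classic : set R) t * (cum Gl t * B t))).
  by apply: eq_Rint => t; rewrite -/B; ring.
have mB : measurable_fun setT (B : measurableTypeR R -> R).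
  by apply: cont_meas; apply: smooth1_cont; exact: smooth1_bump.
have B1 t : `|B t| <= 1 by rewrite ger0_norm ?bump_ge0// bump_le1.
rewrite RintB ?E ?subrr//.
  by apply: L1Mb mB B1 _; exact: L1_indM.
apply: eq_L1 (L1Mb mB B1 (L1_cum iGl)) => t; ring.
Qed.

End absolute_continuity.


(** * Gaussians *)

Section gaussians.
Context {R : realType}.
Notation mu := (@lebesgue_measure R).

Lemma L1_om (f : R -> R) C : continuous f -> (forall x, `|f x| <= C * omega x) -> L1 mu f.
Proof. by move=> cf fC; apply: (L1_cont cf fC); exact/L1Z/L1_omega. Qed.

Lemma Rint_shift_ge0 (f : R -> R) (a : R) : continuous f -> (forall x, 0 <= f x) ->
  \int[mu]_x f (x + a) = \int[mu]_x f x.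
Proof.
move=> cf f0; pose F (x : R) := x + a.
have dF (x : R) : is_derive x 1 F 1.
  by rewrite /F; deriv; ring.
have F1 : derive1 F = cst 1 by exact: (derive1_is_derive dF).
congr fine; rewrite (@increasing_ge0_integration_by_substitutionT R F f).
- by apply: eq_integral => x _; rewrite F1 /= !fctE mulr1.
- by move=> x y xy; rewrite /F ltrD2r.
- by rewrite F1; exact: cst_continuous.
- by rewrite F1; exact: is_cvg_cst.
- by rewrite F1; exact: is_cvg_cst.
- by move=> x; case: (dF x).
- exact: cvg_addrr_Ny.
- exact: cvg_addrr.
- exact: cf.
- exact: f0.
Qed.

(** The substitution for nonnegative integrands is applied to [|f|] and to [|f| - f]. *)
Lemma Rint_shift (f : R -> R) (a C : R) : continuous f -> (forall x, `|f x| <= C * omega x) ->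
  \int[mu]_x f (x + a) = \int[mu]_x f x.
Proof.
move=> cf fC.
have cN : continuous (fun x => `|f x|) by move=> x; apply: cvg_norm; exact: cf.
have iN : L1 mu (fun x => `|f x|) by apply: (L1_om cN) => x; rewrite normr_id; exact: fC.
have sh x : `|x| <= `|x + a| + `|a| by rewrite -[x in leLHS](addrK a) ler_normB.
have cS (h : R -> R) : continuous h -> continuous (fun x => h (x + a)).
  by move=> ch x; apply: (cvg_comp (fun x => x + a) h); [apply: cvgD; [exact: cvg_id|exact: cvg_cst]|exact: ch].
have o2 x : omega (x + a) <= 2 / omega a * omega x.
  rewrite mulrAC ler_pdivlMr ?omega_gt0//.
  by have := omegaM_le x (- a); rewrite opprK omegaN.
have C0 : 0 <= C.
  have := le_trans (normr_ge0 _) (fC 0); rewrite pmulr_lge0//; exact: omega_gt0.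
have bS x : `|f (x + a)| <= (C * (2 / omega a)) * omega x.
  by rewrite -mulrA (le_trans (fC _))// ler_wpM2l.
have iS : L1 mu (fun x => f (x + a)) by exact: (L1_om (cS _ cf) bS).
have iNS : L1 mu (fun x => `|f (x + a)|) by exact: L1_norm.
have i : L1 mu f := L1_om cf fC.
have cD : continuous (fun x => `|f x| - f x) by move=> x; apply: cvgB; [exact: cN|exact: cf].
have E1 := Rint_shift_ge0 a cN (fun x => normr_ge0 _).
have D0 x : 0 <= `|f x| - f x by rewrite subr_ge0 ler_norm.
have E2 := Rint_shift_ge0 a cD D0.
rewrite /= (RintB iNS iS) (RintB iN i) /= E1 in E2.
by move/addrI : E2 => /oppr_inj.
Qed.

(** A class stable under derivation by [dpgauss], whence [schwartz_pgauss]. *)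
Definition pgauss (P : {poly R}) (k y x : R) : R := P.[x] * expR (- k * (x - y) ^+ 2).

Lemma dpgauss P k y (x : R) :
  is_derive x 1 (pgauss P k y) (pgauss (P^`() - (2 * k) *: (P * ('X - y%:P))) k y x).
Proof.
have dP : is_derive x 1 (fun x => P.[x]) (P^`()).[x] by exact: is_derive_poly.
rewrite /pgauss; deriv_with ltac:(exact: dP); rewrite !hornerE/=.
by ring.
Qed.

Lemma cont_pgauss P k y : continuous (pgauss P k y).
Proof. exact: is_derive_continuous (dpgauss P k y). Qed.

(** Horner induction on [P] with [m] generalized: a factor ['X] is traded for one more power of
    [|x|]. *)
Lemma pgauss_bound P k y m n : 0 < k -> exists2 C, 0 <= C &
  forall x, `|x| ^+ m * `|pgauss P k y x| <= C * omega x ^+ n.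
Proof.
move=> k0; elim/poly_ind: P m => [m|P c IH m].
  by exists 0 => // x; rewrite /pgauss horner0 mul0r normr0 mulr0 mul0r.
have [C1 C10 H1] := IH m.+1; have [C2 C20 H2] := gauss_bound (2 * k * `|y|) m n k0.
have w0 x : 0 <= omega x ^+ n :> R by rewrite exprn_ge0// ltW// omega_gt0.
exists (C1 + `|c| * C2) => [|x]; first by rewrite addr_ge0// mulr_ge0.
rewrite /pgauss hornerD hornerMX hornerC [(_ + c) * _]mulrDl [leRHS]mulrDl (le_trans (ler_wpM2l _ (ler_normD _ _)))//.
rewrite mulrDr lerD//.
  apply: le_trans (H1 x); rewrite /pgauss; set E := expR _.
  by rewrite !normrM [`|x| ^+ m.+1]exprSr le_eqVlt; apply/orP; left; apply/eqP; ring.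
rewrite normrM mulrCA -mulrA ler_wpM2l// (le_trans _ (H2 x))//.
rewrite ler_wpM2l// ger0_norm ?expR_ge0// ler_expR.
have : x * y <= `|x| * `|y| by rewrite -normrM ler_norm.
by have := sqr_ge0 y; nra.
Qed.

Lemma pgauss_om P k y : 0 < k -> exists2 C, 0 <= C & forall x, `|pgauss P k y x| <= C * omega x.
Proof.
by move=> k0; have [C C0 H] := pgauss_bound P y 0 1 k0; exists C => // x; have := H x;
  rewrite expr0 mul1r expr1.
Qed.

Lemma schwartz_pgauss P k y : 0 < k -> schwartz (pgauss P k y).
Proof.
move=> k0.
have D n : exists Q, derive1n n (pgauss P k y) = pgauss Q k y.
  elim: n => [|n [Q E]]; first by exists P.
  rewrite derive1nS E (derive1_is_derive (dpgauss Q k y)).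
  by exists (Q^`() - (2 * k) *: (Q * ('X - y%:P))).
split=> [n x|m n]; have [Q ->] := D n; first by case: (dpgauss Q k y x).
by have [C C0 H] := pgauss_bound Q y m 0 k0; exists C => x; have := H x; rewrite expr0 mulr1.
Qed.

Lemma pgauss0E (c k y x : R) : pgauss c%:P k y x = c * expR (- k * (x - y) ^+ 2).
Proof. by rewrite /pgauss hornerC. Qed.

Section trig.
Variables (k : R) (k0 : 0 < k).

Definition gmass : R := \int[mu]_v expR (- k * v ^+ 2).

Let E0 v : pgauss 1 k 0 v = expR (- k * v ^+ 2).
Proof. by rewrite /pgauss hornerC mul1r subr0. Qed.

Lemma gmass_gt0 : 0 < gmass.
Proof.
have [C C0 H] := pgauss_om 1 0 k0.
have i : L1 mu (fun v => expR (- k * v ^+ 2)).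
  by apply: eq_L1 (L1_om (@cont_pgauss 1 k 0) H).
rewrite lt_neqAle Rint_ge0 ?andbT => [|x]; last exact: expR_ge0.
apply/negP => /eqP/esym E.
have := Rint_eq0 i (fun x => expR_ge0 _) E.
move=> [N [mN N0 sN]].
have : (mu (`]0%R, 1%R[%classic : set R) <= mu N)%E.
  apply: le_measure; rewrite ?inE//; apply: subset_trans sN => r /= _.
  by apply/eqP; rewrite gt_eqF// expR_gt0.
by rewrite N0 lebesgue_measure_itv/= lte_fin ltr01 oppr0 adde0 lee_fin ler10.
Qed.

(* Both integrals solve [y' = - xi / (2 k) y]. *)
Let ode (y : R -> R) : (forall x : R, is_derive x 1 y (- (x / (2 * k)) * y x)) ->
  forall x, 0 < x -> y x = y 0 * expR (- x ^+ 2 / (4 * k)).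
Proof.
move=> dy x x0.
have d (t : R) : is_derive t 1 (fun t => y t * expR ((4 * k)^-1 * t ^+ 2)) 0.
  deriv_with ltac:(exact: dy); field; rewrite gt_eqF//.
have [c _] := mvt x0 d; rewrite mul0r expr0n/= mulr0 expR0 mulr1.
move=> /eqP; rewrite subr_eq0 => /eqP <-.
rewrite -mulrA -expRD (_ : _ + _ = 0) ?expR0 ?mulr1//.
by rewrite mulNr mulrC subrr.
Qed.

Let cosk (xi v : R) : R := cos (xi * v) * expR (- k * v ^+ 2).
Let sink (xi v : R) : R := sin (xi * v) * expR (- k * v ^+ 2).

Let bnd n : exists2 C, 0 <= C & forall v : R, `|v| ^+ n * expR (- k * v ^+ 2) <= C * omega v.
Proof.
have [C C0 H] := pgauss_bound 1 0 n 1 k0; exists C => // v; have := H v.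
by rewrite expr1 E0 (ger0_norm (expR_ge0 _)).
Qed.

Lemma norm_cos_le1 (x : R) : `|cos x| <= 1.
Proof. by rewrite ler_norml cos_geN1 cos_le1. Qed.

Lemma norm_sin_le1 (x : R) : `|sin x| <= 1.
Proof. by rewrite ler_norml sin_geN1 sin_le1. Qed.

Let trig_bnd (T : R -> R) n C : (forall x, `|T x| <= 1) ->
  (forall v : R, `|v| ^+ n * expR (- k * v ^+ 2) <= C * omega v) ->
  forall xi v, `|T (xi * v) * (v ^+ n * expR (- k * v ^+ 2))| <= C * omega v.
Proof.
move=> T1 H xi v; rewrite normrM normrM normrX (ger0_norm (expR_ge0 _)).
by apply: le_trans (H v); rewrite ler_piMl// mulr_ge0// ?exprn_ge0// expR_ge0.
Qed.

Let ccos (xi : R) n : continuous (fun v : R => cos (xi * v) * (v ^+ n * expR (- k * v ^+ 2))).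
Proof. by apply: is_derive_continuous => v; repeat deriv1. Qed.

Let csin (xi : R) n : continuous (fun v : R => sin (xi * v) * (v ^+ n * expR (- k * v ^+ 2))).
Proof. by apply: is_derive_continuous => v; repeat deriv1. Qed.

Let iC xi n : L1 mu (fun v => cos (xi * v) * (v ^+ n * expR (- k * v ^+ 2))).
Proof.
have [C C0 H] := bnd n; apply: (L1_om (@ccos xi n)) => v.
exact: (trig_bnd norm_cos_le1 H).
Qed.

Let iS xi n : L1 mu (fun v => sin (xi * v) * (v ^+ n * expR (- k * v ^+ 2))).
Proof.
have [C C0 H] := bnd n; apply: (L1_om (@csin xi n)) => v.
exact: (trig_bnd norm_sin_le1 H).
Qed.

Let byp_cos xi : \int[mu]_v (sin (xi * v) * (v ^+ 1 * expR (- k * v ^+ 2))) =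
  xi / (2 * k) * \int[mu]_v (cos (xi * v) * (v ^+ 0 * expR (- k * v ^+ 2))).
Proof.
have [C C0 H] := bnd 0.
have d (v : R) : is_derive v 1 (fun v => sin (xi * v) * (v ^+ 0 * expR (- k * v ^+ 2)))
  (xi * (cos (xi * v) * (v ^+ 0 * expR (- k * v ^+ 2)))
    - 2 * k * (sin (xi * v) * (v ^+ 1 * expR (- k * v ^+ 2)))).
  by deriv; ring.
have i1 := L1Z xi (iC xi 0); have i2 := L1Z (2 * k) (iS xi 1).
have := Rint_derive0 d _ (L1B i1 i2) (trig_bnd norm_sin_le1 H xi).
rewrite RintB// (RintZ xi (iC xi 0)) (RintZ (2 * k) (iS xi 1)).
move=> E; have {}E := E _.
have k2 : 2 * k != 0 by rewrite gt_eqF// mulr_gt0.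
apply: (mulfI k2); rewrite mulrA mulrCA divff// mulr1.
apply/esym/eqP; rewrite -subr_eq0; apply/eqP; apply: E.
move=> v; apply: cvgB; apply: cvgM; try exact: cvg_cst.
  exact: ccos.
exact: csin.
Qed.

Let byp_sin xi : \int[mu]_v (cos (xi * v) * (v ^+ 1 * expR (- k * v ^+ 2))) =
  - (xi / (2 * k)) * \int[mu]_v (sin (xi * v) * (v ^+ 0 * expR (- k * v ^+ 2))).
Proof.
have [C C0 H] := bnd 0.
have d (v : R) : is_derive v 1 (fun v => cos (xi * v) * (v ^+ 0 * expR (- k * v ^+ 2)))
  (- xi * (sin (xi * v) * (v ^+ 0 * expR (- k * v ^+ 2)))
    - 2 * k * (cos (xi * v) * (v ^+ 1 * expR (- k * v ^+ 2)))).
  by deriv; ring.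
have i1 := L1Z (- xi) (iS xi 0); have i2 := L1Z (2 * k) (iC xi 1).
have := Rint_derive0 d _ (L1B i1 i2) (trig_bnd norm_cos_le1 H xi).
rewrite RintB// (RintZ (- xi) (iS xi 0)) (RintZ (2 * k) (iC xi 1)).
move=> E; have {}E := E _.
have k2 : 2 * k != 0 by rewrite gt_eqF// mulr_gt0.
apply: (mulfI k2).
have -> : 2 * k * (- (xi / (2 * k)) * \int[mu]_v (sin (xi * v) * (v ^+ 0 * expR (- k * v ^+ 2)))) =
   - xi * \int[mu]_v (sin (xi * v) * (v ^+ 0 * expR (- k * v ^+ 2))).
  by field; rewrite gt_eqF.
apply/esym/eqP; rewrite -subr_eq0; apply/eqP; apply: E.
move=> v; apply: cvgB; apply: cvgM; try exact: cvg_cst.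
  exact: csin.
exact: ccos.
Qed.

Let dcosk (xi : R) : is_derive xi 1 (fun xi => \int[mu]_v (cos (xi * v) * (v ^+ 0 * expR (- k * v ^+ 2))))
  (- (xi / (2 * k)) * \int[mu]_v (cos (xi * v) * (v ^+ 0 * expR (- k * v ^+ 2)))).
Proof.
have [C C0 H] := bnd 1.
rewrite mulNr -byp_cos -RintN; last exact: iS.
apply: (@Rint_derive R _ _ mu (fun xi v => cos (xi * v) * (v ^+ 0 * expR (- k * v ^+ 2)))
  (fun xi v => - (sin (xi * v) * (v ^+ 1 * expR (- k * v ^+ 2)))) xi 1 (fun v => C * omega v)) => //.
- by move=> x v _; deriv; ring.
- by move=> x v _; rewrite normrN; exact: (trig_bnd norm_sin_le1 H).
- exact/L1Z/L1_omega.
Qed.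

Let dsink (xi : R) : is_derive xi 1 (fun xi => \int[mu]_v (sin (xi * v) * (v ^+ 0 * expR (- k * v ^+ 2))))
  (- (xi / (2 * k)) * \int[mu]_v (sin (xi * v) * (v ^+ 0 * expR (- k * v ^+ 2)))).
Proof.
have [C C0 H] := bnd 1.
rewrite -byp_sin.
apply: (@Rint_derive R _ _ mu (fun xi v => sin (xi * v) * (v ^+ 0 * expR (- k * v ^+ 2)))
  (fun xi v => cos (xi * v) * (v ^+ 1 * expR (- k * v ^+ 2))) xi 1 (fun v => C * omega v)) => //.
- by move=> x v _; deriv; ring.
- by move=> x v _; exact: (trig_bnd norm_cos_le1 H).
- exact/L1Z/L1_omega.
Qed.

Lemma gauss_cos xi : \int[mu]_v cosk xi v = gmass * expR (- xi ^+ 2 / (4 * k)).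
Proof.
have EZ z : cosk z =1 (fun v => cos (z * v) * (v ^+ 0 * expR (- k * v ^+ 2))).
  by move=> v; rewrite expr0 mul1r.
have Z0 : \int[mu]_v (cos (0 * v) * (v ^+ 0 * expR (- k * v ^+ 2))) = gmass.
  by apply: eq_Rint => v; rewrite mul0r cos0 expr0 !mul1r.
have P x : 0 < x -> \int[mu]_v cosk x v = gmass * expR (- x ^+ 2 / (4 * k)).
  by move=> x0; rewrite (@eq_Rint _ _ _ mu _ _ (EZ x)) (ode dcosk x0) Z0.
have [x0|x0|<-] := ltgtP 0 xi; first exact: P.
  rewrite -sqrrN -P; last by rewrite oppr_gt0.
  by apply: eq_Rint => v; rewrite /cosk [- xi * v]mulNr cosN.
by rewrite (@eq_Rint _ _ _ mu _ _ (EZ 0)) Z0 expr0n/= oppr0 mul0r expR0 mulr1.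
Qed.

Lemma gauss_sin xi : \int[mu]_v sink xi v = 0.
Proof.
have EZ z : sink z =1 (fun v => sin (z * v) * (v ^+ 0 * expR (- k * v ^+ 2))).
  by move=> v; rewrite expr0 mul1r.
have Z0 : \int[mu]_v (sin (0 * v) * (v ^+ 0 * expR (- k * v ^+ 2))) = 0.
  by rewrite -[RHS](Rint0 mu); apply: eq_Rint => v; rewrite mul0r sin0 mul0r.
have P x : 0 < x -> \int[mu]_v sink x v = 0.
  by move=> x0; rewrite (@eq_Rint _ _ _ mu _ _ (EZ x)) (ode dsink x0) Z0 mul0r.
have [x0|x0|<-] := ltgtP 0 xi; first exact: P.
  apply: oppr_inj; rewrite oppr0 -(P (- xi)) ?oppr_gt0// -RintN.
    by apply: eq_Rint => v; rewrite /sink [- xi * v]mulNr sinN [- sin _ * _]mulNr.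
  by apply: eq_L1 (iS xi 0) => v; rewrite EZ.
by rewrite (@eq_Rint _ _ _ mu _ _ (EZ 0)) Z0.
Qed.

Lemma gauss_sin_shift xi x y :
  \int[mu]_z (sin (xi * (x - z)) * expR (- k * (z - y) ^+ 2)) =
  sin (xi * (x - y)) * (gmass * expR (- xi ^+ 2 / (4 * k))).
Proof.
have [C C0 H] := bnd 0.
pose h v := sin (xi * (x - y)) * cosk xi v - cos (xi * (x - y)) * sink xi v.
have hE v : h v = sin (xi * (x - y - v)) * expR (- k * v ^+ 2).
  by rewrite [xi * (x - y - v)]mulrBr sinB /h /cosk /sink; ring.
have i1 : L1 mu (cosk xi) by apply: eq_L1 (iC xi 0) => v; rewrite expr0 mul1r.
have i2 : L1 mu (sink xi) by apply: eq_L1 (iS xi 0) => v; rewrite expr0 mul1r.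
have ch : continuous h.
  by rewrite (funext hE); apply: is_derive_continuous => v; repeat deriv1.
have bh v : `|h v| <= C * omega v.
  rewrite hE normrM (ger0_norm (expR_ge0 _)); apply: le_trans (H v).
  by rewrite expr0 mul1r ler_piMl ?expR_ge0// norm_sin_le1.
rewrite (@eq_Rint _ _ _ mu _ (fun z => h (z + - y))); last first.
  by move=> z; rewrite hE; congr (sin (_ * _) * _); ring.
rewrite (Rint_shift _ ch bh) /h RintB; [|exact: L1Z|exact: L1Z].
by rewrite !RintZ// gauss_cos gauss_sin mulr0 subr0.
Qed.

Lemma gauss_cos_shift xi x y :
  \int[mu]_z (cos (xi * (x - z)) * expR (- k * (z - y) ^+ 2)) =
  cos (xi * (x - y)) * (gmass * expR (- xi ^+ 2 / (4 * k))).
Proof.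
have [C C0 H] := bnd 0.
pose h v := cos (xi * (x - y)) * cosk xi v + sin (xi * (x - y)) * sink xi v.
have hE v : h v = cos (xi * (x - y - v)) * expR (- k * v ^+ 2).
  by rewrite [xi * (x - y - v)]mulrBr cosB /h /cosk /sink; ring.
have i1 : L1 mu (cosk xi) by apply: eq_L1 (iC xi 0) => v; rewrite expr0 mul1r.
have i2 : L1 mu (sink xi) by apply: eq_L1 (iS xi 0) => v; rewrite expr0 mul1r.
have ch : continuous h.
  by rewrite (funext hE); apply: is_derive_continuous => v; repeat deriv1.
have bh v : `|h v| <= C * omega v.
  rewrite hE normrM (ger0_norm (expR_ge0 _)); apply: le_trans (H v).
  by rewrite expr0 mul1r ler_piMl ?expR_ge0// norm_cos_le1.
rewrite (@eq_Rint _ _ _ mu _ (fun z => h (z + - y))); last first.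
  by move=> z; rewrite hE; congr (cos (_ * _) * _); ring.
rewrite (Rint_shift _ ch bh) /h RintD; [|exact: L1Z|exact: L1Z].
by rewrite !RintZ// gauss_cos gauss_sin mulr0 addr0.
Qed.

End trig.

End gaussians.


(** * The operator [Lam] on Gaussians *)

Section lambda.
Context {R : realType}.
Notation mu := (@lebesgue_measure R).

Definition symbol (xi : R) : R := Num.sqrt (1 + xi ^+ 2).

Let s0 (xi : R) : 0 < 1 + xi ^+ 2. Proof. by rewrite ltr_wpDr// sqr_ge0. Qed.

Lemma symbol_sqr xi : symbol xi * symbol xi = 1 + xi ^+ 2.
Proof. by rewrite /symbol -expr2 sqr_sqrtr// ltW. Qed.

Lemma symbol_ge1 xi : 1 <= symbol xi.
Proof. by rewrite /symbol -[leLHS]sqrtr1 ler_wsqrtr// lerDl sqr_ge0. Qed.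

Let m0 xi : 0 < symbol xi. Proof. exact: lt_le_trans ltr01 (symbol_ge1 xi). Qed.

Section symbol_gaussians.
Variables (kap : R) (kap0 : 0 < kap).

(* This class of functions is stable under differentiation, see [dsgauss]. *)
Definition sgauss (P : {poly R}) (j : nat) (xi : R) : R :=
  P.[xi] * (symbol xi)^-1 ^+ j * expR (- kap * xi ^+ 2).

Let drm (xi : R) : is_derive xi 1 (fun x => (symbol x)^-1) (- xi * (symbol xi)^-1 ^+ 3).
Proof.
have d1 : is_derive xi 1 (fun x : R => 1 + x ^+ 2) (0 + 2 * xi ^+ 1 * 1) by repeat deriv1.
have d2 := @dsqrt R (fun x => 1 + x ^+ 2) xi _ (s0 xi) d1.
have n0 : symbol xi != 0 by rewrite gt_eqF.
notypeclasses refine (@is_derive_eq _ _ _ _ _ _ _ _ (@dinv _ symbol _ _ n0 d2) _).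
by rewrite -/(symbol xi); field.
Qed.

Lemma dsgauss P j (xi : R) : is_derive xi 1 (sgauss P j)
  (sgauss (P^`() * (1 + 'X^2) - j%:R *: ('X * P) - (2 * kap) *: ('X * (1 + 'X^2) * P)) j.+2 xi).
Proof.
have dP : is_derive xi 1 (fun x => P.[x]) (P^`()).[xi] by exact: is_derive_poly.
rewrite /sgauss; deriv_with ltac:(first [exact: dP | exact: drm]).
rewrite !(hornerD, hornerN, hornerM, hornerZ, hornerX, hornerXn, hornerC).
have E : (symbol xi)^-1 ^+ j = (1 + xi ^+ 2) * (symbol xi)^-1 ^+ j.+2.
  by rewrite -symbol_sqr 2!exprS !mulrA -[symbol xi * symbol xi * _]mulrA divff ?gt_eqF// mulr1 divff ?gt_eqF// mul1r.
have E1 : j%:R * (symbol xi)^-1 ^+ j.-1 * (- xi * (symbol xi)^-1 ^+ 3) =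
    - j%:R * xi * (symbol xi)^-1 ^+ j.+2.
  case: j {E} => [|j]; first by rewrite !(mul0r, mulr0, oppr0).
  by rewrite /= !exprS expr0; ring.
by rewrite E1 E; ring.
Qed.

Lemma cont_sgauss P j : continuous (sgauss P j).
Proof. exact: is_derive_continuous (dsgauss P j). Qed.

Lemma sgauss_om P j : exists2 C, 0 <= C & forall xi, `|sgauss P j xi| <= C * omega xi.
Proof.
have [C C0 H] := pgauss_om P 0 kap0; exists C => // xi; apply: le_trans (H xi).
rewrite /sgauss /pgauss subr0 !normrM ler_wpM2r// ler_piMr// ger0_norm.
  by rewrite exprn_ile1// ?invr_ge0 ?invf_le1 ?symbol_ge1// ltW.
by rewrite exprn_ge0// invr_ge0 ltW.
Qed.

Lemma L1_sgauss P j : L1 mu (sgauss P j).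
Proof. by have [C C0 H] := sgauss_om P j; exact: (L1_om (@cont_sgauss P j) H). Qed.

(* Two integrations by parts give the decay of the Fourier integral. *)
Lemma sgauss_sin_decay P j : exists2 C, 0 <= C &
  forall X, `|\int[mu]_xi (sgauss P j xi * sin (xi * X))| <= C * omega X.
Proof.
set P1 := (P^`() * (1 + 'X^2) - j%:R *: ('X * P) - (2 * kap) *: ('X * (1 + 'X^2) * P)).
set P2 := (P1^`() * (1 + 'X^2) - j.+2%:R *: ('X * P1) - (2 * kap) *: ('X * (1 + 'X^2) * P1)).
have cc Q i X : continuous (fun xi => sgauss Q i xi * cos (xi * X)).
  by apply: is_derive_continuous => xi; repeat first [exact: dsgauss | deriv1].
have cs Q i X : continuous (fun xi => sgauss Q i xi * sin (xi * X)).
  by apply: is_derive_continuous => xi; repeat first [exact: dsgauss | deriv1].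
have bt Q i : exists2 C, 0 <= C & forall X,
    (forall xi, `|sgauss Q i xi * cos (xi * X)| <= C * omega xi) /\
    (forall xi, `|sgauss Q i xi * sin (xi * X)| <= C * omega xi).
  have [C C0 H] := sgauss_om Q i; exists C => // X; split => xi; rewrite normrM;
    by apply: le_trans (H xi); rewrite ler_piMr// ?norm_cos_le1 ?norm_sin_le1.
have ic Q i X : L1 mu (fun xi => sgauss Q i xi * cos (xi * X)).
  by have [C _ /(_ X)[H _]] := bt Q i; exact: (L1_om (cc Q i X) H).
have js Q i X : L1 mu (fun xi => sgauss Q i xi * sin (xi * X)).
  by have [C _ /(_ X)[_ H]] := bt Q i; exact: (L1_om (cs Q i X) H).
have E1 X : X * \int[mu]_xi (sgauss P j xi * sin (xi * X)) = \int[mu]_xi (sgauss P1 j.+2 xi * cos (xi * X)).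
  have [C _ /(_ X)[H _]] := bt P j.
  have d (xi : R) : is_derive xi 1 (fun xi => sgauss P j xi * cos (xi * X))
      (sgauss P1 j.+2 xi * cos (xi * X) - X * (sgauss P j xi * sin (xi * X))).
    by deriv_with ltac:(exact: dsgauss); ring.
  have c : continuous (fun xi => sgauss P1 j.+2 xi * cos (xi * X) - X * (sgauss P j xi * sin (xi * X))).
    by move=> xi; apply: cvgB; [exact: cc|apply: cvgM; [exact: cvg_cst|exact: cs]].
  have := Rint_derive0 d c (L1B (ic _ _ X) (L1Z X (js _ _ X))) H.
  rewrite (RintB (ic _ _ X) (L1Z X (js _ _ X))) (RintZ X (js _ _ X)).
  by move=> /eqP; rewrite subr_eq0 => /eqP <-.
have E2 X : X * \int[mu]_xi (sgauss P1 j.+2 xi * cos (xi * X)) = - \int[mu]_xi (sgauss P2 j.+4 xi * sin (xi * X)).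
  have [C _ /(_ X)[_ H]] := bt P1 j.+2.
  have d (xi : R) : is_derive xi 1 (fun xi => sgauss P1 j.+2 xi * sin (xi * X))
      (sgauss P2 j.+4 xi * sin (xi * X) + X * (sgauss P1 j.+2 xi * cos (xi * X))).
    by deriv_with ltac:(exact: dsgauss); ring.
  have c : continuous (fun xi => sgauss P2 j.+4 xi * sin (xi * X) + X * (sgauss P1 j.+2 xi * cos (xi * X))).
    by move=> xi; apply: cvgD; [exact: cs|apply: cvgM; [exact: cvg_cst|exact: cc]].
  have := Rint_derive0 d c (L1D (js _ _ X) (L1Z X (ic _ _ X))) H.
  rewrite (RintD (js _ _ X) (L1Z X (ic _ _ X))) (RintZ X (ic _ _ X)).
  by move=> /eqP; rewrite addrC addr_eq0 => /eqP.
have bs Q i X : `|\int[mu]_xi (sgauss Q i xi * sin (xi * X))| <= \int[mu]_xi `|sgauss Q i xi|.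
  apply: le_norm_Rint; [exact: js|exact: L1_norm (L1_sgauss Q i)|].
  by move=> xi; rewrite normrM ler_piMr// norm_sin_le1.
exists (\int[mu]_xi `|sgauss P j xi| + \int[mu]_xi `|sgauss P2 j.+4 xi|).
  by rewrite addr_ge0// Rint_ge0.
move=> X; rewrite /omega -ler_pdivrMr ?invr_gt0// invrK mulrDr mulr1 lerD//.
rewrite -[X ^+ 2]ger0_norm ?sqr_ge0// -normrM mulrC expr2 -mulrA E1 E2 normrN.
exact: bs.
Qed.

End symbol_gaussians.

(** A Gaussian of mass one that concentrates at [y] as [k] grows. The equation is tested with its
    derivative [deta], so that [u] enters through [u_x] tested with [eta]. *)
Definition eta (k y : R) : R -> R := pgauss (gmass k)^-1%:P k y.
Definition deta (k y : R) : R -> R := derive1 (eta k y).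

Section eta.
Variables (k : R) (k0 : 0 < k).

Lemma etaE y z : eta k y z = (gmass k)^-1 * expR (- k * (z - y) ^+ 2).
Proof. by rewrite /eta pgauss0E. Qed.

Lemma dEta y (z : R) : is_derive z 1 (eta k y) (deta k y z).
Proof. by rewrite /deta (derive1_is_derive (dpgauss _ k y)); exact: dpgauss. Qed.

Lemma detaE y z : deta k y z = - (2 * k) * (z - y) * eta k y z.
Proof.
rewrite /deta (derive1_is_derive (dpgauss _ k y)) /eta /pgauss derivC sub0r.
by rewrite !(hornerN, hornerZ, hornerM, hornerXsubC, hornerC); ring.
Qed.

Lemma deta_pgauss y : deta k y = pgauss ((gmass k)^-1%:P^`() - (2 * k) *: ((gmass k)^-1%:P * ('X - y%:P))) k y.
Proof. exact: (derive1_is_derive (dpgauss _ k y)). Qed.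

Let kap := (4 * k)^-1.
Let kap0 : 0 < kap. Proof. by rewrite invr_gt0 mulr_gt0. Qed.

(** Since [sgauss] has only negative powers of [symbol], the product [symbol xi * xi] is written as
    [symbol xi ^+ 2 * xi / symbol xi]. *)
Definition lamP : {poly R} := (1 + 'X^2) * 'X.

Lemma lamPE xi : sgauss kap lamP 1 xi = symbol xi * xi * expR (- kap * xi ^+ 2).
Proof.
rewrite /sgauss /lamP !(hornerD, hornerM, hornerX, hornerXn, hornerC) -symbol_sqr.
have := m0 xi => /gt_eqF/negbT n0; by field.
Qed.

(** The derivative passes from [eta] to the cosine, and the Fourier transform of a Gaussian
    remains. *)
Lemma eta_sin xi x y :
  \int[mu]_z (cos (xi * (x - z)) * deta k y z) =
  - (xi * sin (xi * (x - y)) * expR (- kap * xi ^+ 2)).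
Proof.
have [C C0 H] := pgauss_om (gmass k)^-1%:P y k0.
have [C' C'0 H'] : exists2 C, 0 <= C & forall z, `|deta k y z| <= C * omega z.
  by rewrite deta_pgauss; exact: pgauss_om.
have cE : continuous (eta k y) := @cont_pgauss _ _ k y.
have cD : continuous (deta k y) by rewrite deta_pgauss; exact: cont_pgauss.
have ct (f : R -> R) (T : R -> R) : continuous T -> continuous f ->
    continuous (fun z => T (xi * (x - z)) * f z).
  move=> cT cf z; apply: cvgM; last exact: cf.
  apply: (cvg_comp (fun z => xi * (x - z)) T); last exact: cT.
  by apply: cvgM; [exact: cvg_cst|apply: cvgB; [exact: cvg_cst|exact: cvg_id]].
have bt (f : R -> R) (T : R -> R) c : (forall x, `|T x| <= 1) -> (forall z, `|f z| <= c * omega z) ->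
    forall z, `|T (xi * (x - z)) * f z| <= c * omega z.
  by move=> T1 fc z; rewrite normrM; apply: le_trans (fc z); rewrite ler_piMl.
have cc := ct _ _ (@continuous_cos R) cD; have cs := ct _ _ (@continuous_sin R) cE.
have ic := L1_om cc (bt _ _ _ norm_cos_le1 H').
have js := L1_om cs (bt _ _ _ norm_sin_le1 H).
have d (z : R) : is_derive z 1 (fun z => cos (xi * (x - z)) * eta k y z)
    (cos (xi * (x - z)) * deta k y z + xi * (sin (xi * (x - z)) * eta k y z)).
  by deriv_with ltac:(exact: dEta); ring.
have c : continuous (fun z => cos (xi * (x - z)) * deta k y z + xi * (sin (xi * (x - z)) * eta k y z)).
  by move=> z; apply: cvgD; [exact: cc|apply: cvgM; [exact: cvg_cst|exact: cs]].
have := Rint_derive0 d c (L1D ic (L1Z xi js)) (bt _ _ _ norm_cos_le1 H).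
rewrite (RintD ic (L1Z xi js)) (RintZ xi js) => /eqP; rewrite addr_eq0 => /eqP ->.
congr (- _); rewrite -mulrA; congr (_ * _).
transitivity ((gmass k)^-1 * \int[mu]_z (sin (xi * (x - z)) * expR (- k * (z - y) ^+ 2))).
  rewrite -RintZ.
    by apply: eq_Rint => z; rewrite etaE; ring.
  apply: eq_L1 (L1Z (gmass k) js) => z; rewrite etaE.
  by field; rewrite gt_eqF// gmass_gt0.
rewrite (gauss_sin_shift k0).
rewrite (_ : - xi ^+ 2 / (4 * k) = - kap * xi ^+ 2); last by rewrite /kap; field; rewrite gt_eqF.
by field; rewrite gt_eqF// gmass_gt0.
Qed.

Definition Lam_kernel (X : R) : R := \int[mu]_xi (sgauss kap lamP 1 xi * sin (xi * X)).

Lemma Lam_deta y x : Lam (deta k y) x = - (2 * pi)^-1 * Lam_kernel (x - y).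
Proof.
rewrite /Lam /Lam_kernel mulNr -mulrN; congr (_ * _); rewrite -RintN; last first.
  have [C C0 H] := sgauss_om kap0 lamP 1.
  apply: (@L1_om _ _ C) => [|xi].
    by apply: is_derive_continuous => xi; repeat first [exact: dsgauss | deriv1].
  by rewrite normrM; apply: le_trans (H xi); rewrite ler_piMr// norm_sin_le1.
by apply: eq_Rint => xi; rewrite eta_sin lamPE -/(symbol xi); ring.
Qed.

Lemma Lam_kernel_bound : exists2 C, 0 <= C & forall X, `|Lam_kernel X| <= C * omega X.
Proof. exact: sgauss_sin_decay. Qed.

Lemma Lam_kernel_cont : continuous Lam_kernel.
Proof.
have [C C0 H] := sgauss_om kap0 lamP 1.
apply: (@Rint_cont R _ _ mu (fun X xi => sgauss kap lamP 1 xi * sin (xi * X)) (fun xi => C * omega xi)).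
- move=> X; apply: cont_meas; apply: is_derive_continuous => xi.
  by repeat first [exact: dsgauss | deriv1].
- by move=> xi; apply: is_derive_continuous => X; repeat deriv1.
- by move=> X xi; rewrite normrM; apply: le_trans (H xi); rewrite ler_piMr// norm_sin_le1.
- exact/L1Z/L1_omega.
Qed.

(** [Lam (deta k y)] takes the place of [m] in the results on the weak time derivative; this is the
    decay that they require. *)
Lemma Lam_deta_bound y : exists2 C, 0 <= C & forall x, `|Lam (deta k y) x| <= C * omega x.
Proof.
have [C C0 H] := Lam_kernel_bound; exists ((2 * pi)^-1 * (C * (2 / omega y))) => [|x].
  rewrite mulr_ge0 ?invr_ge0 ?mulr_ge0 ?pi_ge0// ?invr_ge0 ltW ?omega_gt0//.
rewrite Lam_deta normrM normrN (ger0_norm (x := (2 * pi)^-1)); last first.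
  by rewrite invr_ge0 mulr_ge0// pi_ge0.
rewrite -mulrA ler_wpM2l ?invr_ge0 ?mulr_ge0 ?pi_ge0//.
rewrite -mulrA (le_trans (H _))// ler_wpM2l// mulrAC ler_pdivlMr ?omega_gt0//.
exact: omegaM_le.
Qed.

Lemma Lam_deta_cont y : continuous (Lam (deta k y)).
Proof.
rewrite (_ : Lam _ = (fun x => - (2 * pi)^-1 * Lam_kernel (x - y))); last first.
  by apply/funext => x; exact: Lam_deta.
move=> x; apply: cvgM; first exact: cvg_cst.
apply: (cvg_comp (fun x => x - y) Lam_kernel); last exact: Lam_kernel_cont.
by apply: cvgB; [exact: cvg_id|exact: cvg_cst].
Qed.

End eta.

(** The function [K] of the overview. The mollifier [eta k] adds [(4 * k)^-1] to its parameter, see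
    [source_Lam]. *)
Definition skernel (kap y : R) : R :=
  \int[mu]_xi (symbol xi * xi ^+ 2 * expR (- kap * xi ^+ 2) * cos (xi * y)).

(** A derivative of a Gaussian up to a factor. Its factor [xi] on the Fourier side joins the one of
    [deta], and the resulting [xi ^+ 2] makes the density in [skernel] nonnegative. *)
Definition source (n x : R) : R := x * expR (- n * x ^+ 2).

Lemma source_om n : 0 < n -> exists2 C, 0 <= C & forall x, `|source n x| <= C * omega x.
Proof.
move=> n0; have [C C0 H] := pgauss_om 'X 0 n0; exists C => // x.
by have := H x; rewrite /pgauss hornerX subr0.
Qed.

Lemma source_cont n : continuous (source n).
Proof. by apply: is_derive_continuous => x; repeat deriv1. Qed.

Lemma source_sin n xi y : 0 < n ->
  \int[mu]_x (source n x * sin (xi * (x - y))) =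
  xi / (2 * n) * (cos (xi * y) * (gmass n * expR (- xi ^+ 2 / (4 * n)))).
Proof.
move=> n0.
pose E (x : R) := expR (- n * x ^+ 2).
have [C0 _ H0] := pgauss_om 1 0 n0; have [C1 _ H1] := source_om n0.
have HE x : `|E x| <= C0 * omega x.
  by have := H0 x; rewrite /pgauss hornerC mul1r subr0.
have bt (f : R -> R) (T : R -> R) c : (forall x, `|T x| <= 1) -> (forall z, `|f z| <= c * omega z) ->
    forall z, `|f z * T (xi * (z - y))| <= c * omega z.
  by move=> T1 fc z; rewrite normrM; apply: le_trans (fc z); rewrite ler_piMr.
have i1 : L1 mu (fun x => source n x * sin (xi * (x - y))).
  apply: L1_om (bt _ _ _ norm_sin_le1 H1).
  by apply: is_derive_continuous => x; rewrite /source; repeat deriv1.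
have i2 : L1 mu (fun x => E x * cos (xi * (x - y))).
  apply: L1_om (bt _ _ _ norm_cos_le1 HE).
  by apply: is_derive_continuous => x; rewrite /E; repeat deriv1.
have d (x : R) : is_derive x 1 (fun x => E x * sin (xi * (x - y)))
    (xi * (E x * cos (xi * (x - y))) - 2 * n * (source n x * sin (xi * (x - y)))).
  by rewrite /E /source; deriv; ring.
have c : continuous (fun x => xi * (E x * cos (xi * (x - y))) - 2 * n * (source n x * sin (xi * (x - y)))).
  by apply: is_derive_continuous => x; rewrite /E /source; repeat deriv1.
have := Rint_derive0 d c (L1B (L1Z xi i2) (L1Z (2 * n) i1)) (bt _ _ _ norm_sin_le1 HE).
rewrite (RintB (L1Z xi i2) (L1Z (2 * n) i1)) (RintZ xi i2) (RintZ (2 * n) i1).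
move=> /eqP; rewrite subr_eq0 => /eqP Ei.
have n2 : 2 * n != 0 by rewrite gt_eqF// mulr_gt0.
apply: (mulfI n2); rewrite -Ei (_ : \int[mu]_x (E x * cos (xi * (x - y))) =
  cos (xi * y) * (gmass n * expR (- xi ^+ 2 / (4 * n)))); first by field; rewrite gt_eqF.
have := gauss_cos_shift n0 xi y 0; rewrite subr0 => <-.
apply: eq_Rint => x; rewrite /E subr0 mulrC; congr (_ * _).
by rewrite -cosN; congr cos; ring.
Qed.

(** After Fubini the Fourier transforms of two Gaussians are multiplied, so the parameters
    [(4 * k)^-1] and [(4 * n)^-1] add up. *)
Lemma source_Lam k n y : 0 < k -> 0 < n ->
  \int[mu]_x (source n x * Lam (deta k y) x) =
  - ((2 * pi)^-1 * (gmass n / (2 * n))) * skernel ((4 * k)^-1 + (4 * n)^-1) y.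
Proof.
move=> k0 n0; set kap := (4 * k)^-1.
have kap0 : 0 < kap by rewrite invr_gt0 mulr_gt0.
pose F (z : plane R) := source n z.1 * (sgauss kap lamP 1 z.2 * sin (z.2 * (z.1 - y))).
have [C1 _ H1] := source_om n0.
have iff_ : L1 mu (source n) := L1_om (@source_cont n) H1.
have isq : L1 mu (sgauss kap lamP 1) by exact: L1_sgauss.
have iF : L1 (leb2 R) F.
  apply: (@L1_prod _ _ _ _ _ mu mu _ (fun x => `|source n x|) (fun x => `|sgauss kap lamP 1 x|)).
  - apply: measurable_funM; first by apply: meas_fst; exact: L1_meas iff_.
    apply: measurable_funM; first by apply: meas_snd; exact: L1_meas isq.
    have mi : measurable_fun setT ((fun x => x) : measurableTypeR R -> R).
      by apply: cont_meas => x; exact: cvg_id.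
    have ms : measurable_fun setT (sin : R -> R) by apply: cont_meas; exact: continuous_sin.
    apply: (measurableT_comp ms); apply: measurable_funM; first exact: (meas_snd mi).
    by apply: measurable_funB => //; exact: (meas_fst mi).
  - exact: L1_norm.
  - exact: L1_norm.
  - by move=> x xi; rewrite /F /= !normrM ler_wpM2l// ler_piMr// norm_sin_le1.
have isin x : L1 mu (fun xi => sgauss kap lamP 1 xi * sin (xi * (x - y))).
  have [C C0 H] := sgauss_om kap0 lamP 1.
  apply: (@L1_om _ _ C) => [|xi].
    by apply: is_derive_continuous => xi; repeat first [exact: dsgauss | deriv1].
  by rewrite normrM; apply: le_trans (H xi); rewrite ler_piMr// norm_sin_le1.
transitivity (\int[mu]_x (- (2 * pi)^-1 * \int[mu]_xi F (x, xi))).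
  apply: eq_Rint => x; rewrite (Lam_deta k0) mulrCA; congr (_ * _).
  by rewrite /F/= RintZ.
rewrite RintZ; last exact: (L1_fubini1 iF).
rewrite (Rint_fubini1 iF) -(Rint_fubini2 iF) -mulNr -mulrA; congr (_ * _).
have iK : L1 mu (fun xi => symbol xi * xi ^+ 2 * expR (- (kap + (4 * n)^-1) * xi ^+ 2) * cos (xi * y)).
  have kn0 : 0 < kap + (4 * n)^-1 by rewrite addr_gt0// invr_gt0 mulr_gt0.
  pose P : {poly R} := (1 + 'X^2) * 'X^2.
  have E xi : sgauss (kap + (4 * n)^-1) P 1 xi * cos (xi * y) =
      symbol xi * xi ^+ 2 * expR (- (kap + (4 * n)^-1) * xi ^+ 2) * cos (xi * y).
    rewrite /sgauss /P !(hornerD, hornerM, hornerX, hornerXn, hornerC) -symbol_sqr.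
    have := m0 xi => /gt_eqF/negbT nz; by field.
  have [C C0 H] := sgauss_om kn0 P 1.
  apply: (@eq_L1 _ _ _ mu _ _ E); apply: (@L1_om _ _ C) => [|xi].
    by apply: is_derive_continuous => xi; repeat first [exact: dsgauss | deriv1].
  by rewrite normrM; apply: le_trans (H xi); rewrite ler_piMr// norm_cos_le1.
rewrite /skernel -RintZ//; apply: eq_Rint => xi; rewrite /F/=.
transitivity (sgauss kap lamP 1 xi * \int[mu]_x (source n x * sin (xi * (x - y)))).
  rewrite -RintZ; first by apply: eq_Rint => x; ring.
  apply: (@L1_om _ _ C1) => [|x].
    by apply: is_derive_continuous => x; rewrite /source; repeat deriv1.
  by rewrite normrM; apply: le_trans (H1 x); rewrite ler_piMr// norm_sin_le1.
rewrite (source_sin _ _ n0) (lamPE k) (_ : - (kap + (4 * n)^-1) * xi ^+ 2 =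
  - kap * xi ^+ 2 + - xi ^+ 2 / (4 * n)); last by field; rewrite !gt_eqF.
by rewrite expRD; ring.
Qed.

End lambda.


(** * Bounds for the Fourier integral [skernel] *)

Section kernel.
Context {R : realType}.
Notation mu := (@lebesgue_measure R).

Lemma cos_ge_quad (z : R) : 1 - z ^+ 2 / 2 <= cos z.
Proof.
suff H (x : R) : 0 < x -> 1 - x ^+ 2 / 2 <= cos x.
  have [->|] := eqVneq z 0; first by rewrite cos0 expr0n/= mul0r subr0.
  by rewrite neq_lt => /orP[z0|/H//]; rewrite -cosN -sqrrN H// oppr_gt0.
move=> x0.
have d (t : R) : is_derive t 1 (fun t => cos t + t ^+ 2 / 2) (t - sin t).
  by deriv; field.
have e (t : R) : is_derive t 1 (fun t => t - sin t) (1 - cos t) by deriv; ring.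
have [c /andP[c0 _]] := mvt x0 d; have [b _] := mvt c0 e.
rewrite sin0 cos0 expr0n/= mul0r addr0 !subr0 => -> E.
by rewrite lerBlDr -subr_ge0 E !mulr_ge0 ?subr_ge0 ?cos_le1// ltW.
Qed.

Definition smoment (kap : R) (j : nat) (xi : R) : R :=
  symbol xi * xi ^+ j * expR (- kap * xi ^+ 2).

Lemma smoment_ge0 kap i xi : 0 <= smoment kap (2 * i) xi.
Proof. by rewrite /smoment !mulr_ge0 ?expR_ge0 ?sqrtr_ge0// exprM exprn_ge0// sqr_ge0. Qed.

Let n0 (xi : R) : symbol xi != 0.
Proof. by rewrite gt_eqF// (lt_le_trans ltr01 (symbol_ge1 xi)). Qed.

Lemma smomentE kap j xi : smoment kap j xi = sgauss kap ((1 + 'X^2) * 'X^j) 1 xi.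
Proof.
rewrite /sgauss /smoment !(hornerD, hornerM, hornerX, hornerXn, hornerC) -symbol_sqr expr1.
by rewrite [_ * (symbol xi)^-1]mulrAC mulfK ?n0.
Qed.

Lemma cont_smoment kap j : continuous (smoment kap j).
Proof.
have -> : smoment kap j = sgauss kap ((1 + 'X^2) * 'X^j) 1 by apply/funext => xi; exact: smomentE.
exact: cont_sgauss.
Qed.

Let w0 (xi : R) : 0 <= symbol xi * xi ^+ 2.
Proof. by rewrite mulr_ge0 ?sqr_ge0// (le_trans ler01 (symbol_ge1 xi)). Qed.

Section fixed.
Variables (kap : R) (kap0 : 0 < kap).

Lemma L1_smoment j : L1 mu (smoment kap j).
Proof. by apply: eq_L1 (L1_sgauss kap0 ((1 + 'X^2) * 'X^j) 1) => xi; rewrite smomentE. Qed.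

Lemma L1_smoment_cos j y : L1 mu (fun xi => smoment kap j xi * cos (xi * y)).
Proof.
apply: (@L1_dom _ _ _ mu (fun xi => `|smoment kap j xi|)); last exact: L1_norm (L1_smoment j).
  apply: cont_meas => xi; apply: cvgM; first exact: cont_smoment.
  apply: (cvg_comp (fun xi => xi * y) cos); last exact: continuous_cos.
  by apply: cvgM; [exact: cvg_id|exact: cvg_cst].
by move=> xi; rewrite normrM ler_piMr// norm_cos_le1.
Qed.

Lemma moment2_gt0 : 0 < \int[mu]_xi smoment kap 2 xi.
Proof.
rewrite lt_neqAle Rint_ge0 ?andbT => [|x]; last exact: (smoment_ge0 kap 1).
apply/negP => /eqP/esym E.
have [N [mN N0 sN]] := Rint_eq0 (L1_smoment 2) (smoment_ge0 kap 1) E.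
have : (mu (`]0%R, 1%R[%classic : set R) <= mu N)%E.
  apply: le_measure; rewrite ?inE//; apply: subset_trans sN => r /=.
  rewrite in_itv/= => /andP[r0 _]; apply/eqP; rewrite /smoment gt_eqF//.
  by rewrite mulr_gt0 ?expR_gt0// mulr_gt0 ?exprn_gt0// (lt_le_trans ltr01 (symbol_ge1 r)).
by rewrite N0 lebesgue_measure_itv/= lte_fin ltr01 oppr0 adde0 lee_fin ler10.
Qed.

(* The integral of [(xi ^ 3 symbol(xi) exp(-kap xi ^ 2))'] vanishes. *)
Lemma moment4_le : 1 <= kap -> kap * \int[mu]_xi smoment kap 4 xi <= 3 * \int[mu]_xi smoment kap 2 xi.
Proof.
move=> kap1; pose r := sgauss kap ('X^4) 1.
have ir : L1 mu r by exact: L1_sgauss.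
have d (xi : R) : is_derive xi 1 (smoment kap 3) (3 * smoment kap 2 xi - 2 * kap * smoment kap 4 xi + r xi).
  have d1 : is_derive xi 1 (fun x : R => 1 + x ^+ 2) (0 + 2 * xi ^+ 1 * 1) by repeat deriv1.
  have s0 : 0 < 1 + xi ^+ 2 by rewrite ltr_wpDr// sqr_ge0.
  have d2 : is_derive xi 1 (@symbol R) _ := @dsqrt R (fun x => 1 + x ^+ 2) xi _ s0 d1.
  rewrite /smoment; deriv_with ltac:(exact: d2).
  rewrite /r /sgauss hornerXn expr1 -/(symbol xi).
  by field; exact: n0.
have c : continuous (fun xi => 3 * smoment kap 2 xi - 2 * kap * smoment kap 4 xi + r xi).
  move=> xi; apply: cvgD; last exact: cont_sgauss.
  by apply: cvgB; (apply: cvgM; [exact: cvg_cst|exact: cont_smoment]).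
have [C _ H] := sgauss_om kap0 ((1 + 'X^2) * 'X^3) 1.
have H' xi : `|smoment kap 3 xi| <= C * omega xi by rewrite smomentE.
have i3 : L1 mu (fun xi => 3 * smoment kap 2 xi) by exact/L1Z/L1_smoment.
have i4 : L1 mu (fun xi => 2 * kap * smoment kap 4 xi) by exact/L1Z/L1_smoment.
have := Rint_derive0 d c (L1D (L1B i3 i4) ir) H'.
rewrite (RintD (L1B i3 i4) ir) (RintB i3 i4).
rewrite (RintZ 3 (L1_smoment 2)) (RintZ (2 * kap) (L1_smoment 4)) => E0.
have : \int[mu]_xi r xi <= \int[mu]_xi smoment kap 4 xi.
  apply: le_Rint => //; first exact: L1_smoment.
  move=> xi; rewrite /r /sgauss /smoment hornerXn expr1 ler_wpM2r ?expR_ge0// mulrC ler_wpM2r//.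
    by rewrite (exprM xi 2 2) sqr_ge0.
  by rewrite (le_trans _ (symbol_ge1 xi))// invf_le1 ?symbol_ge1// (lt_le_trans ltr01 (symbol_ge1 xi)).
have B0 : 0 <= \int[mu]_xi smoment kap 4 xi by apply: Rint_ge0 => xi; exact: (smoment_ge0 kap 2).
(* Here [2 kap B = 3 A + r1 <= 3 A + B], and [B <= kap B]. *)
by move: E0 B0; set A := \int[mu]_xi _; set B := \int[mu]_xi _; set r1 := \int[mu]_xi _; nra.
Qed.

Lemma skernel_ge y : \int[mu]_xi smoment kap 2 xi - y ^+ 2 / 2 * \int[mu]_xi smoment kap 4 xi <= skernel kap y.
Proof.
rewrite -(RintZ _ (L1_smoment 4)) -RintB; [|exact: L1_smoment|exact/L1Z/L1_smoment].
apply: le_Rint; first by apply: L1B; [exact: L1_smoment|exact/L1Z/L1_smoment].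
  exact: L1_smoment_cos.
move=> xi; rewrite -/(smoment kap 2 xi).
rewrite (_ : smoment kap 2 xi - _ = smoment kap 2 xi * (1 - (xi * y) ^+ 2 / 2)); last by rewrite /smoment; field.
by rewrite ler_wpM2l ?cos_ge_quad//; exact: (smoment_ge0 kap 1).
Qed.

(** Uniform in [kap' >= kap] and in [y]: the majorant for the limits in the mollification and in the
    cut-off. *)
Lemma skernel_dom kap' y : kap <= kap' -> `|skernel kap' y| <= \int[mu]_xi smoment kap 2 xi.
Proof.
move=> kk; have H xi : `|smoment kap' 2 xi * cos (xi * y)| <= smoment kap 2 xi.
  rewrite normrM (ger0_norm (smoment_ge0 kap' 1 xi)).
  apply: (@le_trans _ _ (smoment kap' 2 xi)); first by rewrite ler_piMr ?norm_cos_le1//; exact: (smoment_ge0 kap' 1).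
  rewrite /smoment ler_wpM2l ?w0// ler_expR !mulNr lerN2.
  by rewrite ler_wpM2r// sqr_ge0.
apply: (@le_norm_Rint _ _ _ mu (fun xi => smoment kap' 2 xi * cos (xi * y)) (smoment kap 2)) => //; last exact: L1_smoment.
apply: (@L1_dom _ _ _ mu (smoment kap 2)) H (L1_smoment 2).
apply: cont_meas => xi; apply: cvgM; first exact: cont_smoment.
apply: (cvg_comp (fun xi => xi * y) cos); last exact: continuous_cos.
by apply: cvgM; [exact: cvg_id|exact: cvg_cst].
Qed.

Lemma skernel_cvg (r : nat -> R) y : (forall n, 0 <= r n) -> r n @[n --> \oo] --> (0 : R) ->
  skernel (r n + kap) y @[n --> \oo] --> skernel kap y.
Proof.
move=> r0 rc.
apply: (@Rint_dct _ _ _ mu (fun n xi => smoment (r n + kap) 2 xi * cos (xi * y)) _ (smoment kap 2)).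
- move=> n; apply: cont_meas => xi; apply: cvgM; first exact: cont_smoment.
  apply: (cvg_comp (fun xi => xi * y) cos); last exact: continuous_cos.
  by apply: cvgM; [exact: cvg_id|exact: cvg_cst].
- move=> xi; apply: cvgM; last exact: cvg_cst.
  rewrite /smoment; apply: cvgM; first exact: cvg_cst.
  apply: (cvg_comp (fun n => - (r n + kap) * xi ^+ 2) expR); last exact: continuous_expR.
  apply: cvgM; last exact: cvg_cst.
  apply: cvgN; rewrite -[X in _ --> X]add0r; apply: cvgD => //; exact: cvg_cst.
- exact: L1_smoment.
- move=> n xi; rewrite normrM (ger0_norm (smoment_ge0 _ 1 xi)).
  apply: (@le_trans _ _ (smoment (r n + kap) 2 xi)).
    by rewrite ler_piMr ?norm_cos_le1//; exact: (smoment_ge0 _ 1).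
  rewrite /smoment ler_wpM2l ?w0// ler_expR !mulNr lerN2.
  by rewrite ler_wpM2r ?sqr_ge0// lerDr.
Qed.

Lemma skernel_cont : continuous (skernel kap).
Proof.
apply: (@Rint_cont R _ _ mu (fun y xi => smoment kap 2 xi * cos (xi * y)) (smoment kap 2)).
- by move=> y; exact: L1_meas (L1_smoment_cos 2 y).
- by move=> xi; apply: is_derive_continuous => y; repeat deriv1.
- move=> y xi; rewrite normrM (ger0_norm (smoment_ge0 _ 1 xi)).
  by rewrite ler_piMr ?norm_cos_le1//; exact: (smoment_ge0 _ 1).
- exact: L1_smoment.
Qed.

End fixed.
End kernel.

(** * The strong time derivative *)

Section strong_derivative.
Context {R : realType}.
Notation mu := (@lebesgue_measure R).

Lemma ae_meet (P : R -> Prop) (a b : R) : a < b -> {ae mu, forall t, P t} ->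
  exists2 t, a < t < b & P t.
Proof.
move=> ab [N [mN N0 sN]]; apply: contrapT => nP.
have : (mu (`]a, b[%classic : set R) <= mu N)%E.
  apply: le_measure; rewrite ?inE//; apply: subset_trans sN => t /=.
  by rewrite in_itv/= => tab Pt; apply: nP; exists t.
by rewrite N0 lebesgue_measure_itv/= lte_fin ab -EFinD lee_fin subr_le0 leNgt ab.
Qed.

Lemma cum_derivable (r : R -> R) : L1 mu r ->
  {ae mu, forall t, 0 < t < 1 ->
    h^-1 * (cum r (t + h) - cum r t) @[h --> 0^'] --> r t}.
Proof.
move=> ir; pose f (s : R) : R := \1_(`]0, 1]%classic : set R) s * r s.
have i_f : L1 mu f by apply: L1_indM => //; exact: measurable_itv.
pose F x : R := (\int[mu]_(t in [set` `]-oo, x]]) f t)%R.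
have FE x : x <= 1 -> F x = cum r x.
  move=> x1; rewrite /F Rint_set; apply: eq_Rint => s; rewrite /f.
  have [h|h] := pselect ((`]0, x]%classic : set R) s).
    move: (h); rewrite /= in_itv/= => /andP[s0 sx].
    rewrite (indic_in h) !indic_in ?mul1r//= in_itv/= ?s0//.
    exact: le_trans sx x1.
  rewrite (indic_notin h) mul0r.
  have [s0|s0] := ltP 0 s; last first.
    by rewrite (@indic_notin _ _ `]0, 1]%classic) ?mul0r ?mulr0//= in_itv/= ltNge s0.
  rewrite indic_notin ?mul0r//= in_itv/= => sx; apply: h.
  by rewrite /= in_itv/= s0.
have intf y : mu.-integrable `]-oo, y] (EFin \o f).
  by apply: integrableS i_f => //; exact: measurable_itv.
have locf : locally_integrable [set: R] f.
  exact: (open_integrable_locally openT i_f).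
apply: ae_imp (FTC1Ny intf locf) => t [dF F't] /andP[t0 t1].
have ft : f t = r t by rewrite /f indic_in ?mul1r//= in_itv/= t0 ltW.
rewrite -ft -F't derive1E.
have dF' : h^-1 *: ((F \o shift t) (h *: 1) - F t) @[h --> 0^'] --> 'D_1 F t := dF.
apply: cvg_trans dF'; apply: near_eq_cvg; near=> h.
rewrite /= /shift /= [h%:A]mulr1 [h + t]addrC !FE//; first exact: ltW.
have : `|h| < 1 - t by near: h; apply: dnbhs0_lt; rewrite subr_gt0.
by have := ler_norm h; lra.
Unshelve. all: by end_near. Qed.

(** [U] and [c] agree only almost everywhere, but points of agreement exist arbitrarily close to
    [t], and along them the two difference quotients coincide. *)
Lemma ae_derive_unique (U c : R -> R) (t L r : R) :
  {ae mu, forall s, 0 < s < 1 -> U s = c s} -> 0 < t < 1 -> U t = c t ->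
  h^-1 * (U (t + h) - U t) @[h --> 0^'] --> L ->
  h^-1 * (c (t + h) - c t) @[h --> 0^'] --> r -> L = r.
Proof.
move=> Uc /andP[t0 t1] Ut cU cc; apply/eqP/negPn/negP => Lr.
pose e := `|L - r| / 2; have e0 : 0 < e by rewrite divr_gt0// normr_gt0 subr_eq0.
move: cU cc => /cvgrPdist_lt/(_ _ e0) cU /cvgrPdist_lt/(_ _ e0) cc.
have : \forall h \near (0 : R)^', [/\ `|L - h^-1 * (U (t + h) - U t)| < e,
    `|r - h^-1 * (c (t + h) - c t)| < e & `|h| < 1 - t].
  near=> h; split.
  - by near: h.
  - by near: h.
  - by near: h; apply: dnbhs0_lt; rewrite subr_gt0.
move=> /nbhs_ballP[d /= d0 H].
have td : t < t + d by rewrite ltrDl.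
have [s /andP[ts sd] Us] := ae_meet td Uc.
have := H (s - t); rewrite /ball /= sub0r normrN gtr0_norm ?subr_gt0//.
move=> /(_ _ _)[||]; first by rewrite ltrBlDl.
  by rewrite subr_eq0 gt_eqF.
rewrite (_ : t + (s - t) = s); last by ring.
move=> H1 H2 H3; rewrite Us ?Ut in H1; last by apply/andP; split; lra.
have := ler_distD ((s - t)^-1 * (c s - c t)) L r.
rewrite leNgt => /negP; apply; rewrite [ltRHS](_ : _ = e + e); last by rewrite /e; field.
by rewrite ltrD// distrC.
Unshelve. all: by end_near. Qed.

Variables (p : R) (p1 : 1 < p).

Let p0 : 0 < p. Proof. exact: lt_trans ltr01 p1. Qed.

Lemma Lnorm_om_fin (m : R -> R) (C q : R) : 1 <= q -> 0 <= C ->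
  measurable_fun setT (m : measurableTypeR R -> R) -> (forall x, `|m x| <= C * omega x) ->
  ('N[mu]_q%:E [EFin \o (m : measurableTypeR R -> R)] < +oo)%E.
Proof.
move=> q1 C0 mm mC.
have i : L1 mu (fun x => `|m x| `^ q).
  apply: (@L1_dom _ _ _ mu (fun x => C `^ q * omega x)); last exact/L1Z/L1_omega.
    apply: (measurableT_comp (measurable_powR q)).
    exact: measurableT_comp.
  move=> x; rewrite ger0_norm ?powR_ge0//.
  have w0 := omega_gt0 x.
  apply: (@le_trans _ _ ((C * omega x) `^ q)).
    apply: ge0_ler_powR; rewrite ?nnegrE ?mulr_ge0//; [exact: le_trans q1|exact: ltW].
  rewrite powRM ?(ltW w0)// ler_wpM2l ?powR_ge0// ge1r_powR// w0/=.
  exact: omega_le1.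
rewrite unlock /Lnorm.
rewrite (_ : (\int[mu]_x _)%E = (\int[mu]_x ((`|m x| `^ q)%R)%:E)%E).
  by rewrite Rint_EFin// poweR_EFin ltry.
by apply: eq_integral => x _; rewrite -poweR_EFin.
Qed.

(** If [T] is [Lamdist (reg h)], then [T phi] is the integral of [h * Lam phi], and Hoelder's
    inequality applies. The constant is the [L_q]-norm of [Lam phi], plus [1] to keep it
    positive. *)
Lemma Hm1norm_pairing (phi : R -> R) (C : R) : schwartz phi -> 0 <= C ->
  measurable_fun setT (Lam phi : measurableTypeR R -> R) ->
  (forall x, `|Lam phi x| <= C * omega x) ->
  exists2 K : R, 0 < K & forall T : dist, ((`|T phi| / K)%:E <= Hm1norm p T)%E.
Proof.
move=> sphi C0 mm mC; pose q := p / (p - 1).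
have pm : 0 < p - 1 by rewrite subr_gt0.
have q1 : 1 <= q by rewrite ler_pdivlMr// mul1r gerBl.
have q0 : 0 < q by exact: lt_le_trans q1.
have pq : p^-1 + q^-1 = 1 by rewrite /q; field; rewrite !gt_eqF.
have Nfin := Lnorm_om_fin q1 C0 mm mC.
set N := 'N[mu]_q%:E [_]%E in Nfin.
have N0 : (0 <= N)%E by exact: Lnorm_ge0.
have NE : N = (fine N)%:E by rewrite fineK// ge0_fin_numE.
exists (fine N + 1) => [|T]; first by rewrite ltr_wpDl// fine_ge0.
have K0 : 0 < fine N + 1 by rewrite ltr_wpDl// fine_ge0.
apply/ereal_infP => _ [h [hp Th] <-].
have mh : measurable_fun setT (h : measurableTypeR R -> R).
  by have /sub_Lfun_mfun/set_mem := hp.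
have ih : L1 mu (fun x => `|h x| `^ p) by exact: (Lfun_integrable (ltW p1) hp).
have ihm : L1 mu (fun x => h x * Lam phi x).
  apply: (@L1_dom _ _ _ mu (fun x => C * (`|h x| `^ p + omega x))).
  - exact: measurable_funM.
  - move=> x; rewrite normrM mulrC (le_trans (ler_wpM2r _ (mC x)))// -mulrA ler_wpM2l//.
    rewrite mulrC mul_le_powRD ?(ltW p1)// ltW ?omega_gt0//; exact: omega_le1.
  - by apply: L1Z; apply: L1D => //; exact: L1_omega.
rewrite (Th _ sphi) /Lamdist /reg.
have H1 : (`|\int[mu]_x (h x * Lam phi x)|%:E <= 'N[mu]_1[EFin \o (h \* Lam phi)%R])%E.
  rewrite Lnorm1 (_ : (\int[mu]_x _)%E = (\int[mu]_x (`|h x * Lam phi x|%R)%:E)%E)//.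
  rewrite Rint_EFin; last exact: L1_norm.
  by rewrite lee_fin; apply: le_norm_Rint => //; exact: L1_norm.
have H2 := le_trans H1 (hoelder mu mh mm p0 q0 pq).
rewrite -/N NE in H2.
have := Lnorm_ge0 mu p%:E (fun x : measurableTypeR R => (h x)%:E).
have EN : ('N[mu]_p%:E[EFin \o (h : measurableTypeR R -> R)] =
  Lnorm mu p%:E (fun x : measurableTypeR R => (h x)%:E))%E by [].
move: H2; rewrite EN.
case: (Lnorm _ _ _) => [l| |]; last 2 first.
- by move=> _ _; rewrite leey.
- by move=> _; rewrite leNgt ltNyr.

rewrite -EFinM !lee_fin => H2 l0; rewrite ler_pdivrMr// (le_trans H2)// ler_wpM2l//.
by rewrite lerDl.
Qed.

Variables (u : plane R -> R) (ut : R -> @dist R).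
Hypothesis hut : strong_t_deriv p u ut.
Variables (w W Wt : plane R -> R).
Hypotheses (Wp : LpR2 p W) (Wtp : LpR2 p Wt) (dW : weak_deriv dir_t W Wt).
Hypothesis W0 : forall t x, t <= 0 -> W (t, x) = 0.
Hypothesis wW : forall z, Q z -> w z = W z.
Hypothesis uw : {ae mu, forall t : R, 0 < t < 1 -> deq (slice u t) (Lamdist (slice w t))}.
Variables (phi : R -> R) (C : R).
Hypotheses (sphi : schwartz phi) (C0 : 0 <= C)
  (mm : measurable_fun setT (Lam phi : measurableTypeR R -> R))
  (mC : forall x, `|Lam phi x| <= C * omega x).

(** By duality [u] tested with [phi] is [w] tested with [Lam phi], to which [pairing_cum]
    applies. *)
Lemma slice_cum : {ae mu, forall t, 0 < t < 1 ->
  slice u t phi = cum (pairing (Lam phi) Wt) t}.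
Proof.
have := pairing_cum (ltW p1) Wp Wtp dW W0 mm mC.
move=> /(ae_and uw); apply: ae_imp => t [h1 h2] t01.
rewrite -h2// (h1 t01 _ sphi) pairingE; last by case/andP: t01 => t0 t1; apply/andP; split; lra.
by apply: eq_Rint => x; rewrite wW.
Qed.

(** Convergence in the norm of [H^{-1}_p] entails that of the difference quotients tested with
    [phi]. Their limit is the density of the primitive in [slice_cum], by Lebesgue's theorem and
    [ae_derive_unique]. *)
Lemma ut_pairing : {ae mu, forall t, 0 < t < 1 -> ut t phi = pairing (Lam phi) Wt t}.
Proof.
have [U [Uu _ hU]] := hut.
have [K K0 HK] := Hm1norm_pairing sphi C0 mm mC.
have iG : L1 mu (pairing (Lam phi) Wt) by exact: (L1_pairing (ltW p1) mm mC Wtp).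
have Uc : {ae mu, forall t, 0 < t < 1 -> U t phi = cum (pairing (Lam phi) Wt) t}.
  by apply: ae_imp (ae_and Uu slice_cum) => t [h1 h2] t01; rewrite (h1 t01 _ sphi) h2.
apply: ae_imp (ae_and (ae_and hU Uc) (cum_derivable iG)) => t [[h1 h2] h3] t01.
apply: (ae_derive_unique Uc t01 (h2 t01) _ (h3 t01)).
apply/cvgrPdist_lt => e e0.
have : nbhs 0%E [set y : \bar R | (y < (e / K)%:E)%E].
  by apply: open_ereal_lt'; rewrite lte_fin divr_gt0.
move=> /(h1 t01) H; near=> h.
have : (Hm1norm p (fun phi => (h^-1 * (U (t + h)%R phi - U t phi) - ut t phi)%R) < (e / K)%:E)%E.
  by near: h; exact: H.
by move=> /(le_lt_trans (HK _)); rewrite lte_fin ltr_pM2r ?invr_gt0// distrC.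
Unshelve. all: by end_near. Qed.

End strong_derivative.

(** * The equation tested with mollifiers *)

Section weak_identity.
Context {R : realType}.
Notation mu := (@lebesgue_measure R).

Definition ind (T t : R) : R := \1_(`]0, T]%classic : set R) t.

Lemma ind_cases (T t : R) : (0 < t <= T /\ ind T t = 1) \/ (~ (0 < t <= T) /\ ind T t = 0).
Proof.
have [H|H] := pselect (0 < t <= T); [left|right]; split => //.
  by rewrite /ind indic_in//= in_itv.
by rewrite /ind indic_notin//= in_itv.
Qed.

Lemma measurable_ind (T : R) : measurable_fun setT (fun z : plane R => ind T z.1).
Proof.
by apply: (meas_fst (f := ind T)); apply: measurable_indic; exact: measurable_itv.
Qed.

Definition deta2 (k y : R) : R -> R := derive1 (deta k y).

Lemma deta2_pgauss k y : exists P, deta2 k y = pgauss P k y.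
Proof. by rewrite /deta2 deta_pgauss (derive1_is_derive (dpgauss _ k y)); eexists. Qed.

Variables (p : R) (p1 : 1 < p) (a : plane R -> R) (Ka : R) (f0 : R -> R).
Hypotheses (ma : measurable_fun setT a) (aK : forall z, `|a z| <= Ka).

Section fixed.
Variables (k y : R) (k0 : 0 < k).
Variables (T K : R) (T01 : 0 < T < 1) (th dth : R -> R).
Hypotheses (dth_ : forall t : R, 0 <= t <= T -> is_derive t 1 th (dth t))
  (cdth : forall t : R, 0 <= t <= T -> {for t, continuous dth})
  (thT : th T = 0) (thK : forall t, 0 <= t <= T -> `|th t| <= K)
  (dthK : forall t, 0 <= t <= T -> `|dth t| <= K).


Let iT : 0 < T. Proof. by case/andP: T01. Qed.
Let T1 : T < 1. Proof. by case/andP: T01. Qed.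

Let L1_ind (g : R -> R) : (forall t : R, 0 <= t <= T -> {for t, continuous g}) ->
  L1 mu (fun t => ind T t * g t).
Proof.
move=> cg; have i := L1_itv cg.
have mi : measurable_fun setT (ind T : measurableTypeR R -> R).
  by apply: measurable_indic; exact: measurable_itv.
apply: eq_L1 (L1Mb mi (norm_indic_le1 _) i) => t.
have [[/andP[t0 tT] ->]|[_ ->]] := ind_cases T t; last by rewrite !mul0r.
by rewrite mul1r indic_in ?mul1r//= in_itv/= (ltW t0).
Qed.

Let cth (t : R) : 0 <= t <= T -> {for t, continuous th}.
Proof. by move=> /dth_[+ _]; move=> /derivable1_diffP/differentiable_continuous. Qed.

Let cum_by_parts (r : R -> R) : L1 mu r ->
  \int[mu]_t (cum r t * (ind T t * dth t)) = - \int[mu]_t (ind T t * th t * r t).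
Proof.
move=> ir; have ib := L1_ind cdth.
have := cum_fubini ir ib.
rewrite (@eq_Rint _ _ _ mu _ (fun t => cum r t * (ind T t * dth t))); last first.
  move=> t; have [[/andP[t0 tT] ->]|[_ ->]] := ind_cases T t; last by rewrite !(mul0r, mulr0).
  by rewrite indic_in ?mul1r//= in_itv/= t0 (le_trans tT)// ltW.
move=> ->; rewrite -RintN; last first.
  apply: (@eq_L1 _ _ _ mu (fun t => (ind T t * th t) * r t)) => //.
  apply: (@L1Mb _ _ _ mu (Num.max K 0)) ir => [|t].
    exact: L1_meas (L1_ind cth).
  have [[/andP[t0 tT] ->]|[_ ->]] := ind_cases T t; last by rewrite mul0r normr0 le_max lexx orbT.
  by rewrite mul1r le_max thK// (ltW t0).
apply: eq_Rint => s.
have [h|h] := pselect (`]0, 1]%classic s); last first.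
  rewrite (indic_notin h) mul0r.
  have [[/andP[s0 sT] _]|[_ ->]] := ind_cases T s; last by rewrite !mul0r oppr0.
  by exfalso; apply: h; rewrite /= in_itv/= s0 (le_trans sT)// ltW.
rewrite (indic_in h) mul1r; have := h; rewrite /= in_itv/= => /andP[s0 s1].
have [sT|sT] := leP s T.
  have -> : ind T s = 1 by rewrite /ind indic_in//= in_itv/= s0.
  rewrite mul1r.
  have E : \int[mu]_(t in `[s, T]) dth t = th T - th s.
    apply: FTC2_in => // t /andP[st tT]; [apply: dth_|apply: cdth];
      by rewrite (le_trans (ltW s0) st).
  rewrite (@eq_Rint _ _ _ mu _ (fun t => \1_(`[s, T]%classic : set R) t * dth t)).
    by rewrite -Rint_set E thT sub0r mulrN mulrC.
  move=> t; have [[/andP[t0 tT] ->]|[ht ->]] := ind_cases T t.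
    rewrite mul1r; congr (_ * _).
    have [st|st] := leP s t.
      by rewrite !indic_in//= in_itv/= st// (le_trans tT)// ltW.
    by rewrite !indic_notin//= in_itv/= => /andP[+ _]; apply/negP; rewrite -ltNge.
  rewrite mul0r mulr0 indic_notin ?mul0r//= in_itv/= => /andP[st tT].
  by apply: ht; rewrite tT (lt_le_trans s0 st).
have -> : ind T s = 0.
  by rewrite /ind indic_notin//= in_itv/= => /andP[_]; apply/negP; rewrite -ltNge.
rewrite !mul0r oppr0 -[RHS](mulr0 (r s)); congr (_ * _).
rewrite -[RHS](Rint0 mu); apply: eq_Rint => t.
have [[/andP[t0 tT] _]|[_ ->]] := ind_cases T t; last by rewrite mul0r mulr0.
rewrite indic_notin ?mul0r//= in_itv/= => /andP[st _].
by have := lt_le_trans sT st; rewrite ltNge tT.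
Qed.

Let eta_om : exists2 C, 0 <= C & forall x, `|eta k y x| <= C * omega x.
Proof. exact: pgauss_om. Qed.

Let deta2_om : exists2 C, 0 <= C & forall x, `|deta2 k y x| <= C * omega x.
Proof. by have [P ->] := deta2_pgauss k y; exact: pgauss_om. Qed.

Let L1_test (v b : plane R -> R) (Kb Kg : R) (g h : R -> R) (C : R) :
  LpR2 p v -> measurable_fun setT b -> (forall z, `|b z| <= Kb) ->
  (forall t : R, 0 <= t <= T -> {for t, continuous g}) ->
  (forall t, 0 <= t <= T -> `|g t| <= Kg) ->
  continuous h -> (forall x, `|h x| <= C * omega x) ->
  L1 (leb2 R) (fun z => v z * (b z * (ind T z.1 * g z.1) * h z.2)).
Proof.
move=> vp mb bK cg gK ch hC.
apply: (@L1_LpR2 R p (ltW p1) v _ 1 (Kb * Kg * C) vp).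
  apply: measurable_funM; last by apply: meas_snd; exact: cont_meas.
  by apply: measurable_funM => //; exact: (meas_fst (L1_meas (L1_ind cg))).
move=> [t x] /=; rewrite /strip/=.
have [[/andP[t0 tT] ->]|[_ ->]] := ind_cases T t; last first.
  rewrite mul0r mulr0 mul0r normr0.
  have h0 : 0 <= (0 : R) <= T by rewrite lexx ltW.
  have K0 : 0 <= Kg := le_trans (normr_ge0 _) (gK _ h0).
  have Kb0 : 0 <= Kb by exact: le_trans (bK (t, x)).
  have C0 : 0 <= C.
    by have := le_trans (normr_ge0 _) (hC 0); rewrite pmulr_lge0// omega_gt0.
  by rewrite !mulr_ge0// ?ltW ?omega_gt0// indicE.
have t1 : t <= 1 := le_trans tT (ltW T1).
rewrite indic_in ?mul1r; last by rewrite /= in_itv/= t1 andbT; lra.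
rewrite !normrM -!mulrA !ler_pM ?mulr_ge0//.
by rewrite gK// (ltW t0).
Qed.

Variables (u : plane R -> R).
Hypotheses (hu : calH1_0 p u).
Variables (ut : R -> @dist R) (ux : plane R -> R).
Hypotheses (hut : strong_t_deriv p u ut) (uxp : LpQ p ux) (hx : x_deriv u ux).
Hypothesis eqn : {ae leb, forall t : R, 0 < t < 1 ->
          deq (ut t)
              (fun phi => Ddist (slice (fun z => a z * ux z) t) phi
                          + Lamdist (slice (fun z => f0 z.2) t) phi)}.

Let v := ux \_ Q.

(** The weak form of [v_t = (a v)_xx + Lam f_x]. Both sides of [cum_by_parts] are computed: the
    primitive [cum r] is [u] tested with [deta], that is minus [ux] tested with [eta]; its density
    [r] is [u_t] tested with [deta], which the equation gives. There is no boundary term, as [cum r]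
    starts from [0] and [th T = 0]. *)
Lemma weak_identity :
  \int[leb2 R]_z (v z * (ind T z.1 * dth z.1 * eta k y z.2)) +
  \int[leb2 R]_z (v z * (a z * (ind T z.1 * th z.1) * deta2 k y z.2)) =
  \int[mu]_x (f0 x * Lam (deta k y) x) * \int[mu]_t (ind T t * th t).
Proof.
have [_ [w [W [[Wp [Wx [Wxx [Wt [[_ _ Wtp] [_ _ dW]]]]]] W0 wW]] uw]] := hu.
have [C C0 HC] := Lam_deta_bound k0 y.
have mL : measurable_fun setT (Lam (deta k y) : measurableTypeR R -> R).
  by apply: cont_meas; exact: Lam_deta_cont.
have sphi : schwartz (deta k y) by rewrite deta_pgauss; exact: schwartz_pgauss.
have seta : schwartz (eta k y) by exact: schwartz_pgauss.
pose r := pairing (Lam (deta k y)) Wt.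
have ir : L1 mu r by exact: (L1_pairing (ltW p1) mL HC Wtp).
have e1 : {ae mu, forall t, 0 < t < 1 -> slice u t (deta k y) = cum r t}.
  exact: (slice_cum p1 Wp Wtp dW W0 wW uw sphi mL HC).
have e3 : {ae mu, forall t, 0 < t < 1 -> ut t (deta k y) = r t}.
  exact: (ut_pairing p1 hut Wp Wtp dW W0 wW uw sphi C0 mL HC).
pose P := \int[mu]_x (f0 x * Lam (deta k y) x).
have vE t x : 0 < t < 1 -> v (t, x) = ux (t, x).
  by move=> t01; rewrite /v patchE mem_set.
have vp : LpR2 p v := uxp.
have [Ce Ce0 He] := eta_om; have [Cd Cd0 Hd] := deta2_om.
have ce : continuous (eta k y) by exact: cont_pgauss.
have cd : continuous (deta2 k y) by have [Q ->] := deta2_pgauss k y; exact: cont_pgauss.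
have i1 : L1 (leb2 R) (fun z => v z * (ind T z.1 * dth z.1 * eta k y z.2)).
  have m1 : measurable_fun setT (cst 1 : plane R -> R) by exact: measurable_cst.
  have b1 (z : plane R) : `|cst 1 z| <= 1 :> R by rewrite /= normr1.
  by apply: eq_L1 (L1_test vp m1 b1 cdth dthK ce He) => z /=; rewrite mul1r.
have c1 : forall t : R, 0 <= t <= T -> {for t, continuous (fun _ : R => 1 : R)}.
  by move=> t _; exact: cvg_cst.
have b1 (t : R) : 0 <= t <= T -> `|1 : R| <= 1 by rewrite normr1.
(* The factor [dth] is replaced by [1]: the sections of [v] times [eta] have to be integrable also
   at times where [dth] vanishes. Likewise for [j2]. *)
have j1 : L1 (leb2 R) (fun z => v z * (ind T z.1 * 1 * eta k y z.2)).
  have m1 : measurable_fun setT (cst 1 : plane R -> R) by exact: measurable_cst.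
  have b1' (z : plane R) : `|cst 1 z| <= 1 :> R by rewrite /= normr1.
  by apply: eq_L1 (L1_test vp m1 b1' c1 b1 ce He) => z /=; rewrite mul1r.
have j2 := L1_test vp ma aK c1 b1 cd Hd.
have i2 := L1_test vp ma aK cth thK cd Hd.
have iP : L1 mu (fun t => ind T t * th t) by exact: L1_ind.
have E1 : \int[mu]_t (cum r t * (ind T t * dth t)) =
    - \int[leb2 R]_z (v z * (ind T z.1 * dth z.1 * eta k y z.2)).
  rewrite -(Rint_fubini1 i1) -RintN; last exact: (L1_fubini1 i1).
  apply: eq_Rint_ae.
  - apply: (@eq_measurable_fun _ _ _ _ setT (fun t => (\1_(`]0, 1]%classic : set R) t * cum r t) * (ind T t * dth t))).
      move=> t _; have [[/andP[t0 tT] ->]|[_ ->]] := ind_cases T t; last by rewrite !(mul0r, mulr0).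
      by rewrite indic_in ?mul1r//= in_itv/= t0 (le_trans tT)// ltW.
    by apply: measurable_funM; [exact: L1_meas (L1_cum ir)|exact: L1_meas (L1_ind cdth)].
  - exact: (L1_meas (L1N (L1_fubini1 i1))).
  apply: ae_imp (ae_and e1 (ae_and hx (ae_L1_fubini1 j1))) => t [h1 [h2 h3]].
  have [[/andP[t0 tT] it]|[_ it]] := ind_cases T t; last first.
    rewrite it !(mul0r, mulr0) -[LHS]oppr0; congr (- _).
    by rewrite -[LHS](Rint0 mu); apply: eq_Rint => x /=; rewrite ?it !(mul0r, mulr0).
  have t01 : 0 < t < 1 by rewrite t0 (le_lt_trans tT).
  have S : slice u t (deta k y) = - \int[mu]_x (ux (t, x) * eta k y x).
    by have := h2 t01 _ seta; rewrite /Ddist /slice /reg => ->; rewrite opprK.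
  rewrite -(h1 t01) S it mul1r mulNr mulrC -RintZ.
    by congr (- _); apply: eq_Rint => x /=; rewrite ?it vE//; ring.
  by apply: eq_L1 h3 => x /=; rewrite ?it vE//; ring.
have E2 : \int[mu]_t (ind T t * th t * r t) =
    P * \int[mu]_t (ind T t * th t) -
    \int[leb2 R]_z (v z * (a z * (ind T z.1 * th z.1) * deta2 k y z.2)).
  rewrite -(Rint_fubini1 i2) -(RintZ P iP) -RintB; [|exact: L1Z|exact: (L1_fubini1 i2)].
  apply: eq_Rint_ae.
  - by apply: measurable_funM; [exact: L1_meas iP|exact: L1_meas ir].
  - exact: (L1_meas (L1B (L1Z P iP) (L1_fubini1 i2))).
  apply: ae_imp (ae_and e3 (ae_and eqn (ae_L1_fubini1 j2))) => t [h1 [h2 h3]].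
  have [[/andP[t0 tT] it]|[_ it]] := ind_cases T t; last first.
    rewrite it !(mul0r, mulr0) sub0r -[LHS]oppr0; congr (- _).
    by rewrite -[LHS](Rint0 mu); apply: eq_Rint => x /=; rewrite ?it !(mul0r, mulr0).
  have t01 : 0 < t < 1 by rewrite t0 (le_lt_trans tT).
  rewrite -(h1 t01) (h2 t01 _ sphi) it mul1r /Ddist /Lamdist /slice /reg /= -/P.
  rewrite -/(deta2 k y) mulrDr mulrN addrC mulrC; congr (_ - _).
  rewrite -RintZ.
    by apply: eq_Rint => x /=; rewrite ?it vE//; ring.
  by apply: eq_L1 h3 => x /=; rewrite ?it vE//; ring.
have := cum_by_parts ir; rewrite E1 E2 => E.
by apply/eqP; rewrite eq_sym -subr_eq0; apply/eqP; move: E; rewrite -/P => E; lra.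
Qed.

End fixed.
End weak_identity.

(** * Mollification in [x] *)

Section mollifier.
Context {R : realType}.
Notation mu := (@lebesgue_measure R).

Let Rint_scale_ge0 (f : R -> R) (c : R) : 0 < c -> continuous f -> (forall x, 0 <= f x) ->
  \int[mu]_x (f (c * x) * c) = \int[mu]_x f x.
Proof.
move=> c0 cf f0; pose F (x : R) := c * x.
have dF (x : R) : is_derive x 1 F c by rewrite /F; deriv; ring.
have F1 : derive1 F = cst c by exact: (derive1_is_derive dF).
congr fine; rewrite (@increasing_ge0_integration_by_substitutionT R F f).
- by apply: eq_integral => x _; rewrite F1 /= !fctE.
- by move=> x y xy; rewrite /F ltr_pM2l.
- by rewrite F1; exact: cst_continuous.
- by rewrite F1; exact: is_cvg_cst.
- by rewrite F1; exact: is_cvg_cst.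
- by move=> x; case: (dF x).
- by apply: gt0_cvgMrNy => //; exact: cvg_id.
- by apply: gt0_cvgMry => //; exact: cvg_id.
- exact: cf.
- exact: f0.
Qed.

Lemma Rint_scale (f : R -> R) (c C : R) : 0 < c -> continuous f ->
  (forall x, `|f x| <= C * omega x) ->
  \int[mu]_x f (c * x) = c^-1 * \int[mu]_x f x.
Proof.
move=> c0 cf fC.
have cN : continuous (fun x => `|f x|) by move=> x; apply: cvg_norm; exact: cf.
have iN : L1 mu (fun x => `|f x|) by apply: (L1_om cN) => x; rewrite normr_id; exact: fC.
have cS (h : R -> R) : continuous h -> continuous (fun x => h (c * x)).
  by move=> ch x; apply: (cvg_comp (fun x => c * x) h); [apply: cvgM; [exact: cvg_cst|exact: cvg_id]|exact: ch].
have o2 x : omega (c * x) <= (1 + c^-1 ^+ 2) * omega x.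
  rewrite /omega ler_pdivlMr ?ltr_wpDr ?sqr_ge0// mulrC ler_pdivrMr ?ltr_wpDr ?sqr_ge0//.
  rewrite [leRHS](_ : _ = 1 + x ^+ 2 + (c * x) ^+ 2 + c^-1 ^+ 2); last by field; rewrite gt_eqF.
  by rewrite -addrA lerDl addr_ge0// sqr_ge0.
have C0 : 0 <= C.
  have := le_trans (normr_ge0 _) (fC 0); rewrite pmulr_lge0//; exact: omega_gt0.
have bS x : `|f (c * x)| <= (C * (1 + c^-1 ^+ 2)) * omega x.
  by rewrite -mulrA (le_trans (fC _))// ler_wpM2l.
have iS : L1 mu (fun x => f (c * x)) by exact: (L1_om (cS _ cf) bS).
have iNS : L1 mu (fun x => `|f (c * x)|) by exact: L1_norm.
have i : L1 mu f := L1_om cf fC.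
have cD : continuous (fun x => `|f x| - f x) by move=> x; apply: cvgB; [exact: cN|exact: cf].
have D0 x : 0 <= `|f x| - f x by rewrite subr_ge0 ler_norm.
have H (h : R -> R) : continuous h -> (forall x, 0 <= h x) -> L1 mu (fun x => h (c * x)) ->
    \int[mu]_x h (c * x) = c^-1 * \int[mu]_x h x.
  move=> ch h0 ih; rewrite -(Rint_scale_ge0 c0 ch h0) -RintZ.
    by apply: eq_Rint => x; field; rewrite gt_eqF.
  by apply: eq_L1 (L1Z c ih) => x; rewrite mulrC.
have E1 := H _ cN (fun x => normr_ge0 _) iNS.
have E2 := H _ cD D0 (L1B iNS iS).
rewrite (RintB iNS iS) (RintB iN i) E1 mulrBr in E2.
by move/addrI : E2 => /oppr_inj.
Qed.

Lemma eta_sym (k x y : R) : eta k x y = eta k y x.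
Proof. by rewrite !etaE -sqrrN opprB. Qed.

Lemma deta2E (k y z : R) : deta2 k y z = ((2 * k) ^+ 2 * (z - y) ^+ 2 - 2 * k) * eta k y z.
Proof.
have d (x : R) : is_derive x 1 (deta k y) (((2 * k) ^+ 2 * (x - y) ^+ 2 - 2 * k) * eta k y x).
  have -> : deta k y = (fun z => - (2 * k) * (z - y) * eta k y z) by apply/funext => ?; exact: detaE.
  by deriv_with ltac:(exact: dEta); rewrite detaE; ring.
by rewrite /deta2 (derive1_is_derive d).
Qed.

Lemma deta2_sym (k x y : R) : deta2 k x y = deta2 k y x.
Proof. by rewrite !deta2E eta_sym -[(y - x) ^+ 2]sqrrN opprB. Qed.

Lemma eta_om (k x : R) : 0 < k -> exists2 C, 0 <= C & forall y, `|eta k x y| <= C * omega y.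
Proof. by move=> k0; exact: pgauss_om. Qed.

(* The difference [y - x] makes the bounds of the kernels uniform in the centre. *)
Lemma eta_omB (k : R) : 0 < k -> exists2 C, 0 <= C & forall x y, `|eta k x y| <= C * omega (y - x).
Proof.
move=> k0; have [C C0 H] := eta_om 0 k0; exists C => // x y.
by have := H (y - x); rewrite !etaE subr0.
Qed.

Lemma deta2_omB (k : R) : 0 < k -> exists2 C, 0 <= C & forall x y, `|deta2 k x y| <= C * omega (y - x).
Proof.
move=> k0; have [P E] := deta2_pgauss k 0; have [C C0 H] := pgauss_om P 0 k0; exists C => // x y.
by have := H (y - x); rewrite -E !deta2E !etaE subr0.
Qed.

Lemma eta_cont (k x : R) : continuous (eta k x). Proof. exact: cont_pgauss. Qed.

Let gauss_om : exists2 C, 0 <= C & forall w : R, `|expR (- 1 * w ^+ 2)| <= C * omega w.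
Proof.
have [C C0 H] := pgauss_om 1 0 (@ltr01 R); exists C => // w.
by have := H w; rewrite /pgauss hornerC mul1r subr0.
Qed.

Lemma gmass_scale (c : R) : 0 < c -> gmass (c ^+ 2) = c^-1 * gmass 1.
Proof.
move=> c0; have [C C0 H] := gauss_om.
rewrite /gmass -(Rint_scale c0 _ H); last by apply: is_derive_continuous => w; repeat deriv1.
by apply: eq_Rint => w; congr expR; ring.
Qed.

Section fixed.
Variables (h : R -> R) (C : R).
Hypotheses (ch : continuous h) (hC : forall x, `|h x| <= C * omega x).

Let C0 : 0 <= C.
Proof. by have := le_trans (normr_ge0 _) (hC 0); rewrite pmulr_lge0// omega_gt0. Qed.

Let conth (b x : R) : continuous (fun w => h (b * w + x)).
Proof.
move=> w; apply: (cvg_comp (fun w => b * w + x) h); last exact: ch.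
by apply: cvgD; [apply: cvgM; [exact: cvg_cst|exact: cvg_id]|exact: cvg_cst].
Qed.

(** A majorant independent of [c >= 1]: Peetre's inequality bounds [omega (w / c + x)] by
    [2 * (1 + w ^+ 2) * omega x]. *)
Let Kg (x w : R) : R := expR (- 1 * w ^+ 2) * (C * (2 * (1 + w ^+ 2) * omega x)).

Let KgE x w : Kg x w = (2 * C * omega x) * pgauss (1 + 'X^2) 1 0 w.
Proof.
by rewrite /Kg /pgauss !(hornerD, hornerXn, hornerC) subr0; ring.
Qed.

Let L1_Kg x : L1 mu (Kg x).
Proof.
apply: (@eq_L1 _ _ _ mu (fun w => (2 * C * omega x) * pgauss (1 + 'X^2) 1 0 w)) => [w|].
  by rewrite KgE.
have [B B0 HB] := pgauss_om (1 + 'X^2) 0 (@ltr01 R).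
by apply: L1Z; apply: L1_om HB; exact: cont_pgauss.
Qed.

Let dom (c x w : R) : 1 <= c -> `|expR (- 1 * w ^+ 2) * h (c^-1 * w + x)| <= Kg x w.
Proof.
move=> c1; have c0 : 0 < c by exact: lt_le_trans c1.
rewrite normrM ger0_norm ?expR_ge0// /Kg ler_wpM2l ?expR_ge0//.
apply: le_trans (hC _) _; rewrite ler_wpM2l//.
have := omegaM_le x (- (c^-1 * w)); rewrite opprK omegaN addrC => H.
have wp := omega_gt0 (c^-1 * w).
rewrite -(ler_pM2r wp) (le_trans H)// {H}.
rewrite [leRHS](_ : _ = 2 * omega x * ((1 + w ^+ 2) * omega (c^-1 * w))); last by ring.
rewrite ler_peMr//; first by rewrite mulr_ge0// ltW// omega_gt0.
rewrite /omega ler_pdivlMr ?ltr_wpDr ?sqr_ge0// mul1r lerD2l exprMn ler_piMl ?sqr_ge0//.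
by rewrite exprn_ile1 ?invr_ge0 ?invf_le1 // ltW.
Qed.

Let L1_mollw (c x : R) : 1 <= c -> L1 mu (fun w => expR (- 1 * w ^+ 2) * h (c^-1 * w + x)).
Proof.
move=> c1; apply: (@L1_dom _ _ _ mu (Kg x)) (L1_Kg x) => [|w]; last exact: dom.
have cg : continuous (fun w : R => expR (- 1 * w ^+ 2)).
  by apply: is_derive_continuous => z; repeat deriv1.
by apply: cont_meas => w; apply: cvgM; [exact: cg|exact: conth].
Qed.

Lemma moll (c x : R) : 1 <= c -> \int[mu]_y (eta (c ^+ 2) x y * h y) =
  (gmass 1)^-1 * \int[mu]_w (expR (- 1 * w ^+ 2) * h (c^-1 * w + x)).
Proof.
move=> c1; have c0 : 0 < c by exact: lt_le_trans c1.
have k0 : 0 < c ^+ 2 by rewrite exprn_gt0.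
have [B B0 HB] := eta_om x k0.
pose F y := eta (c ^+ 2) x y * h y.
have cF : continuous F by move=> y; apply: cvgM; [exact: eta_cont|exact: ch].
have FB y : `|F y| <= (B * C) * omega y.
  rewrite normrM (le_trans (ler_pM _ _ (HB y) (hC y)))//.
  rewrite -!mulrA ler_wpM2l// mulrCA ler_wpM2l// ler_piMl ?omega_le1// ltW// omega_gt0//.
rewrite -[LHS](Rint_shift x cF FB).
have o2 y : omega (y + x) <= 2 / omega x * omega y.
  rewrite mulrAC ler_pdivlMr ?omega_gt0//.
  by have := omegaM_le y (- x); rewrite opprK omegaN.
have cF1 : continuous (fun y => F (y + x)).
  by move=> w; apply: (cvg_comp (fun w => w + x) F); [apply: cvgD; [exact: cvg_id|exact: cvg_cst]|exact: cF].
have F1B y : `|F (y + x)| <= (B * C * (2 / omega x)) * omega y.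
  by rewrite -[_ * omega y]mulrA (le_trans (FB _))// ler_wpM2l// mulr_ge0.
have ci : 0 < c^-1 by rewrite invr_gt0.
have := Rint_scale ci cF1 F1B; rewrite invrK => E.
have -> : \int[mu]_y F (y + x) = c^-1 * \int[mu]_w F (c^-1 * w + x).
  by rewrite E mulrA mulVf ?mul1r// gt_eqF.
rewrite -!RintZ; [|exact: L1_mollw|].
  apply: eq_Rint => w; rewrite /F etaE addrK (gmass_scale c0).
  rewrite (_ : - c ^+ 2 * (c^-1 * w) ^+ 2 = - 1 * w ^+ 2).
    by field; rewrite !gt_eqF ?gmass_gt0.
  by field; rewrite gt_eqF.
apply: (@eq_L1 _ _ _ mu (fun w => (c * (gmass 1)^-1) * (expR (- 1 * w ^+ 2) * h (c^-1 * w + x)))).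
  move=> w; rewrite /F etaE addrK (gmass_scale c0).
  rewrite (_ : - c ^+ 2 * (c^-1 * w) ^+ 2 = - 1 * w ^+ 2).
    by field; rewrite !gt_eqF ?gmass_gt0.
  by field; rewrite gt_eqF.
exact/L1Z/L1_mollw.
Qed.

Definition moll_const : R := (gmass 1)^-1 * (2 * \int[mu]_w pgauss (1 + 'X^2) 1 0 w).

Lemma moll_bound (c x : R) : 1 <= c ->
  `|\int[mu]_y (eta (c ^+ 2) x y * h y)| <= moll_const * C * omega x.
Proof.
move=> c1; rewrite moll// normrM ger0_norm; last first.
  by rewrite invr_ge0 ltW// gmass_gt0.
rewrite /moll_const -!mulrA ler_wpM2l ?invr_ge0 ?(ltW (gmass_gt0 _))//.
apply: (@le_trans _ _ (\int[mu]_w Kg x w)).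
  by apply: le_norm_Rint; [exact: L1_mollw|exact: L1_Kg|move=> w; exact: dom].
rewrite (@eq_Rint _ _ _ mu _ _ (KgE x)) RintZ; last first.
  have [B B0 HB] := pgauss_om (1 + 'X^2) 0 (@ltr01 R).
  by apply: L1_om HB; exact: cont_pgauss.
by rewrite le_eqVlt; apply/orP; left; apply/eqP; ring.
Qed.

Lemma moll_cvg (x : R) :
  \int[mu]_y (eta (n.+1%:R ^+ 2) x y * h y) @[n --> \oo] --> h x.
Proof.
rewrite (_ : (fun n : nat => _) = (fun n => (gmass 1)^-1 *
    \int[mu]_w (expR (- 1 * w ^+ 2) * h (n.+1%:R^-1 * w + x)))); last first.
  by apply/funext => n; rewrite moll// ler1n.
have -> : h x = (gmass 1)^-1 * \int[mu]_w (expR (- 1 * w ^+ 2) * h x).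
  rewrite (@eq_Rint _ _ _ mu _ (fun w => h x * expR (- 1 * w ^+ 2))); last by move=> w; rewrite mulrC.
  rewrite RintZ; first by rewrite -/(gmass 1) mulrCA mulVf ?mulr1// gt_eqF// gmass_gt0.
  have [B B0 HB] := gauss_om.
  by apply: L1_om HB; apply: is_derive_continuous => w; repeat deriv1.
apply: cvgM; first exact: cvg_cst.
apply: (@Rint_dct _ _ _ mu (fun n w => expR (- 1 * w ^+ 2) * h (n.+1%:R^-1 * w + x)) _ (Kg x)).
- by move=> n; apply: L1_meas; apply: L1_mollw; rewrite ler1n.
- move=> w; apply: cvgM; first exact: cvg_cst.
  apply: (cvg_comp (fun n => n.+1%:R^-1 * w + x) h); last exact: ch.
  have H : (n.+1%:R^-1 : R) @[n --> \oo] --> (0 : R) by exact: cvg_harmonic.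
  have := cvgD (cvgM H (cvg_cst w)) (cvg_cst x).
  by rewrite mul0r add0r; apply.
- exact: L1_Kg.
- by move=> n w; apply: dom; rewrite ler1n.
Qed.

End fixed.
End mollifier.

Lemma sigma_finite_prod d1 d2 (T1 : measurableType d1) (T2 : measurableType d2) (R : realType)
  (m1 : {sigma_finite_measure set T1 -> \bar R}) (m2 : {sigma_finite_measure set T2 -> \bar R}) :
  sigma_finite setT (m1 \x m2)%E.
Proof.
have /sigma_finiteP[F [TF ndF Foo]] := sigma_finiteT m1.
have /sigma_finiteP[G [TG ndG Goo]] := sigma_finiteT m2.
exists (fun n => F n `*` G n) => [|k].
  rewrite -setXTT TF TG predeqE => -[x y]; split.
    move=> [/= [n _ Fnx] [k _ Gky]]; exists (maxn n k) => //; split.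
    - by move: x Fnx; exact/subsetPset/ndF/leq_maxl.
    - by move: y Gky; exact/subsetPset/ndG/leq_maxr.
  by move=> [n _ []/= ? ?]; split; exists n.
have [? ?] := Foo k; have [? ?] := Goo k.
split; first exact: measurableX.
by rewrite product_measure1E// lte_mul_pinfty// ge0_fin_numE.
Qed.

(* The canonical instance on [m1 \x m2] is only found for subprobabilities. *)
Definition prod_sf d1 d2 (T1 : measurableType d1) (T2 : measurableType d2) (R : realType)
  (m1 : {sigma_finite_measure set T1 -> \bar R}) (m2 : {sigma_finite_measure set T2 -> \bar R}) :
  {sigma_finite_measure set (T1 * T2)%type -> \bar R} :=
  HB.pack (m1 \x m2)%E (Measure_isSigmaFinite.Build _ _ _ (m1 \x m2)%E (sigma_finite_prod m1 m2)).

(** * Removing the mollification *)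

Section mollified_limit.
Context {R : realType}.
Notation mu := (@lebesgue_measure R).
Variables (p : R) (p1 : 1 <= p) (v a : plane R -> R) (Ka T C : R).
Hypotheses (vp : LpR2 p v) (ma : measurable_fun setT a) (aK : forall z, `|a z| <= Ka).
Hypotheses (T1 : T <= 1) (C0 : 0 <= C).
Variables (A B D : R -> R -> R).
Hypotheses (mA : measurable_fun setT (fun z : plane R => A z.1 z.2))
  (mB : measurable_fun setT (fun z : plane R => B z.1 z.2)).
Hypotheses (bA : forall t x, `|A t x| <= C * ind T t * omega x ^+ 2)
  (bB : forall t x, `|B t x| <= C * ind T t * omega x ^+ 2)
  (bD : forall t x, `|D t x| <= C * ind T t * omega x ^+ 2).
Hypotheses (cB : forall t, continuous (B t)) (cD : forall t, continuous (D t)).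
Hypothesis parts : forall k t x, 0 < k ->
  \int[mu]_y (deta2 k x y * A t y) = \int[mu]_y (eta k x y * D t y).
Variables (kap c : R) (kap0 : 0 < kap).
Hypothesis identity : forall k y, 0 < k ->
  \int[leb2 R]_z (v z * (B z.1 y * eta k y z.2)) +
  \int[leb2 R]_z (v z * (a z * A z.1 y * deta2 k y z.2)) =
  c * skernel ((4 * k)^-1 + kap) y * \int[mu]_t A t y.

Let ind0 (t : R) : 0 <= ind T t. Proof. by rewrite /ind indicE. Qed.

Let ind_win (t : R) : ind T t <= \1_(`[- 1, 1]%classic : set R) t.
Proof.
rewrite /ind; have [h|h] := pselect (`]0, T]%classic t); last first.
  by rewrite (indic_notin h) indicE.
rewrite !indic_in//; move: h; rewrite /= !in_itv/= => /andP[t0 tT].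
by rewrite (le_trans tT T1) andbT (le_trans _ (ltW t0))// oppr_le0.
Qed.

Let mind : measurable_fun setT (ind T : measurableTypeR R -> R).
Proof. by apply: measurable_indic; exact: measurable_itv. Qed.

Let L1_ind : L1 mu (ind T).
Proof.
apply: (@L1_dom _ _ _ mu (\1_(`[- 1, 1]%classic : set R))) => //; last exact: L1_indic_itv.
by move=> t; rewrite ger0_norm.
Qed.

Let fubini3 (F : plane R * measurableTypeR R -> R) : L1 (prod_sf mu mu \x mu)%E F ->
  [/\ \int[leb2 R]_z (\int[mu]_y F (z, y)) = \int[mu]_y (\int[leb2 R]_z F (z, y)),
      L1 (leb2 R) (fun z => \int[mu]_y F (z, y)) &
      L1 mu (fun y => \int[leb2 R]_z F (z, y))].
Proof.
move=> iF; split; [|exact: (L1_fubini1 iF)|exact: (L1_fubini2 iF)].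
exact: (etrans (Rint_fubini1 iF) (esym (Rint_fubini2 iF))).
Qed.

Let momega : measurable_fun setT (omega : measurableTypeR R -> R).
Proof. by apply: cont_meas; exact: continuous_omega. Qed.

Let w0 (x : R) : 0 <= omega x. Proof. by rewrite ltW// omega_gt0. Qed.

Let dom (z : plane R) : R := `|v z| * (ind T z.1 * omega z.2).

Let L1_dom0 : L1 (leb2 R) dom.
Proof.
have i : L1 (leb2 R) (fun z => v z * (ind T z.1 * omega z.2)).
  apply: (@L1_LpR2 R p p1 v _ 1 1 vp).
    by apply: measurable_funM; [exact: (meas_fst mind)|exact: (meas_snd momega)].
  by move=> z; rewrite mul1r /strip ger0_norm ?mulr_ge0// ler_wpM2r.
apply: eq_L1 (L1_norm i) => z; rewrite normrM /dom; congr (_ * _).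
by rewrite ger0_norm// mulr_ge0.
Qed.

Let mv : measurable_fun setT v. Proof. exact: LpR2_meas vp. Qed.

Let mz_y (F : R -> R -> R) : measurable_fun setT (fun z : plane R => F z.1 z.2) ->
  measurable_fun setT (fun q : plane R * measurableTypeR R => F q.1.1 q.2).
Proof.
move=> mF; apply: (measurableT_comp mF (g := fun q : plane R * measurableTypeR R => (q.1.1, q.2))).
apply/measurable_fun_pairP; split; last exact: measurable_snd.
exact: (measurableT_comp measurable_fst measurable_fst).
Qed.

Let mfx : measurable_fun setT (fun q : plane R * measurableTypeR R => q.1.2).
Proof. by apply: (measurableT_comp measurable_snd); exact: measurable_fst. Qed.

Let meta3 k : measurable_fun setT (fun q : plane R * measurableTypeR R => eta k q.2 q.1.2).
Proof.
rewrite (_ : (fun q : _ => _) =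
    (fun d => (gmass k)^-1 * expR (- k * d ^+ 2)) \o (fun q : plane R * measurableTypeR R => q.1.2 - q.2)).
  apply: measurableT_comp; last by apply: measurable_funB => //; exact: measurable_snd.
  by apply: cont_meas; apply: is_derive_continuous => x; repeat deriv1.
by apply/funext => q; rewrite etaE.
Qed.

Let mdeta3 k : measurable_fun setT (fun q : plane R * measurableTypeR R => deta2 k q.2 q.1.2).
Proof.
rewrite (_ : (fun q : _ => _) =
    (fun q => ((fun d => (2 * k) ^+ 2 * d ^+ 2 - 2 * k) \o
       (fun q : plane R * measurableTypeR R => q.1.2 - q.2)) q * eta k q.2 q.1.2)).
  apply: measurable_funM; last exact: meta3.
  apply: measurableT_comp; last by apply: measurable_funB => //; exact: measurable_snd.
  by apply: cont_meas; apply: is_derive_continuous => x; repeat deriv1.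
by apply/funext => q; rewrite deta2E.
Qed.

(* Peetre's inequality [omegaM_le] separates the variables of the kernel. *)
Let swap (b : plane R -> R) (Kb : R) (F : R -> R -> R) (K : R -> R -> R) (CK : R) :
  measurable_fun setT b -> (forall z, `|b z| <= Kb) ->
  measurable_fun setT (fun z : plane R => F z.1 z.2) ->
  (forall t x, `|F t x| <= C * ind T t * omega x ^+ 2) ->
  measurable_fun setT (fun q : plane R * measurableTypeR R => K q.2 q.1.2) ->
  0 <= CK -> (forall y x, `|K y x| <= CK * omega (x - y)) ->
  L1 (prod_sf mu mu \x mu)%E (fun q : plane R * measurableTypeR R =>
    v q.1 * (b q.1 * F q.1.1 q.2 * K q.2 q.1.2)).
Proof.
move=> mb bK mF bF mK CK0 bKer.
apply: (@L1_prod _ _ _ _ _ (prod_sf mu mu) mu _ (fun z => (2 * Kb * C * CK) * dom z) omega).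
- apply: measurable_funM; first by apply: measurableT_comp => //; exact: measurable_fst.
  apply: measurable_funM => //; apply: measurable_funM; last exact: mz_y.
  by apply: measurableT_comp => //; exact: measurable_fst.
- exact: L1Z.
- exact: L1_omega.
move=> [t x] y /=; rewrite /dom/= !normrM.
have Kb0 : 0 <= Kb by exact: le_trans (bK (t, x)).
have H := omegaM_le x y.
apply: (@le_trans _ _ (`|v (t, x)| * (Kb * (C * ind T t * omega y ^+ 2) * (CK * omega (x - y))))).
  rewrite ler_wpM2l//; apply: ler_pM => //.
  by apply: ler_pM.
rewrite [leLHS](_ : _ = (`|v (t, x)| * Kb * C * CK * ind T t * omega y) * (omega (x - y) * omega y)); last by ring.
rewrite [leRHS](_ : _ = (`|v (t, x)| * Kb * C * CK * ind T t * omega y) * (2 * omega x)); last by ring.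
by rewrite ler_wpM2l// !mulr_ge0.
Qed.

Let Kc : R := \int[mu]_xi smoment kap 2 xi.

Let mKn (k : R) : 0 < k -> continuous (skernel k).
Proof. exact: skernel_cont. Qed.

Let L1_KnA (k : R) : kap <= k -> L1 (leb2 R) (fun z => skernel k z.2 * A z.1 z.2).
Proof.
move=> kk; have k0 : 0 < k by exact: lt_le_trans kk.
apply: (@L1_prod _ _ _ _ _ mu mu _ (fun t => (Kc * C) * ind T t) omega).
- by apply: measurable_funM => //; exact: (meas_snd (cont_meas (mKn k0))).
- exact/L1Z/L1_ind.
- exact: L1_omega.
move=> t y; rewrite normrM /=.
have Kc0 : 0 <= Kc by exact: le_trans (skernel_dom kap0 0 kk).
apply: (@le_trans _ _ (Kc * (C * ind T t * omega y ^+ 2))).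
  by apply: ler_pM => //; exact: skernel_dom.
rewrite -!mulrA !ler_wpM2l// ler_piMl// ?omega_le1//.
Qed.

(** The hypothesis [identity] is integrated over the centre [y] of the mollifier. As [eta] is
    symmetric in centre and argument, this mollifies [B]; [parts] turns the second derivative of the
    mollifier on [A] into the mollification of [D]. *)
Let identity_k (k : R) : 0 < k ->
  L1 (leb2 R) (fun z => v z * (\int[mu]_y (eta k z.2 y * B z.1 y) +
                         a z * \int[mu]_y (eta k z.2 y * D z.1 y))) /\
  \int[leb2 R]_z (v z * (\int[mu]_y (eta k z.2 y * B z.1 y) +
                         a z * \int[mu]_y (eta k z.2 y * D z.1 y))) =
  c * \int[leb2 R]_z (skernel ((4 * k)^-1 + kap) z.2 * A z.1 z.2).
Proof.
move=> k0; have [C1 C10 H1] := eta_omB k0; have [C2 C20 H2] := deta2_omB k0.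
have kk : kap <= (4 * k)^-1 + kap by rewrite lerDr invr_ge0 mulr_ge0// ltW.
have m1 : measurable_fun setT (cst 1 : plane R -> R) by exact: measurable_cst.
have b1 (z : plane R) : `|cst 1 z| <= 1 :> R by rewrite /= normr1.
have i1 := swap m1 b1 mB bB (@meta3 k) C10 H1.
have i2 := swap ma aK mA bA (@mdeta3 k) C20 H2.
have i3 := L1_KnA kk.
have [e1 f1 g1] := fubini3 i1; have [e2 f2 g2] := fubini3 i2.
have E (z : plane R) :
    \int[mu]_y (v z * (cst 1 z * B z.1 y * eta k y z.2)) +
    \int[mu]_y (v z * (a z * A z.1 y * deta2 k y z.2)) =
    v z * (\int[mu]_y (eta k z.2 y * B z.1 y) + a z * \int[mu]_y (eta k z.2 y * D z.1 y)).
  have om0 (x y : R) : omega (x - y) <= 1 := omega_le1 _.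
  have io2 : L1 mu (fun y => C * omega y ^+ 2).
    apply: L1Z; apply: (@L1_om _ _ 1) => [|y].
      by move=> y; exact: (cvgM (@continuous_omega R y) (@continuous_omega R y)).
    by rewrite mul1r ger0_norm ?exprn_ge0// expr2 ler_piMl// omega_le1.
  have sec (F : R -> R -> R) t : measurable_fun setT (fun z : plane R => F z.1 z.2) ->
      measurable_fun setT (F t : measurableTypeR R -> R).
    by move=> mF; exact: (measurableT_comp mF (pair1_measurable t)).
  have iS (F K : R -> R -> R) CK t x : measurable_fun setT (fun z : plane R => F z.1 z.2) ->
      (forall t x, `|F t x| <= C * ind T t * omega x ^+ 2) ->
      measurable_fun setT (fun q : plane R * measurableTypeR R => K q.2 q.1.2) ->
      0 <= CK -> (forall y x, `|K y x| <= CK * omega (x - y)) ->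
      L1 mu (fun y => K y x * F t y).
    move=> mF bF mK CK0 bK.
    apply: (@L1_dom _ _ _ mu (fun y => CK * (C * omega y ^+ 2))); last exact: L1Z.
      apply: measurable_funM; last exact: sec.
      exact: (measurableT_comp mK (pair1_measurable (t, x))).
    move=> y; rewrite normrM ler_pM//.
      by rewrite (le_trans (bK _ _))// ler_piMr.
    rewrite (le_trans (bF _ _))// -mulrA ler_wpM2l// ler_piMl ?exprn_ge0//.
    by rewrite (le_trans (ind_win t))// indicE; case: (_ \in _).
  case: z => t x /=; rewrite mulrDr; congr (_ + _).
    rewrite -RintZ; first by apply: eq_Rint => y; rewrite mul1r eta_sym; ring.
    apply: (@eq_L1 _ _ _ mu (fun y => eta k y x * B t y)); first by move=> y; rewrite eta_sym.
    exact: (iS B (eta k) C1).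
  rewrite -parts// mulrA -RintZ; first by apply: eq_Rint => y; rewrite deta2_sym; ring.
  apply: (@eq_L1 _ _ _ mu (fun y => deta2 k y x * A t y)); first by move=> y; rewrite deta2_sym.
  exact: (iS A (deta2 k) C2).
split; first by apply: eq_L1 (L1D f1 f2).
transitivity (\int[mu]_y (\int[leb2 R]_z (v z * (cst 1 z * B z.1 y * eta k y z.2)) +
  \int[leb2 R]_z (v z * (a z * A z.1 y * deta2 k y z.2)))).
  by rewrite (RintD g1 g2) -e1 -e2 -(RintD f1 f2); apply: eq_Rint => z; rewrite E.
rewrite -(Rint_fubini2 i3) -(RintZ c (L1_fubini2 i3)).
have iA y : L1 mu (A^~ y).
  apply: (@L1_dom _ _ _ mu (fun t => C * ind T t)).
  - by apply: (measurableT_comp mA (g := fun t : measurableTypeR R => (t, y))).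
  - move=> t; rewrite (le_trans (bA _ _))// ler_piMr ?mulr_ge0//.
    by rewrite exprn_ile1// omega_le1.
  - exact/L1Z/L1_ind.
apply: eq_Rint => y /=; rewrite (RintZ _ (iA y)) mulrA -identity//; congr (_ + _).
by apply: eq_Rint => z; rewrite mul1r.
Qed.

(** [A], [B] and [D] stand for the test function, its [t]-derivative and its second [x]-derivative,
    cut off in time. Dominated convergence as [k] grows, the parameter [(4 * k)^-1 + kap] tending to
    [kap]. *)
Lemma mollified_limit :
  \int[leb2 R]_z (v z * (B z.1 z.2 + a z * D z.1 z.2)) =
  c * \int[leb2 R]_z (skernel kap z.2 * A z.1 z.2).
Proof.
pose k (n : nat) : R := n.+1%:R ^+ 2.
have k0 n : 0 < k n by rewrite exprn_gt0.
have bH (F : R -> R -> R) t x : (forall t x, `|F t x| <= C * ind T t * omega x ^+ 2) ->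
    `|F t x| <= C * ind T t * omega x.
  move=> bF; rewrite (le_trans (bF _ _))// ler_wpM2l ?mulr_ge0// expr2 ler_piMl//.
  exact: omega_le1.
have l1 : \int[leb2 R]_z (v z * (\int[mu]_y (eta (k n) z.2 y * B z.1 y) +
    a z * \int[mu]_y (eta (k n) z.2 y * D z.1 y))) @[n --> \oo] -->
    \int[leb2 R]_z (v z * (B z.1 z.2 + a z * D z.1 z.2)).
  pose M := @moll_const R.
  apply: (@Rint_dct _ _ _ (leb2 R) (fun n z => v z * (\int[mu]_y (eta (k n) z.2 y * B z.1 y) +
    a z * \int[mu]_y (eta (k n) z.2 y * D z.1 y))) _ (fun z => (1 + Ka) * (M * C) * dom z)).
  - by move=> n; have [i _] := identity_k (k0 n); exact: L1_meas i.
  - move=> [t x] /=; apply: cvgM; first exact: cvg_cst.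
    apply: cvgD; first exact: (moll_cvg (@cB t) (fun x => bH _ t x bB)).
    apply: cvgM; first exact: cvg_cst.
    exact: (moll_cvg (@cD t) (fun x => bH _ t x bD)).
  - exact: L1Z.
  - move=> n [t x] /=; rewrite normrM /dom/=.
    have n1 : 1 <= n.+1%:R :> R by rewrite ler1n.
    have e1 := moll_bound (@cB t) (fun x => bH _ t x bB) x n1.
    have e2 := moll_bound (@cD t) (fun x => bH _ t x bD) x n1.
    rewrite [leRHS](_ : _ = `|v (t, x)| * ((1 + Ka) * (M * (C * ind T t) * omega x))); last by ring.
    rewrite ler_wpM2l// (le_trans (ler_normD _ _))// [leRHS]mulrDl mul1r lerD//.
    by rewrite normrM ler_pM//.
have l2 : c * \int[leb2 R]_z (skernel ((4 * k n)^-1 + kap) z.2 * A z.1 z.2) @[n --> \oo] -->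
    c * \int[leb2 R]_z (skernel kap z.2 * A z.1 z.2).
  apply: cvgM; first exact: cvg_cst.
  have r0 n : 0 <= (4 * k n)^-1 by rewrite invr_ge0 mulr_ge0// ltW.
  apply: (@Rint_dct _ _ _ (leb2 R) (fun n z => skernel ((4 * k n)^-1 + kap) z.2 * A z.1 z.2) _
     (fun z => Kc * `|A z.1 z.2|)).
  - by move=> n; apply: L1_meas; apply: L1_KnA; rewrite lerDr.
  - move=> [t x] /=; apply: cvgM; last exact: cvg_cst.
    apply: (skernel_cvg kap0 (r := fun n => (4 * k n)^-1)) => //.
    have H : (n.+1%:R^-1 : R) @[n --> \oo] --> (0 : R) by exact: cvg_harmonic.
    have -> : (fun n => (4 * k n)^-1) = (fun n : nat => 4^-1 * (n.+1%:R^-1 * n.+1%:R^-1)).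
      by apply/funext => n; rewrite /k expr2 !invfM.
    by have := cvgM (cvg_cst (4^-1 : R)) (cvgM H H); rewrite !mulr0; exact.
  - apply: L1Z; apply: L1_norm.
    apply: (@L1_prod _ _ _ _ _ mu mu _ (fun t => C * ind T t) omega) => //.
    - exact/L1Z/L1_ind.
    - exact: L1_omega.
    by move=> t x; exact: bH.
  - move=> n [t x] /=; rewrite normrM ler_wpM2r//; apply: skernel_dom => //.
    by rewrite lerDr.
apply: cvg_unique l2; first exact: Rhausdorff.
by apply: cvg_trans l1; apply: near_eq_cvg; near=> n; rewrite (identity_k (k0 n)).2.
Unshelve. all: by end_near. Qed.

End mollified_limit.

(** * The barrier *)

Section parabolic_weight.
Context {R : realType}.
Notation mu := (@lebesgue_measure R).

(** The similarity variable [x / sqrt s]. For [t >= 1] the default values of square root and inverse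
    make it [0]. *)
Definition rescale (t x : R) : R := (Num.sqrt (1 - t))^-1 * x.

Lemma measurable_rescale : measurable_fun setT (fun z : plane R => rescale z.1 z.2).
Proof.
have mr : measurable_fun setT ((fun t => (Num.sqrt (1 - t))^-1) : measurableTypeR R -> R).
  have -> : (fun t : measurableTypeR R => (Num.sqrt (1 - t))^-1) =
      (fun t : measurableTypeR R => (Num.sqrt (1 - t)) `^ (-1)).
    by apply/funext => t; rewrite powR_inv1// sqrtr_ge0.
  apply: (measurableT_comp (measurable_powR _)).
  apply: cont_meas => t; apply: (cvg_comp (fun t => 1 - t) Num.sqrt); last exact: sqrt_continuous.
  by apply: cvgB; [exact: cvg_cst|exact: cvg_id].
apply: measurable_funM; first exact: (meas_fst mr).
by apply: (meas_snd (f := fun x : measurableTypeR R => x)); apply: cont_meas => x; exact: cvg_id.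
Qed.

Lemma measurable_onem_powR (e : R) :
  measurable_fun setT (fun z : plane R => (1 - z.1) `^ e).
Proof.
apply: (meas_fst (f := fun t : measurableTypeR R => (1 - t) `^ e)).
apply: (measurableT_comp (measurable_powR e)).
by apply: cont_meas => t; apply: cvgB; [exact: cvg_cst|exact: cvg_id].
Qed.

Lemma measurable_ind_inv (T : R) : T < 1 ->
  measurable_fun setT (fun z : plane R => ind T z.1 * (1 - z.1)^-1).
Proof.
move=> T1; have -> : (fun z : plane R => ind T z.1 * (1 - z.1)^-1) =
    (fun z : plane R => ind T z.1 * (1 - z.1) `^ (-1)).
  apply/funext => z; rewrite /ind; have [H|H] := pselect (`]0, T]%classic z.1); last first.
    by rewrite (indic_notin H) !mul0r.
  by move: H => /=; rewrite in_itv/= => /andP[t0 t1]; rewrite powR_inv1//; lra.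
by apply: measurable_funM; [exact: measurable_ind|exact: measurable_onem_powR].
Qed.

Lemma le_rescale t x : 0 <= t -> t < 1 -> `|x| <= `|rescale t x|.
Proof.
move=> t0 t1; rewrite /rescale normrM ler_peMl// ger0_norm ?invr_ge0 ?sqrtr_ge0//.
rewrite invf_ge1 ?sqrtr_gt0 ?subr_gt0//.
by rewrite -[leRHS]sqrtr1 ler_wsqrtr// gerBl.
Qed.

Let I : R := \int[mu]_x omega x.

Let I0 : 0 <= I. Proof. by apply: Rint_ge0 => x; rewrite ltW// omega_gt0. Qed.

Let Rint_rescale t : t < 1 -> \int[mu]_x omega (rescale t x) = Num.sqrt (1 - t) * I.
Proof.
move=> t1; have c0 : 0 < (Num.sqrt (1 - t))^-1 by rewrite invr_gt0 sqrtr_gt0 subr_gt0.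
rewrite (@Rint_scale _ omega _ 1 c0) ?invrK//; first exact: continuous_omega.
by move=> x; rewrite mul1r ger0_norm// ltW// omega_gt0.
Qed.

(** The integral in [x] contributes [sqrt (1 - t)], which moves the threshold for the exponent from
    [- 1] to [- 3 / 2]. *)
Lemma L1_parabolic (e : R) : - (3 / 2) < e -> L1 (leb2 R) (fun z =>
  \1_(`[0, 1[%classic : set R) z.1 * ((1 - z.1) `^ e * omega (rescale z.1 z.2))).
Proof.
move=> e1; have e0 : 0 < e + 3 / 2 by lra.
pose b n : R := 1 - n.+1%:R^-1.
have b1 n : b n < 1 by rewrite /b ltrBlDr ltrDl invr_gt0.
have b0 n : 0 <= b n by rewrite subr_ge0 invf_le1 ?ler1n.
pose A n : set R := `[0, b n]%classic.
have At n t : A n t -> 0 <= t /\ t < 1.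
  by rewrite /A/= in_itv/= => /andP[t0 tb]; split => //; exact: le_lt_trans (b1 n).
have m1 : measurable_fun setT (fun z : plane R => omega (rescale z.1 z.2)).
  by apply: (measurableT_comp _ measurable_rescale); apply: cont_meas; exact: continuous_omega.
have mA n : measurable_fun setT (fun z : plane R =>
    \1_(A n) z.1 * ((1 - z.1) `^ e * omega (rescale z.1 z.2))).
  apply: measurable_funM.
    by apply: (meas_fst (f := \1_(A n))); apply: measurable_indic; exact: measurable_itv.
  by apply: measurable_funM; [exact: measurable_onem_powR|exact: m1].
have d1 (t : R) : is_derive t 1 (fun t : R => 1 - t) (0 - 1) by repeat deriv1.
have cpow (e' t : R) : t < 1 -> {for t, continuous (fun t : R => (1 - t) `^ e')}.
  move=> t1; have s0 : 0 < 1 - t by rewrite subr_gt0.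
  have [+ _] := @dcomp R (fun s => s `^ e') _ t _ _ (dpowR e' s0) (d1 t).
  by move=> /derivable1_diffP/differentiable_continuous.
have iA n : L1 mu (fun t => \1_(A n) t * (1 - t) `^ e).
  by apply: L1_itv => t /andP[t0 tb]; apply: cpow; exact: le_lt_trans (b1 n).
have i2 n : L1 (leb2 R) (fun z => \1_(A n) z.1 * ((1 - z.1) `^ e * omega (rescale z.1 z.2))).
  apply: (@L1_prod _ _ _ _ _ mu mu _ (fun t => \1_(A n) t * (1 - t) `^ e) omega) => //.
    exact: L1_omega.
  move=> t x /=; have [h|h] := pselect (A n t); last first.
    by rewrite (indic_notin h) !mul0r normr0.
  have [t0 t1] := At _ _ h.
  rewrite (indic_in h) !mul1r ger0_norm ?mulr_ge0 ?powR_ge0// ?(ltW (omega_gt0 _))//.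
  by rewrite ler_wpM2l ?powR_ge0// le_omega// le_rescale.
apply: (@L1_fatou _ _ _ (leb2 R) (fun n (z : plane R) =>
    \1_(A n) z.1 * ((1 - z.1) `^ e * omega (rescale z.1 z.2))) _ (I * (e + 3 / 2)^-1)) => //.
- by move=> n z; rewrite mulr_ge0 ?indicE// mulr_ge0 ?powR_ge0// ltW// omega_gt0.
- move=> [t x] /=; apply: cvgM; last exact: cvg_cst.
  apply: cvg_near_cst; have [h|h] := pselect (`[0, 1[%classic t); last first.
    near=> n; rewrite !indic_notin// => /At[t0 t1]; apply: h.
    by rewrite /= in_itv/= t0.
  move: (h); rewrite /= in_itv/= => /andP[t0 t1].
  have s0 : 0 < 1 - t by rewrite subr_gt0.
  near=> n; rewrite !indic_in// /A/= in_itv/= t0/= /b lerBrDr -lerBrDl.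
  by rewrite ltW//; near: n; exact: (near_infty_natSinv_lt (PosNum s0)).
- move=> n; rewrite -(Rint_fubini1 (i2 n)).
  pose F (t : R) := - (e + 3 / 2)^-1 * (1 - t) `^ (e + 3 / 2).
  have E t : \int[mu]_x (\1_(A n) t * ((1 - t) `^ e * omega (rescale t x))) =
      I * (\1_(A n) t * (1 - t) `^ (e + 2^-1)).
    have [h|h] := pselect (A n t); last first.
      rewrite (indic_notin h) mul0r mulr0 -[RHS](Rint0 mu).
      by apply: eq_Rint => x; rewrite mul0r.
    have [t0 t1] := At _ _ h; have s0 : 0 < 1 - t by rewrite subr_gt0.
    rewrite (indic_in h) (@eq_Rint _ _ _ mu _ (fun x => (1 - t) `^ e * omega (rescale t x))); last first.
      by move=> x; rewrite mul1r.
    rewrite RintZ.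
      have -> : (1 - t) `^ (e + 2^-1) = (1 - t) `^ e * Num.sqrt (1 - t).
        rewrite powRD ?powR12_sqrt ?(ltW s0)//.
        by apply/implyP => _; rewrite gt_eqF.
      by rewrite Rint_rescale//; ring.
    apply: (@L1_om _ _ 1) => [|x].
      move=> x; apply: (cvg_comp (rescale t) omega); last exact: continuous_omega.
      by apply: cvgM; [exact: cvg_cst|exact: cvg_id].
    by rewrite mul1r ger0_norm ?(ltW (omega_gt0 _))// le_omega// le_rescale.
  rewrite (@eq_Rint _ _ _ mu _ _ E) RintZ; last first.
    by apply: L1_itv => t /andP[t0 tb]; apply: cpow; exact: le_lt_trans (b1 n).
  rewrite ler_wpM2l// -Rint_set.
  have dF (t : R) : 0 <= t <= b n -> is_derive t 1 F ((1 - t) `^ (e + 2^-1)).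
    move=> /andP[t0 tb]; have s0 : 0 < 1 - t by rewrite subr_gt0 (le_lt_trans tb).
    have d2 := @dcomp R (fun s => s `^ (e + 3 / 2)) _ t _ _ (dpowR (e + 3 / 2) s0) (d1 t).
    rewrite /F; deriv_with ltac:(exact: d2).
    rewrite (_ : e + 3 / 2 - 1 = e + 2^-1); last by field.
    by field; rewrite gt_eqF//; lra.
  rewrite (FTC2_in (b0 n) dF); last first.
    by move=> t /andP[t0 tb]; apply: cpow; exact: le_lt_trans (b1 n).
  rewrite /F subr0 powR1 mulr1 opprK mulNr gerDr oppr_le0 mulr_ge0 ?powR_ge0//.
  by rewrite invr_ge0 ltW.
Unshelve. all: by end_near. Qed.

End parabolic_weight.

Section barrier.
Context {R : realType}.
Notation mu := (@lebesgue_measure R).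

Lemma eta_parts (k x C : R) (H H1 H2 : R -> R) : 0 < k ->
  (forall y : R, is_derive y 1 H (H1 y)) -> (forall y : R, is_derive y 1 H1 (H2 y)) ->
  continuous H2 -> (forall y, `|H y| <= C * omega y) -> (forall y, `|H1 y| <= C * omega y) ->
  (forall y, `|H2 y| <= C * omega y) ->
  \int[mu]_y (deta2 k x y * H y) = \int[mu]_y (eta k x y * H2 y).
Proof.
move=> k0 dH dH1 cH2 bH bH1 bH2.
have C0 : 0 <= C.
  by have := le_trans (normr_ge0 _) (bH 0); rewrite pmulr_lge0// omega_gt0.
have [P EP] := deta2_pgauss k x.
have [C1 C10 b1] := eta_om x k0.
have [C2 C20 b2] : exists2 C, 0 <= C & forall y, `|deta k x y| <= C * omega y.
  by rewrite deta_pgauss; exact: pgauss_om.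
have [C3 C30 b3] : exists2 C, 0 <= C & forall y, `|deta2 k x y| <= C * omega y.
  by rewrite EP; exact: pgauss_om.
have d1 (y : R) : is_derive y 1 (eta k x) (deta k x y) by exact: dEta.
have d2 (y : R) : is_derive y 1 (deta k x) (deta2 k x y).
  rewrite {1}deta_pgauss EP.
  have E : deta2 k x = pgauss P k x := EP.
  rewrite -E /deta2 deta_pgauss (derive1_is_derive (dpgauss _ k x)); exact: dpgauss.
have cp (f g : R -> R) c1 : continuous f -> continuous g -> (forall y, `|f y| <= c1 * omega y) ->
    (forall y, `|g y| <= C * omega y) ->
    continuous (fun y => f y * g y) /\ forall y, `|f y * g y| <= (c1 * C) * omega y.
  move=> cf cg bf bg; split => [y|y]; first by apply: cvgM; [exact: cf|exact: cg].
  rewrite normrM (le_trans (ler_pM _ _ (bf y) (bg y)))//.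
  have c10 : 0 <= c1.
    by have := le_trans (normr_ge0 _) (bf 0); rewrite pmulr_lge0// omega_gt0.
  have w0 : 0 <= omega y by rewrite ltW// omega_gt0.
  rewrite [leLHS](_ : _ = (c1 * C * omega y) * omega y); last by ring.
  by rewrite ler_piMr ?omega_le1// !mulr_ge0.
have ceta := is_derive_continuous d1; have cdeta := is_derive_continuous d2.
have cdeta2 : continuous (deta2 k x) by rewrite EP; exact: cont_pgauss.
have cH := is_derive_continuous dH; have cH1 := is_derive_continuous dH1.
have [ca ba] := cp _ _ _ cdeta2 cH b3 bH; have [cb bb] := cp _ _ _ ceta cH2 b1 bH2.
have [_ bc] := cp _ _ _ cdeta cH b2 bH; have [_ bd] := cp _ _ _ ceta cH1 b1 bH1.
have ia := L1_om ca ba; have ib := L1_om cb bb.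
have d (y : R) : is_derive y 1 (fun y => deta k x y * H y - eta k x y * H1 y)
    (deta2 k x y * H y - eta k x y * H2 y).
  by deriv_with ltac:(first [exact: d1|exact: d2|exact: dH|exact: dH1]); ring.
have c : continuous (fun y => deta2 k x y * H y - eta k x y * H2 y).
  by move=> y; apply: cvgB; [exact: ca|exact: cb].
have bF y : `|deta k x y * H y - eta k x y * H1 y| <= (C2 * C + C1 * C) * omega y.
  by rewrite (le_trans (ler_normB _ _))// [leRHS]mulrDl lerD.
have := Rint_derive0 d c (L1B ia ib) bF; rewrite (RintB ia ib).
by move=> /eqP; rewrite subr_eq0 => /eqP.
Qed.

Variables (g : R) (g01 : 0 < g < 1) (h h1 h2 cf : R -> R) (al Ch : R).
Hypotheses (dh : forall y : R, is_derive y 1 h (h1 y))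
  (dh1 : forall y : R, is_derive y 1 h1 (h2 y)) (ch2 : continuous h2)
  (ode : forall y, cf y * h2 y = - (g / 2) * h y - y / 2 * h1 y)
  (h_gt0 : forall y, 0 < h y) (Ch0 : 0 <= Ch)
  (hb : forall y, [/\ `|h y| <= Ch * omega y ^+ 3, `|h1 y| <= Ch * omega y ^+ 3 &
      `|h2 y| <= Ch * omega y ^+ 3])
  (mcf : measurable_fun setT (cf : measurableTypeR R -> R))
  (cf1 : forall y, 1 <= cf y <= al).

Let nu := - (g / 2) - 1.
Let sw (t : R) : R := (1 - t) `^ nu.

(* [V(t, x) = s^(- g / 2) h(x / sqrt s)], [s = 1 - t]; the power of [s] is split so that
   [s^(- g / 2 - 1)] is the factor of both [V_t] and [V_xx]. *)
Definition barrier (t x : R) : R := (1 - t) * (1 - t) `^ (- (g / 2) - 1) * h (rescale t x).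
Let V := barrier.
(** By [dV_t] this is [- V_t], and by [ode] it is [a V_xx]. *)
Let Vq (t x : R) : R := sw t * (- (g / 2) * h (rescale t x) - rescale t x / 2 * h1 (rescale t x)).
(** The cut-off vanishes at [t = 1 - d], which is the condition [th T = 0] of [weak_identity]. *)
Let Th d t x := (1 - d / (1 - t)) * V t x.
Let Tht d t x := (1 - d / (1 - t)) * - Vq t x - d / (1 - t) ^+ 2 * V t x.
Let Thx d t x := (1 - d / (1 - t)) * (Num.sqrt (1 - t) * sw t * h1 (rescale t x)).
Let Thxx d t x := (1 - d / (1 - t)) * (sw t * h2 (rescale t x)).

Let d1B (t : R) : is_derive t 1 (fun t : R => 1 - t) (- 1).
Proof. by deriv; ring. Qed.

Let dsw (t : R) : t < 1 -> is_derive t 1 sw (- nu * sw t / (1 - t)).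
Proof.
move=> t1; have s0 : 0 < 1 - t by rewrite subr_gt0.
have := @dcomp R (fun s => s `^ nu) _ t _ _ (dpowR nu s0) (d1B t).
rewrite /sw => H; notypeclasses refine (@is_derive_eq _ _ _ _ _ _ _ _ H _).
rewrite powRB ?powRr1 ?(ltW s0)//; last by apply/implyP => _; rewrite gt_eqF.
by ring.
Qed.

Let dresc_t (t x : R) : t < 1 -> is_derive t 1 (rescale^~ x) (rescale t x / (2 * (1 - t))).
Proof.
move=> t1; have s0 : 0 < 1 - t by rewrite subr_gt0.
have r0 : Num.sqrt (1 - t) != 0 by rewrite gt_eqF// sqrtr_gt0.
have e1 := @dsqrt R (fun t => 1 - t) t _ s0 (d1B t).
have e2 := @dinv R (fun t => Num.sqrt (1 - t)) t _ r0 e1.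
rewrite /rescale; deriv_with ltac:(exact: e2).
have r2 := sqr_sqrtr (ltW s0); set r := Num.sqrt _ in r0 r2 *.
by rewrite -r2; field.
Qed.

Let dresc_x (t x : R) : is_derive x 1 (rescale t) (Num.sqrt (1 - t))^-1.
Proof. by rewrite /rescale; deriv; ring. Qed.

Let dh_t (t x : R) : t < 1 -> is_derive t 1 (fun t => h (rescale t x))
  (h1 (rescale t x) * (rescale t x / (2 * (1 - t)))).
Proof. by move=> t1; exact: (@dcomp R h (rescale^~ x) t _ _ (dh _) (dresc_t x t1)). Qed.

Let dh1_t (t x : R) : t < 1 -> is_derive t 1 (fun t => h1 (rescale t x))
  (h2 (rescale t x) * (rescale t x / (2 * (1 - t)))).
Proof. by move=> t1; exact: (@dcomp R h1 (rescale^~ x) t _ _ (dh1 _) (dresc_t x t1)). Qed.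

Let dV_t (t x : R) : t < 1 -> is_derive t 1 (V^~ x) (- Vq t x).
Proof.
move=> t1; have s0 : 1 - t != 0 by rewrite gt_eqF// subr_gt0.
have e1 := dsw t1; have e2 := dh_t x t1.
rewrite /V /barrier -/(sw t).
have e3 : is_derive t 1 (fun t => (1 - t) `^ (- (g / 2) - 1)) (- nu * sw t / (1 - t)) := e1.
by deriv_with ltac:(first [exact: e3|exact: e2]); rewrite -/(sw t) /Vq /nu; field.
Qed.

Let dinvB (t : R) : t < 1 -> is_derive t 1 (fun t => (1 - t)^-1) ((1 - t) ^- 2).
Proof.
move=> t1; have s0 : 1 - t != 0 by rewrite gt_eqF// subr_gt0.
by have := @dinv R (fun t => 1 - t) t _ s0 (d1B t); rewrite mulrN1 opprK.
Qed.

Let dTh_t d (t x : R) : t < 1 -> is_derive t 1 (Th d ^~ x) (Tht d t x).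
Proof.
move=> t1; have s0 : 1 - t != 0 by rewrite gt_eqF// subr_gt0.
have e1 := dV_t x t1; have e2 := dinvB t1.
rewrite /Th; deriv_with ltac:(first [exact: e1|exact: e2]).
by rewrite /Tht; field.
Qed.

Let cTht_t d (t x : R) : t < 1 -> {for t, continuous (Tht d ^~ x)}.
Proof.
move=> t1; have e1 := dV_t x t1; have e2 := dinvB t1; have e3 := dsw t1.
have e4 := dh_t x t1; have e5 := dh1_t x t1; have e6 := dresc_t x t1.
suff [l [+ _]] : exists l, is_derive t 1 (Tht d ^~ x) l.
  by move=> /derivable1_diffP/differentiable_continuous.
have -> : Tht d ^~ x = (fun t => (1 - d * (1 - t)^-1) *
   - (sw t * (- (g / 2) * h (rescale t x) - rescale t x * 2^-1 * h1 (rescale t x)))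
   - d * (1 - t)^-1 ^+ 2 * V t x).
  by apply/funext => {e1 e2 e3 e4 e5 e6}t'; rewrite /Tht /Vq exprVn.
by eexists; repeat first [exact: e1|exact: e2|exact: e3|exact: e4|exact: e5|exact: e6|deriv1].
Qed.

Let dTh_x d (t x : R) : t < 1 -> is_derive x 1 (Th d t) (Thx d t x).
Proof.
move=> t1; have s0 : 0 < 1 - t by rewrite subr_gt0.
have r0 : Num.sqrt (1 - t) != 0 by rewrite gt_eqF// sqrtr_gt0.
have e1 := @dcomp R h (rescale t) x _ _ (dh _) (dresc_x t x).
rewrite /Th /V /barrier; deriv_with ltac:(exact: e1).
rewrite /Thx -/nu -/(sw t).
transitivity ((1 - d / (1 - t)) * (Num.sqrt (1 - t) ^+ 2 * sw t * (h1 (rescale t x) / Num.sqrt (1 - t)))).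
  by rewrite (sqr_sqrtr (ltW s0)); ring.
by congr (_ * _); field.
Qed.

Let dThx_x d (t x : R) : t < 1 -> is_derive x 1 (Thx d t) (Thxx d t x).
Proof.
move=> t1; have s0 : 0 < 1 - t by rewrite subr_gt0.
have r0 : Num.sqrt (1 - t) != 0 by rewrite gt_eqF// sqrtr_gt0.
have e1 := @dcomp R h1 (rescale t) x _ _ (dh1 _) (dresc_x t x).
rewrite /Thx; deriv_with ltac:(exact: e1).
rewrite /Thxx !mul0r ?add0r.
by rewrite -/nu -/(sw t); move: (1 - d / (1 - t)) => X; field.
Qed.

Section fixed_delta.
Variables (d : R) (d01 : 0 < d < 1).
Let T := 1 - d.
Let d0 : 0 < d. Proof. by case/andP: d01. Qed.

(** For [s >= d], the factor [d^(- g / 2 - 1)] bounds the same power of [s], and [d^-1] bounds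
    [d / s^2], the derivative of the cut-off up to sign. *)
Definition barrier_const : R :=
  (1 + d^-1) * (d `^ (- (g / 2) - 1) * (al * Ch)).
Let K := barrier_const.

Let tT (t : R) : 0 <= t <= T -> [/\ 0 <= t, t < 1, d <= 1 - t & 1 - t <= 1].
Proof. by rewrite /T => /andP[t0 t1]; have := d0; split; lra. Qed.

Let al1 : 1 <= al. Proof. by have /andP[] := cf1 0; exact: le_trans. Qed.

Let sw_le t : 0 <= t <= T -> sw t <= d `^ nu.
Proof.
move=> /tT[t0 t1 ds s1]; have s0 : 0 < 1 - t by rewrite subr_gt0.
rewrite /sw -[nu]opprK powRN [leRHS]powRN lef_pV2 ?posrE ?powR_gt0//.
apply: ge0_ler_powR; rewrite ?nnegrE ?(ltW s0) ?(ltW d0)// /nu.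
by case/andP: g01 => ? ?; lra.
Qed.

Let sw0 t : 0 <= sw t. Proof. exact: powR_ge0. Qed.

Let om_h t x : 0 <= t <= T -> omega (rescale t x) ^+ 3 <= omega x ^+ 2.
Proof.
move=> /tT[t0 t1 _ _]; have wy := omega_gt0 (rescale t x).
have H : omega (rescale t x) <= omega x by rewrite le_omega// le_rescale.
rewrite exprS (@le_trans _ _ (omega (rescale t x) ^+ 2))//.
  by rewrite ler_piMl ?omega_le1// exprn_ge0// ltW.
by rewrite lerXn2r ?nnegrE// ltW// omega_gt0.
Qed.

Let chi t : 0 <= t <= T -> 0 <= 1 - d / (1 - t) <= 1.
Proof.
move=> /tT[t0 t1 ds s1]; have s0 : 0 < 1 - t by rewrite subr_gt0.
rewrite subr_ge0 ler_pdivrMr// mul1r ds/= gerBl divr_ge0 ?ltW//.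
Qed.

Let w20 (x : R) : 0 <= omega x ^+ 2. Proof. exact: sqr_ge0. Qed.

Let bchi t a b : 0 <= t <= T -> `|a| <= b -> `|(1 - d / (1 - t)) * a| <= b.
Proof.
move=> /chi/andP[c0 c1] ab; rewrite normrM ger0_norm// (le_trans _ ab)//.
by rewrite ler_piMl.
Qed.

Let bprod t y c x : 0 <= t <= T -> 0 <= c -> `|y| <= c * Ch * omega (rescale t x) ^+ 3 ->
  `|sw t * y| <= d `^ nu * (c * Ch) * omega x ^+ 2.
Proof.
move=> tt c0 yc; rewrite normrM ger0_norm// -mulrA ler_pM// ?sw_le//.
by rewrite (le_trans yc)// ler_wpM2l ?om_h// mulr_ge0.
Qed.

Let alCh : 1 * Ch <= al * Ch. Proof. by rewrite ler_wpM2r. Qed.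

Let leK (c x : R) : 0 <= c <= al -> d `^ nu * (c * Ch) * omega x ^+ 2 <= K * omega x ^+ 2.
Proof.
move=> /andP[c0 ca]; rewrite ler_wpM2r// /K /barrier_const -/nu.
apply: (@le_trans _ _ (d `^ nu * (al * Ch))).
  by rewrite ler_wpM2l ?powR_ge0// ler_wpM2r.
by rewrite ler_peMl ?mulr_ge0 ?powR_ge0 ?(le_trans ler01 al1)// lerDl invr_ge0 ltW.
Qed.

Let bV t x : 0 <= t <= T -> `|V t x| <= d `^ nu * (1 * Ch) * omega x ^+ 2.
Proof.
move=> tt; have [t0 t1 ds s1] := tT tt; have [hh _ _] := hb (rescale t x).
rewrite /V /barrier -/nu -/(sw t) -mulrA normrM ger0_norm ?subr_ge0 ?(ltW t1)//.
apply: (@le_trans _ _ `|sw t * h (rescale t x)|); first by rewrite ler_piMl.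
by apply: bprod => //; rewrite mul1r.
Qed.

Let bTh t x : 0 <= t <= T -> `|Th d t x| <= K * omega x ^+ 2.
Proof.
by move=> tt; apply: bchi => //; apply: le_trans (bV x tt) (leK _ _); rewrite ler01.
Qed.

Let bTht t x : 0 <= t <= T -> `|Tht d t x| <= K * omega x ^+ 2.
Proof.
move=> tt; have [t0 t1 ds s1] := tT tt; have [_ _ hh] := hb (rescale t x).
have s0 : 0 < 1 - t by rewrite subr_gt0.
rewrite (le_trans (ler_normB _ _))//.
rewrite (_ : K * omega x ^+ 2 = d `^ nu * (al * Ch) * omega x ^+ 2 +
    d^-1 * (d `^ nu * (al * Ch)) * omega x ^+ 2); last by rewrite /K /barrier_const -/nu; ring.
rewrite lerD//.
  apply: bchi => //; rewrite normrN /Vq -ode.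
  apply: bprod => //; first exact: le_trans al1.
  have /andP[c1 c2] := cf1 (rescale t x).
  by rewrite normrM -mulrA ler_pM// ger0_norm// (le_trans ler01).
rewrite normrM -[leRHS]mulrA; apply: ler_pM => //.
  rewrite ger0_norm ?divr_ge0 ?sqr_ge0 ?(ltW d0)//.
  rewrite ler_pdivrMr ?exprn_gt0// -ler_pdivrMl ?invr_gt0// invrK -expr2.
  by rewrite lerXn2r ?nnegrE ?(ltW s0) ?(ltW d0).
apply: le_trans (bV x tt) _.
by apply: ler_wpM2r => //; apply: ler_wpM2l => //; exact: powR_ge0.
Qed.

Let bThxx t x : 0 <= t <= T -> `|Thxx d t x| <= K * omega x ^+ 2.
Proof.
move=> tt; have [_ _ hh] := hb (rescale t x); apply: bchi => //.
apply: le_trans (leK (c := 1) _ _); last by rewrite ler01.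
by apply: bprod => //; rewrite mul1r.
Qed.

Let bThx t x : 0 <= t <= T -> `|Thx d t x| <= K * omega x ^+ 2.
Proof.
move=> tt; have [t0 t1 ds s1] := tT tt; have [_ hh _] := hb (rescale t x); apply: bchi => //.
apply: le_trans (leK (c := 1) _ _); last by rewrite ler01.
rewrite -mulrA normrM ger0_norm ?sqrtr_ge0//.
apply: (@le_trans _ _ `|sw t * h1 (rescale t x)|).
  by rewrite ler_piMl// -[leRHS]sqrtr1 ler_wsqrtr.
by apply: bprod => //; rewrite mul1r.
Qed.

Let A t x := ind T t * Th d t x.
Let B t x := ind T t * Tht d t x.
Let D t x := ind T t * Thxx d t x.

Let bind (F : R -> R -> R) : (forall t x, 0 <= t <= T -> `|F t x| <= K * omega x ^+ 2) ->
  forall t x, `|ind T t * F t x| <= K * ind T t * omega x ^+ 2.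
Proof.
move=> bF t x; have [[/andP[t0 tT'] ->]|[_ ->]]   := ind_cases T t.
  by rewrite mul1r mulr1 bF// (ltW t0).
by rewrite mul0r normr0 mulr0 mul0r.
Qed.

Let mj : measurable_fun setT (fun z : plane R => ind T z.1 * (1 - z.1)^-1).
Proof. by apply: measurable_ind_inv; rewrite /T; have := d0; lra. Qed.

Let mresc (f : R -> R) : continuous f ->
  measurable_fun setT (fun z : plane R => f (rescale z.1 z.2)).
Proof. by move=> cf_; exact: (measurableT_comp (cont_meas cf_) measurable_rescale). Qed.

Let msw : measurable_fun setT (fun z : plane R => sw z.1).
Proof. exact: measurable_onem_powR. Qed.

Let mV : measurable_fun setT (fun z : plane R => V z.1 z.2).
Proof.
apply: measurable_funM; last exact: (mresc (is_derive_continuous dh)).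
apply: measurable_funM; last exact: measurable_onem_powR.
apply: (meas_fst (f := fun t : measurableTypeR R => 1 - t)).
by apply: cont_meas; exact: is_derive_continuous d1B.
Qed.

Let mVq : measurable_fun setT (fun z : plane R => Vq z.1 z.2).
Proof.
apply: measurable_funM; first exact: msw.
apply: (mresc (f := fun y => - (g / 2) * h y - y / 2 * h1 y)).
by apply: is_derive_continuous => y; repeat first [exact: dh|exact: dh1|deriv1].
Qed.

Let mA : measurable_fun setT (fun z : plane R => A z.1 z.2).
Proof.
have -> : (fun z : plane R => A z.1 z.2) =
    (fun z : plane R => (ind T z.1 - d * (ind T z.1 * (1 - z.1)^-1)) * V z.1 z.2).
  by apply/funext => z; rewrite /A /Th; ring.
apply: measurable_funM; last exact: mV.
by apply: measurable_funB; [exact: measurable_ind|apply: measurable_funM => //; exact: mj].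
Qed.

Let mB : measurable_fun setT (fun z : plane R => B z.1 z.2).
Proof.
have -> : (fun z : plane R => B z.1 z.2) =
    (fun z : plane R => (ind T z.1 - d * (ind T z.1 * (1 - z.1)^-1)) * - Vq z.1 z.2 -
      d * ((ind T z.1 * (1 - z.1)^-1) * (ind T z.1 * (1 - z.1)^-1)) * V z.1 z.2).
  apply/funext => z; rewrite /B /Tht expr2 invfM.
  by have [[_ ->]|[_ ->]] := ind_cases T z.1; ring.
apply: measurable_funB.
  apply: measurable_funM; last by apply: measurableT_comp => //; exact: mVq.
  by apply: measurable_funB; [exact: measurable_ind|apply: measurable_funM => //; exact: mj].
apply: measurable_funM; last exact: mV.
by apply: measurable_funM => //; apply: measurable_funM; exact: mj.
Qed.

Let cresc (f : R -> R) t : continuous f -> continuous (fun x => f (rescale t x)).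
Proof.
move=> cf_ x; apply: (cvg_comp (rescale t) f); last exact: cf_.
exact: is_derive_continuous (dresc_x t) x.
Qed.

Let cB t : continuous (B t).
Proof.
exact: is_derive_continuous.
Qed.

Let cD t : continuous (D t).
Proof.
move=> x; do 3 (apply: cvgM; first exact: cvg_cst).
exact: cresc.
Qed.

Let parts k t x : 0 < k ->
  \int[mu]_y (deta2 k x y * A t y) = \int[mu]_y (eta k x y * D t y).
Proof.
move=> k0; rewrite /A /D; have [[/andP[t0 t1] ->]|[_ ->]] := ind_cases T t; last first.
  by apply: eq_Rint => y; rewrite !mul0r !mulr0.
have tt : 0 <= t <= T by rewrite (ltW t0).
have [_ t_lt1 _ _] := tT tt.
rewrite (@eq_Rint _ _ _ mu _ (fun y => deta2 k x y * Th d t y)); last by move=> y; rewrite mul1r.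
rewrite [RHS](@eq_Rint _ _ _ mu _ (fun y => eta k x y * Thxx d t y)); last by move=> y; rewrite mul1r.
have w1 c y : c <= K * omega y ^+ 2 -> c <= K * omega y.
  move=> /le_trans; apply; have K0 : 0 <= K.
    rewrite /K /barrier_const mulr_ge0 ?addr_ge0 ?invr_ge0 ?(ltW d0)//.
    by rewrite !mulr_ge0 ?powR_ge0// (le_trans ler01 al1).
  by rewrite ler_wpM2l// expr2 ler_piMl ?omega_le1// ltW// omega_gt0.
apply: (@eta_parts k x K (Th d t) (Thx d t)) => // [y|y||y|y|y].
- exact: dTh_x.
- exact: dThx_x.
- by move=> y; apply: cvgM; [exact: cvg_cst|apply: cvgM; [exact: cvg_cst|exact: cresc]].
- exact/w1/bTh.
- exact/w1/bThx.
- exact/w1/bThxx.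
Qed.

Variables (p : R) (p1 : 1 <= p) (v : plane R -> R) (vp : LpR2 p v) (kap c : R) (kap0 : 0 < kap).
Let a (z : plane R) : R := cf (rescale z.1 z.2).
Hypothesis weak : forall (k y : R) (th dth : R -> R) (M : R), 0 < k ->
  (forall t : R, 0 <= t <= T -> is_derive t 1 th (dth t)) ->
  (forall t : R, 0 <= t <= T -> {for t, continuous dth}) ->
  th T = 0 -> (forall t, 0 <= t <= T -> `|th t| <= M) ->
  (forall t, 0 <= t <= T -> `|dth t| <= M) ->
  \int[leb2 R]_z (v z * (ind T z.1 * dth z.1 * eta k y z.2)) +
  \int[leb2 R]_z (v z * (a z * (ind T z.1 * th z.1) * deta2 k y z.2)) =
  c * skernel ((4 * k)^-1 + kap) y * \int[mu]_t (ind T t * th t).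

(** In [Tht + a * Thxx] the two multiples of [Vq] cancel. What is left is the derivative of the
    cut-off times [V], where the factor [1 - t] of [V] lowers the power [(1 - t) ^- 2] by one. *)
Lemma barrier_identity :
  \int[leb2 R]_z (v z * (ind T z.1 * (- (d / (1 - z.1)) *
    ((1 - z.1) `^ (- (g / 2) - 1) * h (rescale z.1 z.2))))) =
  c * \int[leb2 R]_z (skernel kap z.2 * (ind T z.1 * ((1 - d / (1 - z.1)) * barrier z.1 z.2))).
Proof.
have K0 : 0 <= K.
  rewrite /K /barrier_const mulr_ge0 ?addr_ge0 ?invr_ge0 ?(ltW d0)//.
  by rewrite !mulr_ge0 ?powR_ge0// (le_trans ler01 al1).
have ma : measurable_fun setT a by exact: (measurableT_comp mcf measurable_rescale).
have aK z : `|a z| <= al.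
  by have /andP[c1 c2] := cf1 (rescale z.1 z.2); rewrite ger0_norm// (le_trans ler01).
have T1 : T <= 1 by rewrite /T gerBl ltW.
have idt k y : 0 < k ->
  \int[leb2 R]_z (v z * (B z.1 y * eta k y z.2)) +
  \int[leb2 R]_z (v z * (a z * A z.1 y * deta2 k y z.2)) =
  c * skernel ((4 * k)^-1 + kap) y * \int[mu]_t A t y.
  move=> k0; apply: (@weak k y (Th d ^~ y) (Tht d ^~ y) K) => // [t /tT[_ t1 _ _]|t /tT[_ t1 _ _]||t tt|t tt].
  - exact: dTh_t.
  - exact: cTht_t.
  - by rewrite /Th /T opprB addrCA subrr addr0 divff ?gt_eqF// subrr mul0r.
  - by apply: le_trans (bTh y tt) _; rewrite ler_piMr// exprn_ile1 ?omega_le1// ltW// omega_gt0.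
  - by apply: le_trans (bTht y tt) _; rewrite ler_piMr// exprn_ile1 ?omega_le1// ltW// omega_gt0.
have := mollified_limit p1 vp ma aK T1 K0 mA mB (bind bTh) (bind bTht) (bind bThxx)
  cB cD parts kap0 idt.
move=> <-; apply: eq_Rint => -[t x] /=; congr (_ * _).
rewrite /B /D /Tht /Thxx /a /=; have [[/andP[t0 t1] ->]|[_ ->]] := ind_cases T t; last by ring.
have s0 : 1 - t != 0.
  by rewrite gt_eqF// subr_gt0; have := d0; move: t1; rewrite /T; lra.
rewrite /Vq -ode /V /barrier -/nu -/(sw t).
by field.
Qed.

End fixed_delta.
End barrier.

(** * The limit at the singular time, and positivity *)

Section barrier_limit.
Context {R : realType}.
Notation mu := (@lebesgue_measure R).
Variables (g : R) (g01 : 0 < g < 1) (h : R -> R) (Ch : R).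
Hypotheses (ch : continuous h) (h_gt0 : forall y, 0 < h y) (Ch0 : 0 <= Ch)
  (hb : forall y, `|h y| <= Ch * omega y ^+ 3).

Let nu : R := - (g / 2) - 1.
(** This is [V / s]. *)
Let E (z : plane R) : R := (1 - z.1) `^ nu * h (rescale z.1 z.2).
Let E1 (z : plane R) : R := \1_(`[0, 1[%classic : set R) z.1 * E z.
Let iV (z : plane R) : R := \1_(`]0, 1[%classic : set R) z.1 * barrier g h z.1 z.2.

Let w0 (x : R) : 0 <= omega x. Proof. by rewrite ltW// omega_gt0. Qed.

Let w31 (x : R) : omega x ^+ 3 <= omega x.
Proof. by rewrite exprS ler_piMr// exprn_ile1// omega_le1. Qed.

Let E0 z : 0 <= E z. Proof. by rewrite mulr_ge0 ?powR_ge0// ltW. Qed.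

Let E10 z : 0 <= E1 z. Proof. by rewrite mulr_ge0// indicE. Qed.

Let mE : measurable_fun setT E.
Proof.
apply: measurable_funM; first exact: measurable_onem_powR.
exact: (measurableT_comp (cont_meas ch) measurable_rescale).
Qed.

Let mE1 : measurable_fun setT E1.
Proof.
apply: measurable_funM; last exact: mE.
by apply: (meas_fst (f := \1_(`[0, 1[%classic : set R))); apply: measurable_indic; exact: measurable_itv.
Qed.

Let L1_E1 : L1 (leb2 R) E1.
Proof.
have e1 : - (3 / 2) < nu by rewrite /nu; case/andP: g01 => ? ?; lra.
apply: (@L1_dom _ _ _ (leb2 R) (fun z => Ch * (\1_(`[0, 1[%classic : set R) z.1 *
    ((1 - z.1) `^ nu * omega (rescale z.1 z.2))))); first exact: mE1.
  move=> z; rewrite ger0_norm// /E1 /E [leRHS]mulrCA; apply: ler_wpM2l; first by rewrite indicE.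
  rewrite [leRHS]mulrCA ler_wpM2l ?powR_ge0// (le_trans (ler_norm _))// (le_trans (hb _))//.
  by rewrite ler_wpM2l.
exact/L1Z/L1_parabolic.
Qed.

Let mbarrier : measurable_fun setT (fun z : plane R => barrier g h z.1 z.2).
Proof.
rewrite (_ : (fun z : plane R => barrier g h z.1 z.2) = (fun z => (1 - z.1) * E z)).
  apply: measurable_funM; last exact: mE.
  apply: (meas_fst (f := fun t : measurableTypeR R => 1 - t)).
  by apply: cont_meas => t; apply: cvgB; [exact: cvg_cst|exact: cvg_id].
by apply/funext => z; rewrite /barrier /E -/nu mulrA.
Qed.

Let miV : measurable_fun setT iV.
Proof.
apply: measurable_funM; last exact: mbarrier.
by apply: (meas_fst (f := \1_(`]0, 1[%classic : set R))); apply: measurable_indic; exact: measurable_itv.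
Qed.

Let iV_cases z : (0 < z.1 < 1 /\ iV z = (1 - z.1) * E1 z) \/ iV z = 0.
Proof.
rewrite /iV; have [H|H] := pselect (`]0, 1[%classic z.1); last by right; rewrite (indic_notin H) mul0r.
left; move: (H); rewrite /= in_itv/= => /andP[t0 t1]; split; first by rewrite t0.
rewrite (indic_in H) mul1r /E1 indic_in ?mul1r; last by rewrite /= in_itv/= (ltW t0).
by rewrite /barrier /E -/nu mulrA.
Qed.

Let iV0 z : 0 <= iV z.
Proof.
by have [[/andP[_ t1] ->]|->//] := iV_cases z; rewrite mulr_ge0// subr_ge0 ltW.
Qed.

Let iV_le z : iV z <= E1 z.
Proof.
have [[/andP[t0 t1] ->]|->//] := iV_cases z.
by rewrite ler_piMl// gerBl ltW.
Qed.

Let L1_iV : L1 (leb2 R) iV.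
Proof. by apply: L1_dom miV _ L1_E1 => z; rewrite ger0_norm. Qed.

Section limit.
Variables (p q : R) (p1 : 1 < p) (q1 : 1 < q) (pq : p^-1 + q^-1 = 1).
Hypothesis gq : - (3 / 2) < nu * q.
Variables (v : plane R -> R) (vp : LpR2 p v) (kap c : R) (kap0 : 0 < kap).
Hypothesis identity : forall d, 0 < d < 1 ->
  \int[leb2 R]_z (v z * (ind (1 - d) z.1 * (- (d / (1 - z.1)) *
    ((1 - z.1) `^ (- (g / 2) - 1) * h (rescale z.1 z.2))))) =
  c * \int[leb2 R]_z (skernel kap z.2 * (ind (1 - d) z.1 * ((1 - d / (1 - z.1)) * barrier g h z.1 z.2))).

(* Young's inequality; the exponent condition makes [E1] an element of L_q. *)
Let L1_vE : L1 (leb2 R) (fun z => `|v z| * E1 z).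
Proof.
have p0 : 0 < p by exact: lt_trans p1.
have q0 : 0 < q by exact: lt_trans q1.
apply: (@L1_dom _ _ _ (leb2 R) (fun z => p^-1 * (`|v z| `^ p) + (q^-1 * Ch `^ q) *
    (\1_(`[0, 1[%classic : set R) z.1 * ((1 - z.1) `^ (nu * q) * omega (rescale z.1 z.2))))).
- apply: measurable_funM; last exact: mE1.
  by apply: measurableT_comp => //; exact: (LpR2_meas vp).
- move=> z; rewrite ger0_norm; last by apply: mulr_ge0.
  apply: (le_trans (conjugate_powR (normr_ge0 _) (E10 z) p0 q0 pq)).
  rewrite mulrC lerD2l mulrC -mulrA ler_wpM2l ?invr_ge0 ?(ltW q0)// /E1.
  have [H|H] := pselect (`[0, 1[%classic z.1); last first.
    by rewrite !(indic_notin H) !mul0r mulr0 powR0// gt_eqF.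
  rewrite !(indic_in H) !mul1r /E.
  rewrite [in leLHS]powRM; [|exact: powR_ge0|exact: ltW].
  rewrite -powRrM mulrCA.
  rewrite ler_wpM2l ?powR_ge0//.
  set y := rescale _ _; have hy := hb y; rewrite ger0_norm ?(ltW (h_gt0 _))// in hy.
  apply: (@le_trans _ _ ((Ch * omega y ^+ 3) `^ q)).
    by apply: ge0_ler_powR; rewrite ?nnegrE ?(ltW q0) ?(ltW (h_gt0 _))// mulr_ge0// exprn_ge0.
  rewrite powRM ?exprn_ge0// ler_wpM2l ?powR_ge0// (le_trans _ (w31 y))//.
  by rewrite ge1r_powR ?(ltW q1)// exprn_gt0 ?omega_gt0//= exprn_ile1// omega_le1.
- have i1 := L1Z p^-1 (LpR2_L1p (ltW p1) vp).
  have i2 := L1Z (q^-1 * Ch `^ q) (L1_parabolic gq).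
  exact: (L1D i1 i2).
Qed.

(** The factor [1 / 2] keeps [d n < 1] also at [n = 0]. *)
Let d (n : nat) : R := 2^-1 * n.+1%:R^-1.

Let d01 n : 0 < d n < 1.
Proof.
rewrite mulr_gt0 ?invr_gt0//= /d; apply: (@le_lt_trans _ _ 2^-1); last by lra.
by rewrite ler_piMr// invf_le1 ?ler1n.
Qed.

Let cd : d n @[n --> \oo] --> (0 : R).
Proof.
have H : (n.+1%:R^-1 : R) @[n --> \oo] --> (0 : R) by exact: cvg_harmonic.
by have := cvgM (cvg_cst (2^-1 : R)) H; rewrite mulr0; exact.
Qed.

Let cind (t : R) : ind (1 - d n) t @[n --> \oo] --> (\1_(`]0, 1[%classic : set R) t : R).
Proof.
apply: cvg_near_cst; have [H|H] := pselect (`]0, 1[%classic t); last first.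
  near=> n; rewrite (indic_notin H); have [[/andP[t0 t1] _]|[_ ->//]] := ind_cases (1 - d n) t.
  by exfalso; apply: H; rewrite /= in_itv/= t0; have /andP[? _] := d01 n; lra.
move: (H); rewrite /= in_itv/= => /andP[t0 t1].
have s0 : 0 < 1 - t by rewrite subr_gt0.
near=> n; rewrite (indic_in H) /ind indic_in//= in_itv/= t0/=.
have : d n < 1 - t by near: n; exact: (cvgr_lt _ cd).
by lra.
Unshelve. all: by end_near. Qed.

Let mj n : measurable_fun setT (fun z : plane R => ind (1 - d n) z.1 * (1 - z.1)^-1).
Proof. by apply: measurable_ind_inv; have /andP[? _] := d01 n; lra. Qed.

Let dle n t : 0 < t <= 1 - d n -> 0 <= d n / (1 - t) <= 1.
Proof.
move=> /andP[t0 t1]; have /andP[d0 _] := d01 n; have s0 : 0 < 1 - t by lra.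
by rewrite divr_ge0 ?(ltW d0) ?(ltW s0)//= ler_pdivrMr// mul1r; lra.
Qed.

(** On the support of [ind (1 - d)] one has [d / (1 - t) <= 1]. So [|v| * E1] dominates the
    integrands on the left of [identity], which tend to [0] pointwise, and a multiple of [E1]
    dominates those on the right. *)
Lemma barrier_limit : c * \int[leb2 R]_z (skernel kap z.2 * iV z) = 0.
Proof.
pose K0 := \int[mu]_xi smoment kap 2 xi.
have mK : measurable_fun setT (fun z : plane R => skernel kap z.2).
  by apply: (meas_snd (f := skernel kap)); apply: cont_meas; exact: skernel_cont.
have l1 : \int[leb2 R]_z (v z * (ind (1 - d n) z.1 * (- (d n / (1 - z.1)) * E z))) @[n --> \oo] -->
    \int[leb2 R]_z (v z * (\1_(`]0, 1[%classic : set R) z.1 * (- (0 / (1 - z.1)) * E z))).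
  apply: (@Rint_dct _ _ _ (leb2 R)
     (fun n z => v z * (ind (1 - d n) z.1 * (- (d n / (1 - z.1)) * E z))) _ (fun z => `|v z| * E1 z)).
  - move=> n; apply: measurable_funM; first exact: (LpR2_meas vp).
    rewrite (_ : (fun z : plane R => _) = (fun z => (- d n) * (ind (1 - d n) z.1 * (1 - z.1)^-1) * E z)).
      by apply: measurable_funM; [apply: measurable_funM => //; exact: mj|exact: mE].
    by apply/funext => z; ring.
  - move=> z; apply: cvgM; first exact: cvg_cst.
    apply: cvgM; first exact: cind.
    apply: cvgM; last exact: cvg_cst.
    by apply: cvgN; apply: cvgM; [exact: cd|exact: cvg_cst].
  - exact: L1_vE.
  - move=> n z; rewrite normrM ler_wpM2l//.
    have [[tT ->]|[_ ->]] := ind_cases (1 - d n) z.1; last by rewrite mul0r normr0.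
    have /andP[e0 e1] := dle tT; rewrite mul1r normrM normrN !ger0_norm//.
    rewrite /E1 indic_in ?mul1r; first by rewrite ler_piMl.
    case/andP: tT => t0 t1; rewrite /= in_itv/= (ltW t0)/=.
    by have /andP[? _] := d01 n; lra.
have l2 : c * \int[leb2 R]_z (skernel kap z.2 * (ind (1 - d n) z.1 * ((1 - d n / (1 - z.1)) * barrier g h z.1 z.2))) @[n --> \oo] -->
    c * \int[leb2 R]_z (skernel kap z.2 * (\1_(`]0, 1[%classic : set R) z.1 * ((1 - 0 / (1 - z.1)) * barrier g h z.1 z.2))).
  apply: cvgM; first exact: cvg_cst.
  apply: (@Rint_dct _ _ _ (leb2 R)
     (fun n z => skernel kap z.2 * (ind (1 - d n) z.1 * ((1 - d n / (1 - z.1)) * barrier g h z.1 z.2))) _ (fun z => K0 * E1 z)).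
  - move=> n; apply: measurable_funM; first exact: mK.
    rewrite (_ : (fun z : plane R => _) =
      (fun z => (ind (1 - d n) z.1 - d n * (ind (1 - d n) z.1 * (1 - z.1)^-1)) * barrier g h z.1 z.2)).
      apply: measurable_funM; last exact: mbarrier.
      by apply: measurable_funB; [exact: measurable_ind|apply: measurable_funM => //; exact: mj].
    by apply/funext => z; ring.
  - move=> z; apply: cvgM; first exact: cvg_cst.
    apply: cvgM; first exact: cind.
    apply: cvgM; last exact: cvg_cst.
    by apply: cvgB; [exact: cvg_cst|apply: cvgM; [exact: cd|exact: cvg_cst]].
  - exact: (L1Z K0 L1_E1).
  - move=> n z; rewrite normrM ler_pM//; first exact: skernel_dom.
    have [[tT ->]|[_ ->]] := ind_cases (1 - d n) z.1; last by rewrite mul0r normr0.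
    have t01 : 0 < z.1 < 1.
      by case/andP: tT => t0 t1; rewrite t0/=; have /andP[? _] := d01 n; lra.
    have V0 : barrier g h z.1 z.2 = iV z by rewrite /iV indic_in ?mul1r//= in_itv.
    have /andP[e0 e1] := dle tT.
    rewrite mul1r V0 normrM ger0_norm ?subr_ge0// (ger0_norm (iV0 z)).
    by apply: (le_trans _ (iV_le z)); rewrite ler_piMl// gerBl.
have L0 : \int[leb2 R]_z (v z * (\1_(`]0, 1[%classic : set R) z.1 * (- (0 / (1 - z.1)) * E z))) = 0.
  rewrite -[RHS](Rint0 (leb2 R)); apply: eq_Rint => z.
  by rewrite mul0r oppr0 mul0r mulr0 mulr0.
rewrite L0 in l1.
have R0 : \int[leb2 R]_z (skernel kap z.2 * (\1_(`]0, 1[%classic : set R) z.1 * ((1 - 0 / (1 - z.1)) * barrier g h z.1 z.2))) =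
    \int[leb2 R]_z (skernel kap z.2 * iV z).
  by apply: eq_Rint => z; rewrite mul0r subr0 mul1r.
rewrite R0 in l2.
apply/esym; apply: cvg_unique l2; first exact: Rhausdorff.
apply: cvg_trans l1; apply: near_eq_cvg; near=> n.
by rewrite -(identity (d01 n)).
Unshelve. all: by end_near. Qed.

End limit.

(** In the similarity variable [x^2 = (1 - t) y^2], and [y ^+ 2 * omega y <= 1]. *)
Let L1_x2V : L1 (leb2 R) (fun z => z.2 ^+ 2 * iV z).
Proof.
have e1 : - (3 / 2) < nu by rewrite /nu; case/andP: g01 => ? ?; lra.
apply: (@L1_dom _ _ _ (leb2 R) (fun z => Ch * (\1_(`[0, 1[%classic : set R) z.1 *
    ((1 - z.1) `^ nu * omega (rescale z.1 z.2))))).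
- apply: measurable_funM; last exact: miV.
  apply: (meas_snd (f := fun x : measurableTypeR R => x ^+ 2)).
  by apply: cont_meas; apply: is_derive_continuous => x; repeat deriv1.
- move=> z; rewrite ger0_norm; last by apply: mulr_ge0; [exact: sqr_ge0|exact: iV0].
  have [[/andP[t0 t1] ->]|->] := iV_cases z; last first.
    by rewrite mulr0 !mulr_ge0 ?powR_ge0 ?indicE.
  have s0 : 0 < 1 - z.1 by rewrite subr_gt0.
  rewrite /E1 indic_in ?mul1r; last by rewrite /= in_itv/= (ltW t0).
  rewrite /E; set y := rescale _ _; have hy := hb y; rewrite ger0_norm ?(ltW (h_gt0 _))// in hy.
  have Ex : z.2 ^+ 2 = (1 - z.1) * y ^+ 2.
    rewrite /y /rescale exprMn exprVn sqr_sqrtr ?(ltW s0)//.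
    by field; rewrite gt_eqF.
  rewrite Ex [leRHS]mulrCA.
  rewrite [leLHS](_ : _ = (1 - z.1) `^ nu * ((1 - z.1) ^+ 2 * (y ^+ 2 * h y))); last by ring.
  rewrite ler_wpM2l ?powR_ge0//.
  apply: (@le_trans _ _ (y ^+ 2 * h y)).
    apply: ler_piMl; first by rewrite mulr_ge0 ?sqr_ge0 ?(ltW (h_gt0 _)).
    by apply: exprn_ile1; [exact: ltW|rewrite gerBl ltW].
  apply: (@le_trans _ _ (y ^+ 2 * (Ch * omega y ^+ 3))); first by rewrite ler_wpM2l ?sqr_ge0.
  rewrite [leLHS](_ : _ = (Ch * omega y) * (y ^+ 2 * omega y * omega y)); last by ring.
  have yw : y ^+ 2 * omega y <= 1.
    by rewrite /omega ler_pdivrMr ?ltr_wpDr ?sqr_ge0// mul1r lerDr.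
  apply: ler_piMr; first exact: mulr_ge0.
  by apply: mulr_ile1 => //; [apply: mulr_ge0; rewrite ?sqr_ge0|exact: omega_le1].
- exact/L1Z/L1_parabolic.
Qed.

Let Rint_iV_gt0 : 0 < \int[leb2 R]_z iV z.
Proof.
rewrite lt_neqAle Rint_ge0 ?andbT//; apply/negP => /eqP/esym Eq.
have [N [mN N0 sN]] := Rint_eq0 L1_iV iV0 Eq.
have m01 : measurable (`]0%R, 1%R[%classic : set (measurableTypeR R)) by exact: measurable_itv.
have : (leb2 R (`]0%R, 1%R[%classic `*` `]0%R, 1%R[%classic) <= leb2 R N)%E.
  apply: le_measure; rewrite ?inE//; first exact: measurableX.
  apply: subset_trans sN => -[t x] [/= tt _]; apply/eqP; rewrite /iV indic_in// mul1r.
  move: tt; rewrite /= in_itv/= => /andP[t0 t1].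
  by rewrite gt_eqF// /barrier !mulr_gt0 ?powR_gt0 ?subr_gt0.
have mu1 : mu (`]0%R, 1%R[%classic : set R) = 1%E.
  by rewrite lebesgue_measure_itv/= lte_fin ltr01 oppr0 adde0.
rewrite N0 product_measure1E// [X in (X * _)%E]mu1 [X in (_ * X)%E]mu1 mule1 lee_fin.
by rewrite ler10.
Qed.

(* [skernel kap y >= A - B y ^ 2 / 2] with [B / A = O(1 / kap)]. *)
Lemma barrier_positive : exists2 kap : R, 0 < kap & 0 < \int[leb2 R]_z (skernel kap z.2 * iV z).
Proof.
pose I := \int[leb2 R]_z iV z; have I0 : 0 < I := Rint_iV_gt0.
pose M := \int[leb2 R]_z (z.2 ^+ 2 * iV z).
have M0 : 0 <= M by apply: Rint_ge0 => z; rewrite mulr_ge0// sqr_ge0.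
(* This gives [kap * I = I + 3 * M], so the main term [A * I + 3 * (A * M)] beats the error, which
   [moment4_le] bounds by [3 / 2 * (A * M)]. *)
pose kap := 1 + 3 * M / I.
have kap1 : 1 <= kap by rewrite lerDl divr_ge0 ?mulr_ge0// ltW.
have kap0 : 0 < kap by exact: lt_le_trans kap1.
exists kap => //.
pose A := \int[mu]_xi smoment kap 2 xi; pose B := \int[mu]_xi smoment kap 4 xi.
have A0 : 0 < A by exact: moment2_gt0.
have BA : kap * B <= 3 * A by exact: moment4_le.
have mK : measurable_fun setT (fun z : plane R => skernel kap z.2).
  by apply: (meas_snd (f := skernel kap)); apply: cont_meas; exact: skernel_cont.
have iK : L1 (leb2 R) (fun z => skernel kap z.2 * iV z).
  by apply: (L1Mb (C := A) mK _ L1_iV) => z; exact: (skernel_dom kap0 z.2 (lexx kap)).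
have i1 : L1 (leb2 R) (fun z => A * iV z) by exact: L1Z.
have i2 : L1 (leb2 R) (fun z => (B / 2) * (z.2 ^+ 2 * iV z)) by exact: (L1Z _ L1_x2V).
apply: (@lt_le_trans _ _ (\int[leb2 R]_z (A * iV z - (B / 2) * (z.2 ^+ 2 * iV z)))).
  rewrite (RintB i1 i2) (RintZ A L1_iV) (RintZ (B / 2) L1_x2V) -/I -/M.
  rewrite -(pmulr_rgt0 _ kap0) mulrBr.
  have Ek : kap * I = I + 3 * M by rewrite /kap; field; rewrite gt_eqF.
  have H1 : kap * (B / 2 * M) <= 3 / 2 * (A * M) by nra.
  have H2 : kap * (A * I) = A * I + 3 * (A * M) by rewrite mulrCA Ek; ring.
  have H3 : 0 < A * I by exact: mulr_gt0.
  have H4 : 0 <= A * M by rewrite mulr_ge0// ltW.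
  by rewrite H2; lra.
apply: le_Rint => //; first exact: (L1B i1 i2).
move=> z; have := skernel_ge kap0 z.2; rewrite -/A -/B => H.
rewrite [leLHS](_ : _ = (A - z.2 ^+ 2 / 2 * B) * iV z); last by field.
by rewrite ler_wpM2r.
Qed.

End barrier_limit.

(** * The coefficient, the source, and the contradiction *)

Section data.
Context {R : realType}.
Notation mu := (@lebesgue_measure R).

Lemma measurable_coef (c0 c1 : R) : measurable_fun setT (coef c0 c1 : measurableTypeR R -> R).
Proof.
rewrite (_ : coef c0 c1 = (fun y => a1 c0 c1 ^+ 2 +
    (1 - a1 c0 c1 ^+ 2) * \1_(`](- ystar c0), (ystar c0)[%classic : set R) y)).
  have mi : measurable_fun setT
      (\1_(`](- ystar c0), (ystar c0)[%classic : set R) : measurableTypeR R -> R).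
    by apply: measurable_indic; exact: measurable_itv.
  by apply: measurable_funD => //; apply: measurable_funM => //; exact: mi.
apply/funext => y; rewrite /coef ltr_norml; case: ifPn => yh.
  by rewrite indic_in ?in_itv// mulr1 addrC subrK.
by rewrite indic_notin ?mulr0 ?addr0//= in_itv/=; exact/negP.
Qed.

Lemma LpQ_source (p n : R) : 1 <= p -> 0 < n -> LpQ p (fun z : plane R => source n z.2).
Proof.
move=> p1 n0; have [C C0 HC] := source_om n0.
have mQ : measurable (@Q R).
  rewrite (_ : Q = setT `&` (fun z : plane R => z.1) @^-1` `]0, 1[%classic); last first.
    by apply/seteqP; split => z /=; rewrite in_itv/=; [split|case].
  by apply: measurable_fst => //; exact: measurable_itv.
have mf : measurable_fun setT ((fun z : plane R => source n z.2) \_ Q).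
  apply/(measurable_restrictT _ mQ); apply: measurable_funTS.
  by apply: (meas_snd (f := source n)); apply: cont_meas; exact: source_cont.
have i : L1 (leb2 R) (fun z => `|((fun z : plane R => source n z.2) \_ Q) z| `^ p).
  apply: (@L1_dom _ _ _ (leb2 R) (fun z => C `^ p * strip 1 z)).
  - by apply: (measurableT_comp (measurable_powR p)); exact: measurableT_comp.
  - move=> z; rewrite ger0_norm ?powR_ge0// patchE.
    have p0 : 0 < p by exact: lt_le_trans p1.
    have w0 := omega_gt0 z.2.
    case: ifPn => [/set_mem/andP[t0 t1]|_]; last first.
      by rewrite normr0 powR0 ?gt_eqF// mulr_ge0 ?powR_ge0//; have /andP[] := strip01 1 z.
    rewrite /strip indic_in ?mul1r; last by rewrite /= in_itv/=; apply/andP; split; lra.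
    apply: (@le_trans _ _ ((C * omega z.2) `^ p)).
      by apply: ge0_ler_powR; rewrite ?nnegrE ?mulr_ge0// ltW.
    rewrite powRM ?(ltW w0)// ler_wpM2l ?powR_ge0// ge1r_powR// w0/=.
    exact: omega_le1.
  - exact/L1Z/L1_strip.
rewrite /LpQ /LpR2; apply/andP; rewrite !inE; split => //=.
rewrite /finite_norm unlock /Lnorm.
rewrite (_ : (\int[leb2 R]_x _)%E =
    (\int[leb2 R]_x ((`|((fun z : plane R => source n z.2) \_ Q) x| `^ p)%R)%:E)%E).
  by rewrite Rint_EFin// poweR_EFin ltry.
by apply: eq_integral => x _; rewrite -poweR_EFin.
Qed.

End data.

Theorem theorem2p6 (R : realType) (gamma : R -> R)
    (gamma01 : forall q : R, 1 < q < 3 / 2 -> 0 < gamma q < 1)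
    (gamma_lt : forall q : R, 1 < q < 3 / 2 -> gamma q < 3 / q - 2)
    (gamma_lim : gamma q @[q --> (1 : R)^'+] --> (1 : R))
    (p : R) (p_gt3 : 3 < p) :
  exists a f : plane R -> R,
    [/\ frakA 1 (alpha_ gamma (p / (p - 1))) a, LpQ p f
      & ~ exists2 u : plane R -> R, calH1_0 p u & solves p a f u].
Proof.
have p0 : 0 < p by lra.
have p1 : 1 < p by lra.
have p1' : 0 < p - 1 by lra.
pose q := p / (p - 1).
have q1 : 1 < q by rewrite ltr_pdivlMr// mul1r gtrBl.
have q32 : 1 < q < 3 / 2.
  by rewrite q1/= ltr_pdivrMr//; lra.
have q0 : 0 < q by exact: lt_trans q1.
have pq : p^-1 + q^-1 = 1 by rewrite /q; field; rewrite !gt_eqF.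
pose g := gamma q; have g01 : 0 < g < 1 := gamma01 _ q32.
(* This is [g < 3 / q - 2] multiplied by [q / 2]. *)
have gq : - (3 / 2) < (- (g / 2) - 1) * q.
  have := gamma_lt _ q32; rewrite -/g ltrBrDr ltr_pdivlMr// => H.
  by move: H; lra.
have [c0_gt0 Uc0] := c0P g01; have [c1_gt0 Gc1] := c1P g01.
have c10 := c1_lt_c0 g01; have alE := beta_E g.
(* From here on only the sign of [c0] and [c1], their order and the vanishing of the second
   derivatives are used. *)
move: (c0 g) (c1 g) c0_gt0 Uc0 c1_gt0 Gc1 c10 alE => c0 c1 c0_gt0 Uc0 c1_gt0 Gc1 c10 alE.
have [Ch Ch0 hb] := prof_bound g01 c0_gt0 c1_gt0 Uc0 Gc1.
have dh := dprof g01 c0_gt0 c1_gt0 Uc0 Gc1.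
have dh1 := dprof1 g01 c0_gt0 c1_gt0 Uc0 Gc1.
have ch2 : continuous (prof2 g c0 c1) by exact: (prof2_cont g01 c0_gt0 c1_gt0 Uc0 Gc1).
have h_gt0 y : 0 < prof g c0 c1 y by exact: prof_gt0.
have hb0 y : `|prof g c0 c1 y| <= Ch * omega y ^+ 3 by have [] := hb y.
have ch := is_derive_continuous dh.
have [kap kap0 Kpos] := barrier_positive g01 ch h_gt0 Ch0 hb0.
have a1_1 : 1 <= a1 c0 c1 ^+ 2.
  by rewrite exprn_ege1// /a1 ler_pdivlMr// mul1r ltW.
have cf1 y : 1 <= coef c0 c1 y <= a1 c0 c1 ^+ 2.
  by rewrite /coef; case: ifP => _; rewrite lexx ?a1_1.
have mcf := measurable_coef c0 c1.
(* Chosen so that the source contributes exactly [kap] to the parameter of [skernel], the value for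
   which [barrier_positive] holds. *)
pose n := (4 * kap)^-1.
have n0 : 0 < n by rewrite invr_gt0 mulr_gt0.
have nk : (4 * n)^-1 = kap by rewrite /n; field; rewrite gt_eqF.
pose a (z : plane R) := coef c0 c1 (rescale z.1 z.2).
have ma : measurable_fun setT a by exact: (measurableT_comp mcf measurable_rescale).
have aK z : `|a z| <= a1 c0 c1 ^+ 2.
  by have /andP[h1 h2] := cf1 (rescale z.1 z.2); rewrite ger0_norm// (le_trans ler01).
exists a, (fun z => source n z.2); split.
- split; first exact: measurable_funTS.
  by move=> z _; rewrite /alpha_ -/q -/g alE; exact: cf1.
- exact: (LpQ_source (ltW p1) n0).
case=> u hu [ut [ux [hut uxp hx eqn]]].
pose c := - ((2 * pi)^-1 * (gmass n / (2 * n))) : R.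
have c_neq0 : c != 0.
  by rewrite oppr_eq0 gt_eqF// !mulr_gt0 ?invr_gt0 ?mulr_gt0 ?gmass_gt0 ?pi_gt0.
have vp : LpR2 p (ux \_ Q) := uxp.
have Z : c * \int[leb2 R]_z (skernel kap z.2 * (\1_(`]0, 1[%classic : set R) z.1 *
    barrier g (prof g c0 c1) z.1 z.2)) = 0.
  apply: (barrier_limit g01 ch h_gt0 Ch0 hb0 p1 q1 pq gq vp kap0) => d d01.
  have I := @barrier_identity R g g01 _ _ _ _ _ _ dh dh1 ch2
    (prof_ode c0_gt0 c1_gt0 Uc0) Ch0 hb mcf cf1 d d01 p (ltW p1) _ vp kap c kap0.
  apply: I => k y th dth M k0 dth_ cdth thT thM dthM.
  have T01 : 0 < 1 - d < 1 by case/andP: d01 => d0 d1; apply/andP; split; lra.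
  have := weak_identity p1 ma aK y k0 T01 dth_ cdth thT thM dthM hu hut uxp hx eqn.
  by rewrite source_Lam// nk.
by move/eqP: Z; rewrite mulf_eq0 (negbTE c_neq0)/= gt_eqF.
Qed.
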